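(* Let $d\ge 1$ and let $u_0:\mathbb{R}^d\to\mathbb{R}$ satisfy: $u_0\in C^{1,1}(\mathbb{R}^d)$, $\lim_{|x|\to\infty} u_0(x)/|x|=+\infty$, and there is $R_0>0$ such that $u_0=u_0^{**}$ outside $\overline{B}_{R_0}$. Let $$u(t,x):=\inf_{\sigma\,:\,|\sigma|\le 1}\ \mathbb{E}\Big(u_0\Big(x+\int_0^t\sqrt{2}\,\sigma_s\,dW_s\Big)\Big),\qquad t\ge 0,\ x\in\mathbb{R}^d.$$ Then there exist $C\ge 0$ and $\lambda>0$ such that $$\|u(t,\cdot)-u_0^{**}\|_{L^\infty}\le Ce^{-\lambda t}\quad\text{for all } t\ge 0,$$ and $$\|\nabla u(t,\cdot)-\nabla u_0^{**}\|_{L^\infty}\le Ce^{-\lambda t}\quad\text{for all } t\ge 0.$$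
   Context: $\overline{B}_R$ is the closed Euclidean ball of radius $R$ centered at $0$ in $\mathbb{R}^d$. $C^{1,1}(\mathbb{R}^d)$ is the set of $C^1$ functions with (globally) Lipschitz gradient. $u_0^{**}$ is the convex envelope of $u_0$, i.e. the largest convex function on $\mathbb{R}^d$ that is everywhere $\le u_0$. $(W_s)_{s\ge0}$ is a standard $d$-dimensional Brownian motion; the infimum is over all $d\times d$-matrix-valued processes $\sigma$ adapted to the Brownian filtration (progressively measurable, so that the stochastic integral is defined) with $|\sigma_s|\le1$ for all $s$, where $|\sigma|:=\sqrt{\mathrm{Tr}(\sigma\sigma^T)}$. This $u$ is the continuous viscosity solution, with initial datum $u_0$ and agreeing with $u_0^{**}$ outside $B_{R_0}$ (the open ball), of $\partial_t u=\min(0,\lambda_1(D^2u))$, where $\lambda_1$ is the smallest eigenvalue. $\nabla$ denotes the gradient in $x$ (under these assumptions $u(t,\cdot)$ and $u_0^{**}$ are $C^{1,1}$), and $L^\infty=L^\infty(\mathbb{R}^d)$. *)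

(* Defs.v *)
From HB Require Import structures.
From mathcomp Require Import all_boot all_order all_algebra.
From mathcomp Require Import all_classical all_reals all_analysis.
Import Order.TTheory GRing.Theory Num.Theory.
Import numFieldNormedType.Exports.

Set Implicit Arguments.
Unset Strict Implicit.
Unset Printing Implicit Defensive.

Local Open Scope classical_set_scope.
Local Open Scope ring_scope.

(* Points of R^d are row vectors.  The library norm of 'rV[R]_d is the sup
   norm, hence the explicit Euclidean norm; differentiability does not depend
   on this choice. *)
Definition enorm (R : realType) (d : nat) (x : 'rV[R]_d) : R :=
  Num.sqrt (\sum_(i < d) x 0 i ^+ 2).

(* |A| = sqrt (Tr (A A^T)) *)
Definition frobenius (R : realType) (d : nat) (A : 'M[R]_d) : R :=
  Num.sqrt (\tr (A *m A^T)).

(* Meaningful where f is differentiable; elsewhere 'D_v takes junk values. *)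
Definition gradient (R : realType) (d : nat) (f : 'rV[R]_d -> R)
    (x : 'rV[R]_d) : 'rV[R]_d :=
  \row_(i < d) 'D_(delta_mx 0 i) f x.

(* Continuity of the gradient follows from the Lipschitz condition. *)
Definition C11 (R : realType) (d : nat) (f : 'rV[R]_d -> R) : Prop :=
  (forall x, differentiable f x) /\
  exists L : R, forall x y,
    enorm (gradient f x - gradient f y) <= L * enorm (x - y).

Definition superlinear (R : realType) (d : nat) (f : 'rV[R]_d -> R) : Prop :=
  forall A : R, exists r : R,
    forall x, r < enorm x -> A <= f x / enorm x.

(* A pointwise supremum of convex functions is convex, so whenever f has a
   convex minorant this is the largest one. *)
Definition convex_envelope (R : realType) (d : nat) (f : 'rV[R]_d -> R)
    (x : 'rV[R]_d) : R :=
  sup [set y | exists h : 'rV[R]_d -> R,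
    [/\ convex_function [set: 'rV[R]_d] h,
        (forall z, h z <= f z) & y = h x]].

(* Null sets of d-dimensional Lebesgue measure, through its outer measure:
   for every e > 0 there is a countable cover by boxes of total volume at
   most e. *)
Definition lebesgue_null (R : realType) (d : nat) (A : set 'rV[R]_d) : Prop :=
  forall e : R, 0 < e -> exists a b : nat -> 'rV[R]_d,
    [/\ forall k i, a k 0 i <= b k 0 i,
        A `<=` \bigcup_k [set x | forall i, a k 0 i <= x 0 i <= b k 0 i] &
        (\sum_(0 <= k <oo) (\prod_(i < d) (b k 0 i - a k 0 i))%:E <= e%:E)%E].

Definition Linfty_norm (R : realType) (d : nat) (f : 'rV[R]_d -> R) : \bar R :=
  ereal_inf [set M%:E | M in
    [set M : R | 0 <= M /\ lebesgue_null [set x | M < `|f x|]]].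

Section stochastic_control.
Context (R : realType) (d : nat) (dO : measure_display)
  (Omega : measurableType dO) (P : probability Omega R).
Implicit Types (W : R -> Omega -> 'rV[R]_d) (sigma : R -> Omega -> 'M[R]_d).

(* The sigma-algebra generated by this class is that of (W_s)_{0 <= s <= t}. *)
Definition past_events W (t : R) : set (set Omega) :=
  [set A | exists s i (B : set R),
    [/\ 0 <= s <= t, measurable B & A = (fun w => W s w 0 i) @^-1` B]].

Definition brownian_filtration W (t : R) : set (set Omega) :=
  <<s past_events W t >>.

(* The last clause says at once that W_t - W_s is independent of the past up
   to s and that its law is that of d independent N(0, t - s) variables; the
   second parameter of normal_prob is the standard deviation. *)
Definition standard_brownian_motion W : Prop :=
  [/\ forall (t : R) i, 0 <= t -> measurable_fun [set: Omega] (fun w => W t w 0 i),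
      {ae P, forall w, W 0 w = 0},
      {ae P, forall w, {within `[0, +oo[, continuous (fun t => W t w)}} &
      forall s t : R, 0 <= s -> s < t ->
      forall A, brownian_filtration W s A ->
      forall B : 'I_d -> set R, (forall i, measurable (B i)) ->
      P (A `&` [set w | forall i, B i (W t w 0 i - W s w 0 i)]) =
      (P A * \prod_(i < d) normal_prob 0 (Num.sqrt (t - s)) (B i))%E].

Definition progressively_measurable W sigma : Prop :=
  forall t : R, 0 <= t -> forall i j,
    measurable_fun
      (`[0, t] `*` [set: Omega] :
         set (R * g_sigma_algebraType (past_events W t))%type)
      (fun p => sigma p.1 p.2 i j : R).

(* The process equal to [level k] on ]knot k, knot k.+1], for k < steps. *)
Record step_process := StepProcess {
  steps : nat;
  knot : nat -> R;
  level : nat -> Omega -> 'M[R]_d }.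

Definition elementary W (t : R) (S : step_process) : Prop :=
  [/\ knot S 0%N = 0, knot S (steps S) = t,
      forall k, (k < steps S)%N -> knot S k <= knot S k.+1,
      forall k i j, (k < steps S)%N ->
        measurable_fun
          ([set: Omega] : set (g_sigma_algebraType (past_events W (knot S k))))
          (fun w => level S k w i j : R) &
      exists M : R, forall k w, (k < steps S)%N ->
        frobenius (level S k w) <= M].

Definition step_value (S : step_process) (s : R) (w : Omega) : 'M[R]_d :=
  \sum_(k < steps S) (knot S k < s <= knot S k.+1)%R%:R *: level S k w.

(* Vectors being rows, "sigma dW" reads "dW *m sigma^T". *)
Definition step_integral W (S : step_process) (w : Omega) : 'rV[R]_d :=
  \sum_(k < steps S) (W (knot S k.+1) w - W (knot S k) w) *m (level S k w)^T.

(* X is (a version of) the Ito integral of sigma against W over [0, t]: the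
   L^2 limit of the integrals of elementary processes converging to sigma in
   L^2([0, t] x Omega). *)
Definition is_ito_integral W sigma (t : R) (X : Omega -> 'rV[R]_d) : Prop :=
  (forall i, measurable_fun [set: Omega] (fun w => X w 0 i)) /\
  exists S : nat -> step_process,
    [/\ forall n, elementary W t (S n),
        (fun n => \int[P]_w \int[lebesgue_measure]_(s in `[0%R, t])
           (frobenius (step_value (S n) s w - sigma s w)%R ^+ 2)%:E)%E
          @ \oo --> 0%E &
        (fun n => 'E_P[fun w => (enorm (step_integral W (S n) w - X w) ^+ 2)%R])%E
          @ \oo --> 0%E].

Definition admissible_control W sigma : Prop :=
  progressively_measurable W sigma /\
  forall s w, 0 <= s -> frobenius (sigma s w) <= 1.

Definition value_function W (u0 : 'rV[R]_d -> R) (t : R) (x : 'rV[R]_d) : R :=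
  fine (ereal_inf [set y : \bar R | exists sigma X,
    [/\ admissible_control W sigma, is_ito_integral W sigma t X &
        y = ('E_P[fun w => u0 (x + Num.sqrt 2 *: X w)%R])%E]]).

End stochastic_control.

(* Main.v *)
Require Import Defs.
From HB Require Import structures.
From mathcomp Require Import all_boot all_order all_algebra.
From mathcomp Require Import all_classical all_reals all_analysis.
From mathcomp Require Import measurable_realfun normal_distribution random_variable.
From mathcomp Require Import ring lra.
Import Order.TTheory GRing.Theory Num.Theory.
Import numFieldNormedType.Exports.

Set Implicit Arguments.
Unset Strict Implicit.
Unset Printing Implicit Defensive.

Local Open Scope classical_set_scope.
Local Open Scope ring_scope.

(** The control problem is solved backwards by the one-step operator
    [opT h f x = inf_s E f (x + W_h s^T)], the infimum being over constant
    matrices of Frobenius norm at most sqrt 2: the value function is the limit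
    [limval] of the dyadic iterates of [opT] on [u0].

    Decay.  By Caratheodory, up to an arbitrarily small error, [u0^** x] is
    [\sum_i q_i u0 (p_i)] with [x = \sum_i q_i p_i], where the [d + 1] points
    [p_i] can be pulled back to a bounded set because [u0 = u0^**] far away.
    Steer [x = \sum_i q_i p_i] along a single Brownian coordinate [g] so that
    the weights become [q_i (1 + g (a_i - \sum_j q_j a_j))] with distinct [a_i]:
    [\sum_i q_i u0 (p_i)] is a martingale, while
    [\sum_(i <> j) sqrt (q_i q_j)] contracts at an exponential rate.  As [u0]
    is C^{1,1}, the latter sum dominates [u0 x - \sum_i q_i u0 (p_i)].

    Gradients.  [opT] preserves semiconcavity.  Since waiting a time [h] costs
    at most [c0 h], a maximum-principle argument on segments shows that
    [limval t] is also semiconvex, uniformly in [t].  Hence [u t - u0^**] is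
    nonnegative, of size e^{-lam t} and has uniformly bounded second order
    remainders, so that its gradient is of size e^{-lam t / 2}. *)

(** * Expectations and discretisation *)

(** The obstacle is that an admissible control is only an L^2 limit of elementary processes, whose
    knots are arbitrary and whose levels may leave the unit ball. Conditioning on the past becomes
    independence of Gaussian increments, tested on the cells of a rounding.

    The contraction comes from the concavity of the square root. For weights tilted by 1 + g t_i
    with |g t_i| <= 1, the mean over the two signs of g of sqrt ((1 + g t_i) (1 + g t_j)) is at most
    1 - g^2 (t_i - t_j)^2 / 8, and t_i - t_j = a_i - a_j is the same for all weights, so the rate is
    uniform. Large increments add an error O(h^2) per step, which vanishes when summed over t / h
    steps.

    Semiconcavity of u0^** is a by-product of the decay: [limval t] inherits the constant of u0 for
    every t, and u0^** is its limit as t tends to infinity. *)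

Section expectation_api.
Context (R : realType) (dO : measure_display) (Omega : measurableType dO)
  (P : probability Omega R).
Implicit Types (X Y Z : Omega -> R).

(** Real-valued, hence meaningful only for integrable variables; this is what the [intg] side
    conditions below record. *)
Definition mean X : R := (\int[P]_w X w)%R.
Definition intg X := P.-integrable [set: Omega] (EFin \o X).

Lemma intg_meas X : intg X -> measurable_fun [set: Omega] X.
Proof. by move=> /measurable_int /measurable_EFinP. Qed.

Lemma intg_cst c : intg (fun=> c).
Proof. exact: finite_measure_integrable_cst. Qed.

Lemma intgD X Y : intg X -> intg Y -> intg (fun w => X w + Y w).
Proof. by move=> iX iY; apply: (eq_integrable measurableT _ _ _ (integrableD measurableT iX iY)). Qed.

Lemma intgN X : intg X -> intg (fun w => - X w).
Proof. by move=> iX; apply: (eq_integrable measurableT _ _ _ (integrableN iX)). Qed.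

Lemma intgB X Y : intg X -> intg Y -> intg (fun w => X w - Y w).
Proof. by move=> iX iY; exact: intgD iX (intgN iY). Qed.

Lemma intgZ c X : intg X -> intg (fun w => c * X w).
Proof. by move=> iX; apply: (eq_integrable measurableT _ _ _ (integrableZl measurableT c iX)). Qed.

Lemma intg_sum (I : Type) (s : seq I) (Q : pred I) (X : I -> Omega -> R) :
  (forall i, intg (X i)) -> intg (fun w => \sum_(i <- s | Q i) X i w).
Proof.
move=> iX; elim: s => [|i s IH].
  by apply: (eq_integrable measurableT _ _ _ (intg_cst 0)) => // w _; rewrite /= big_nil.
have iF : intg (fun w => (if Q i then X i w else 0) + \sum_(j <- s | Q j) X j w).
  by apply: intgD => //; case: (Q i) => //; exact: intg_cst.
apply: (eq_integrable measurableT _ _ _ iF) => // w _; rewrite /= big_cons.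
by case: (Q i) => //; rewrite add0r.
Qed.

Lemma intg_le X Y : measurable_fun [set: Omega] X ->
  (forall w, `|X w| <= Y w) -> intg Y -> intg X.
Proof.
move=> mX XY iY; apply: le_integrable iY => //; first exact/measurable_EFinP.
by move=> w _ /=; rewrite lee_fin (le_trans (XY w))// ler_norm.
Qed.

Lemma intg_norm X : intg X -> intg (fun w => `|X w|).
Proof. by move=> iX; exact: integrable_norm. Qed.

Lemma meanD X Y : intg X -> intg Y -> mean (fun w => X w + Y w) = mean X + mean Y.
Proof. by move=> iX iY; exact: RintegralD. Qed.

Lemma meanB X Y : intg X -> intg Y -> mean (fun w => X w - Y w) = mean X - mean Y.
Proof. by move=> iX iY; exact: RintegralB. Qed.

Lemma meanZ c X : intg X -> mean (fun w => c * X w) = c * mean X.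
Proof. by move=> iX; exact: RintegralZl. Qed.

Lemma mean_cst c : mean (fun=> c) = c.
Proof. by rewrite /mean Rintegral_cst//= probability_setT mulr1. Qed.

Lemma meanN X : intg X -> mean (fun w => - X w) = - mean X.
Proof.
move=> iX; rewrite -[RHS]mulN1r -meanZ//; congr mean.
by apply/funext => w; rewrite mulN1r.
Qed.

Lemma mean_sum (I : Type) (s : seq I) (Q : pred I) (X : I -> Omega -> R) :
  (forall i, intg (X i)) ->
  mean (fun w => \sum_(i <- s | Q i) X i w) = \sum_(i <- s | Q i) mean (X i).
Proof.
move=> iX; elim: s => [|i s IH].
  by rewrite big_nil -[RHS]mean_cst; congr mean; apply/funext => w; rewrite big_nil.
rewrite big_cons.
transitivity (mean (fun w =>
  (if Q i then X i w else 0) + \sum_(j <- s | Q j) X j w)).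
  congr mean; apply/funext => w; rewrite big_cons.
  by case: (Q i) => //; rewrite add0r.
rewrite meanD ?IH; last exact: intg_sum.
  by case: (Q i) => //; rewrite mean_cst add0r.
by case: (Q i) => //; exact: intg_cst.
Qed.

Lemma mean_le X Y : intg X -> intg Y -> (forall w, X w <= Y w) -> mean X <= mean Y.
Proof. by move=> iX iY XY; apply: le_Rintegral. Qed.

Lemma mean_ge0 X : (forall w, 0 <= X w) -> 0 <= mean X.
Proof. by move=> X0; exact: Rintegral_ge0. Qed.

Lemma mean_norm_le X : intg X -> `|mean X| <= mean (fun w => `|X w|).
Proof. by move=> iX; exact: le_normr_Rintegral. Qed.

Lemma mean_dct (X : nat -> Omega -> R) Y Z :
  (forall n, measurable_fun [set: Omega] (X n)) ->
  (forall w, X n w @[n --> \oo] --> Y w) ->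
  intg Z -> (forall n w, `|X n w| <= Z w) ->
  intg Y /\ mean (X n) @[n --> \oo] --> mean Y.
Proof.
move=> mX XY iZ XZ.
have mY : measurable_fun [set: Omega] Y by apply: (measurable_fun_cvg mX) => w _; exact: XY.
have [] := @dominated_convergence _ _ _ P setT measurableT
  (fun n => EFin \o X n) (EFin \o Y) (EFin \o Z).
- by move=> n; exact/measurable_EFinP.
- exact/measurable_EFinP.
- by apply: aeW => w _; apply: cvg_EFin; [exact: nearW|exact: XY].
- exact: iZ.
- by apply: aeW => w n _ /=; rewrite lee_fin.
move=> iY _ cv; split => //.
have iX n : intg (X n) by exact: intg_le iZ.
apply: (@fine_cvg _ _ _ _ (fun n => \int[P]_w (X n w)%:E)%E).
rewrite fineK//; last exact: integrable_fin_num.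
Qed.

Lemma EFin_mean X : intg X -> (\int[P]_w (X w)%:E)%E = (mean X)%:E.
Proof. by move=> iX; rewrite fineK//; exact: integrable_fin_num. Qed.

Lemma expectation_mean X : intg X -> ('E_P[X])%E = (mean X)%:E.
Proof. by move=> iX; rewrite unlock EFin_mean. Qed.

Lemma mean_indic (A : set Omega) : measurable A -> mean (\1_A) = fine (P A).
Proof. by move=> mA; rewrite /mean /Rintegral integral_indic// setIT. Qed.

Lemma intg_indic (A : set Omega) : measurable A -> intg (\1_A).
Proof. by move=> mA; apply: integrable_indic. Qed.

End expectation_api.

Section discretisation.
Context (R : realType).

(* [round n] truncates to [-n, n] and rounds towards 0 to a multiple of 1/n. It
   has finitely many values (coded by sign and numerator), so that measurability
   and independence of f (Y) reduce to finite sums. *)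
Definition cell (n : nat) : finType := (bool * 'I_(n * n).+1)%type.

Definition cell_of n (y : R) : cell n :=
  (y < 0, inord (Num.truncn (Num.min `|y| n%:R * n%:R))).

Definition cell_val n (c : cell n) : R := (-1) ^+ c.1 * (c.2%:R / n%:R).

Definition round n (y : R) : R := cell_val (cell_of n y).

Lemma truncn_cell n (y : R) :
  (Num.truncn (Num.min `|y| n%:R * n%:R)%R < (n * n).+1)%N.
Proof.
rewrite ltnS truncn_le_nat (@le_lt_trans _ _ (n * n)%:R)//; last by rewrite ltr_nat.
by rewrite natrM ler_wpM2r// ge_min lexx orbT.
Qed.

Lemma cell_of2 n y : ((cell_of n y).2 : nat) = Num.truncn (Num.min `|y| n%:R * n%:R).
Proof. by rewrite /cell_of /= inordK// truncn_cell. Qed.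

Lemma norm_round n y : `|round n y| =
  (Num.truncn (Num.min `|y| n%:R * n%:R))%:R / n%:R.
Proof.
rewrite /round /cell_val normrM normrX normrN1 expr1n mul1r cell_of2.
by rewrite ger0_norm// divr_ge0.
Qed.

Lemma round_le n y : `|round n y| <= `|y|.
Proof.
rewrite norm_round; case: n => [|n]; first by rewrite invr0 mulr0.
rewrite ler_pdivrMr// (@le_trans _ _ (Num.min `|y| n.+1%:R * n.+1%:R))//.
  by rewrite truncn_le mulr_ge0// le_min normr_ge0 ler0n.
by rewrite ler_wpM2r// ge_min lexx.
Qed.

Lemma round_near n y : (0 < n)%N -> `|y| <= n%:R -> `|round n y - y| <= n%:R^-1.
Proof.
move=> n0 yn; have n0' : 0 < n%:R :> R by rewrite ltr0n.
rewrite /round /cell_val cell_of2 (min_idPl yn) /=.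
have /andP[] := @truncn_itv _ (`|y| * n%:R) (mulr_ge0 (normr_ge0 _) (ler0n _ _)).
set k := Num.truncn _ => k1 k2.
have h1 : k%:R / n%:R <= `|y| by rewrite ler_pdivrMr.
have h2 : `|y| <= k%:R / n%:R + n%:R^-1.
  by rewrite -[X in _ <= _ + X]mul1r -mulrDl natr1 ler_pdivlMr// ltW.
rewrite ler_norml; case: ltP => y0; rewrite ?expr1 ?expr0.
  by move: h1 h2; rewrite ltr0_norm//; lra.
by move: h1 h2; rewrite ger0_norm//; lra.
Qed.

Lemma cvg_round (y : R) : round n y @[n --> \oo] --> y.
Proof.
apply/cvgrPdist_le => e e0; near=> n.
rewrite distrC (le_trans (round_near _ _))//.
- near: n; exact: nbhs_infty_gt.
- near: n; exact: nbhs_infty_ger.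
- rewrite -[e]invrK lef_pV2 ?posrE ?invr_gt0//.
    near: n; exact: nbhs_infty_ger.
  by rewrite ltr0n; near: n; exact: nbhs_infty_gt.
Unshelve. all: by end_near. Qed.

Lemma measurable_cell n (c : cell n) : measurable (cell_of n @^-1` [set c]).
Proof.
case: c => b k.
have -> : cell_of n @^-1` [set (b, k)] =
    (if b then `]-oo, 0[%classic else `[0, +oo[%classic) `&`
    (fun y : R => Num.min `|y| n%:R * n%:R) @^-1` `[(k : nat)%:R, (k : nat).+1%:R[%classic.
  apply/seteqP; split => y /=.
    move=> [<- <-] /=; rewrite inordK; last exact: truncn_cell.
    split; first by case: ltP => y0 /=; rewrite in_itv/= ?andbT.
    by rewrite /= in_itv/= truncn_itv// mulr_ge0// le_min normr_ge0 ler0n.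
  move=> [yb]; rewrite in_itv/= => yk; congr pair.
    case: b yb => /=; rewrite in_itv/= ?andbT => yb; first exact: yb.
    by apply/negbTE; rewrite -leNgt.
  apply: val_inj; rewrite /= inordK; last exact: truncn_cell.
  by apply/eqP; rewrite truncn_eq// mulr_ge0// le_min normr_ge0 ler0n.
apply: measurableI; first by case: b.
have mf : measurable_fun [set: R] (fun y : R => Num.min `|y| n%:R * n%:R).
  apply: measurable_funM => //.
  by apply: (@measurable_minr _ _ R setT (@Num.norm R R) (cst n%:R)).
by rewrite -[X in measurable X]setTI; exact: mf.
Qed.

Definition mxcell n (p q : nat) : finType := {ffun 'I_p * 'I_q -> cell n}.

Definition mxcell_of n p q (A : 'M[R]_(p, q)) : mxcell n p q :=
  [ffun ij => cell_of n (A ij.1 ij.2)].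

Definition mxcell_val n p q (c : mxcell n p q) : 'M[R]_(p, q) :=
  \matrix_(i, j) cell_val (c (i, j)).

Definition mxround n p q (A : 'M[R]_(p, q)) : 'M[R]_(p, q) :=
  mxcell_val (mxcell_of n A).

Lemma mxroundE n p q (A : 'M[R]_(p, q)) i j : mxround n A i j = round n (A i j).
Proof. by rewrite mxE ffunE. Qed.

Lemma mx_entry_le p q (A : 'M[R]_(p, q)) i j : `|A i j| <= `|A|.
Proof.
rewrite [leRHS]/Num.norm/= mx_normrE.
exact: (@le_bigmax _ _ _ 0 (fun ij => `|A ij.1 ij.2|) (i, j)).
Qed.

Lemma mx_norm_le p q (A : 'M[R]_(p, q)) c : 0 <= c ->
  (forall i j, `|A i j| <= c) -> `|A| <= c.
Proof. by move=> c0 h; rewrite /Num.norm/= mx_normrE; apply/bigmax_leP; split. Qed.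

Lemma mxround_le n p q (A : 'M[R]_(p, q)) : `|mxround n A| <= `|A|.
Proof.
apply: mx_norm_le => // i j; rewrite mxroundE.
exact: le_trans (round_le _ _) (mx_entry_le _ _ _).
Qed.

Lemma cvg_mxround p q (A : 'M[R]_(p, q)) : mxround n A @[n --> \oo] --> A.
Proof.
apply/cvgrPdist_le => e e0.
have : \forall n \near \oo, forall ij : 'I_p * 'I_q,
    `|A ij.1 ij.2 - round n (A ij.1 ij.2)| <= e.
  by apply: filter_forall => -[i j]; apply: (cvgrPdist_le _ _).1 => //; exact: cvg_round.
apply: filterS => n h; apply: mx_norm_le => [|i j]; first exact: ltW.
by have := h (i, j); rewrite !mxE ffunE.
Qed.

End discretisation.

Section measurability.
Context (R : realType).

(** Entrywise, to match the measurability clauses in the definitions of Brownian motion and of the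
    Ito integral. *)
Definition measmx d (T : measurableType d) p q (Y : T -> 'M[R]_(p, q)) :=
  forall i j, measurable_fun [set: T] (fun w => Y w i j).

Lemma measurable_mxcell d (T : measurableType d) p q (Y : T -> 'M[R]_(p, q)) n c :
  measmx Y -> measurable [set w | mxcell_of n (Y w) = c].
Proof.
move=> mY.
have -> : [set w | mxcell_of n (Y w) = c] =
    \bigcap_(ij in [set: 'I_p * 'I_q])
      (fun w => Y w ij.1 ij.2) @^-1` (@cell_of R n @^-1` [set c ij]).
  apply/seteqP; split => w /=; first by move=> <- ij _; rewrite ffunE.
  by move=> h; apply/ffunP => ij; rewrite ffunE; exact: h.
apply: fin_bigcap_measurable => [|ij _]; first exact: finite_finset.
rewrite -[X in measurable X]setTI.
by apply: (mY ij.1 ij.2) => //; exact: measurable_cell.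
Qed.

Lemma measurable_fin d (T : measurableType d) (K : finType) (Q : T -> K)
  (g : K -> R) : (forall k, measurable [set w | Q w = k]) ->
  measurable_fun [set: T] (fun w => g (Q w)).
Proof.
move=> mQ _ B mB; rewrite setTI.
have -> : (fun w => g (Q w)) @^-1` B =
    \bigcup_(k in [set k | B (g k)]) [set w | Q w = k].
  apply/seteqP; split => w /=; first by move=> h; exists (Q w).
  by move=> [k /= h ->].
by apply: fin_bigcup_measurable => //; exact: finite_finset.
Qed.

(* Local Lipschitz constants of linear growth: the class is stable under [opT] and
   makes f (Y) integrable as soon as Y is square integrable. *)
Definition lq (V : normedModType R) (f : V -> R) :=
  exists2 K : R, 0 <= K &
    forall x y, `|f x - f y| <= K * (1 + `|x| + `|y|) * `|x - y|.

Lemma lq_continuous (V : normedModType R) (f : V -> R) : lq f -> continuous f.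
Proof.
move=> [K K0 fK] x.
apply/cvgrPdist_le => e e0.
have C0 : 0 < K * (2 + `|x| + `|x|) + 1 by rewrite ltr_wpDl// mulr_ge0// !addr_ge0.
near=> y.
have h1 : `|x - y| <= 1 by near: y; apply: (cvgrPdist_le _ _).1.
have h2 : `|x - y| <= e / (K * (2 + `|x| + `|x|) + 1).
  by near: y; apply: (cvgrPdist_le _ _).1 => //; rewrite divr_gt0.
apply: (le_trans (fK _ _)).
apply: (@le_trans _ _ ((K * (2 + `|x| + `|x|) + 1) * `|x - y|)).
  rewrite ler_wpM2r// (@le_trans _ _ (K * (2 + `|x| + `|x|)))//; last by lra.
  rewrite ler_wpM2l//.
  have : `|y| <= `|x| + 1.
    rewrite -[y](subrK x) (le_trans (ler_normD _ _))// distrC; lra.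
  lra.
by rewrite mulrC -ler_pdivlMr.
Unshelve. all: by end_near. Qed.

Lemma lq_cvg (V : normedModType R) (f : V -> R) (y : nat -> V) (x : V) :
  lq f -> y n @[n --> \oo] --> x -> f (y n) @[n --> \oo] --> f x.
Proof. by move=> lf; apply: continuous_cvg; exact: lq_continuous. Qed.

Lemma measurable_lq d (T : measurableType d) p q (Y : T -> 'M[R]_(p, q)) f :
  measmx Y -> lq f -> measurable_fun [set: T] (fun w => f (Y w)).
Proof.
move=> mY lf.
apply: (@measurable_fun_cvg _ _ _ _ (fun n w => f (mxround n (Y w)))).
  move=> n; apply: (measurable_fin (Q := fun w => mxcell_of n (Y w))
    (fun c => f (mxcell_val R c))) => k; exact: measurable_mxcell.
by move=> w _; apply: lq_cvg => //; exact: cvg_mxround.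
Qed.

Lemma lq_quad (V : normedModType R) (f : V -> R) : lq f ->
  exists2 K : R, 0 <= K & forall x, `|f x| <= K * (1 + `|x| ^+ 2).
Proof.
move=> [K K0 fK]; exists (`|f 0| + 2 * K).
  by rewrite addr_ge0// mulr_ge0.
move=> x; have := fK x 0; rewrite normr0 subr0 addr0 => h.
have : `|f x| <= `|f 0| + K * (1 + `|x|) * `|x|.
  rewrite -{1}[f x](subrK (f 0)) (le_trans (ler_normD _ _))// addrC lerD2l//.
move/le_trans; apply.
rewrite mulrDl lerD//.
  by rewrite ler_peMr// lerDl sqr_ge0.
rewrite -mulrA [2 * K]mulrC -mulrA ler_wpM2l//.
have := normr_ge0 x; have := sqr_ge0 (`|x| - 1); nra.
Qed.

End measurability.

Section matrix_norms.
Context (R : realType).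

Lemma sqrD_le (a b : R) : (a + b) ^+ 2 <= 2 * a ^+ 2 + 2 * b ^+ 2.
Proof. have := sqr_ge0 (a - b); nra. Qed.

Lemma mulmx_norm_le p q r (A : 'M[R]_(p, q)) (B : 'M[R]_(q, r)) :
  `|A *m B| <= q%:R * `|A| * `|B|.
Proof.
apply: mx_norm_le => [|i j]; first by rewrite !mulr_ge0.
rewrite mxE (le_trans (ler_norm_sum _ _ _))//.
apply: (@le_trans _ _ (\sum_(k < q) `|A| * `|B|)).
  by apply: ler_sum => k _; rewrite normrM ler_pM// mx_entry_le.
by rewrite sumr_const card_ord -mulrA mulr_natl.
Qed.

Lemma norm_trmx p q (A : 'M[R]_(p, q)) : `|A^T| = `|A|.
Proof.
apply/eqP; rewrite eq_le; apply/andP; split.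
  by apply: mx_norm_le => // i j; rewrite mxE mx_entry_le.
by apply: mx_norm_le => // i j; have := mx_entry_le A^T j i; rewrite mxE.
Qed.

Lemma frobeniusE d (A : 'M[R]_d) :
  frobenius A = Num.sqrt (\sum_i \sum_j A i j ^+ 2).
Proof.
congr Num.sqrt; apply: eq_bigr => i _; rewrite mxE.
by apply: eq_bigr => j _; rewrite mxE expr2.
Qed.

Lemma frobenius_sq d (A : 'M[R]_d) : frobenius A ^+ 2 = \sum_i \sum_j A i j ^+ 2.
Proof.
by rewrite frobeniusE sqr_sqrtr// sumr_ge0// => i _; rewrite sumr_ge0// => j _; rewrite sqr_ge0.
Qed.

Lemma frobenius_ge0 d (A : 'M[R]_d) : 0 <= frobenius A.
Proof. exact: sqrtr_ge0. Qed.

Lemma frobenius_round d n (A : 'M[R]_d) : frobenius (mxround n A) <= frobenius A.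
Proof.
rewrite !frobeniusE ler_wsqrtr//; apply: ler_sum => i _; apply: ler_sum => j _.
by rewrite mxroundE -[leLHS]real_normK ?num_real// -[leRHS]real_normK ?num_real// ler_sqr ?nnegrE// round_le.
Qed.

Lemma mx_norm_frobenius d (A : 'M[R]_d) : `|A| <= frobenius A.
Proof.
apply: mx_norm_le => [|i j]; first exact: frobenius_ge0.
rewrite -ler_sqr ?nnegrE ?frobenius_ge0// real_normK ?num_real//.
rewrite frobenius_sq (bigD1 i)//= (bigD1 j)//= -addrA lerDl addr_ge0//.
  by rewrite sumr_ge0// => k _; rewrite sqr_ge0.
by rewrite sumr_ge0// => k _; rewrite sumr_ge0// => l _; rewrite sqr_ge0.
Qed.

Lemma lq_comp (V U : normedModType R) (f : U -> R) (h : V -> U) (C : R) :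
  lq f -> (forall x y, `|h x - h y| <= C * `|x - y|) -> lq (fun x => f (h x)).
Proof.
move=> [K K0 fK] hC; exists (K * (1 + 2 * `|h 0| + `|C|) * `|C|).
  by rewrite !mulr_ge0// !addr_ge0// mulr_ge0.
move=> x y; apply: (le_trans (fK _ _)).
have hle z : `|h z| <= `|h 0| + `|C| * `|z|.
  rewrite -{1}[h z](subrK (h 0)) addrC (le_trans (ler_normD _ _))// lerD2l.
  by apply: (le_trans (hC _ _)); rewrite subr0 ler_wpM2r// ler_norm.
rewrite -!mulrA ler_wpM2l//.
apply: (@le_trans _ _ ((1 + `|h x| + `|h y|) * (`|C| * `|x - y|))).
  apply: ler_wpM2l; first by rewrite !addr_ge0.
  by apply: (le_trans (hC _ _)); rewrite ler_wpM2r// ler_norm.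
rewrite [leRHS](_ : _ = ((1 + 2 * `|h 0| + `|C|) * (1 + `|x| + `|y|)) * (`|C| * `|x - y|)); last by ring.
apply: ler_wpM2r; first by rewrite mulr_ge0.
have := hle x; have := hle y; have := normr_ge0 x; have := normr_ge0 y.
have := normr_ge0 (h 0); have := normr_ge0 C; nra.
Qed.

End matrix_norms.

(** * Independence from the past *)

Section independence.
Context (R : realType) (dO : measure_display) (Omega : measurableType dO)
  (P : probability Omega R).
Local Notation Ex := (mean P).
Local Notation intg := (intg P).

(** In this finite form, independence is a mere factorisation of probabilities. *)
Lemma mean_fin (K : finType) (Q : Omega -> K) (g : K -> R) (A : set Omega) :
  measurable A -> (forall k, measurable [set w | Q w = k]) ->
  Ex (fun w => \1_A w * g (Q w)) =
  \sum_k g k * fine (P (A `&` [set w | Q w = k])).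
Proof.
move=> mA mQ.
have mAQ k : measurable (A `&` [set w | Q w = k]) by exact: measurableI.
transitivity (Ex (fun w => \sum_k g k * \1_(A `&` [set w | Q w = k]) w)).
  congr Ex; apply/funext => w; rewrite (bigD1 (Q w))//= big1 ?addr0.
    rewrite mulrC !indicE; congr (_ * _%:R).
    by rewrite in_setI; congr nat_of_bool; rewrite [X in _ && X]mem_set ?andbT.
  move=> k kQ; rewrite indicE in_setI [X in _ && X](_ : _ = false) ?andbF ?mulr0//.
  by apply/negbTE/negP; rewrite inE /= => e; rewrite e eqxx in kQ.
rewrite mean_sum => [|k]; last by apply: intgZ; exact: intg_indic.
by apply: eq_bigr => k _; rewrite meanZ ?mean_indic//; exact: intg_indic.
Qed.

Definition l2 p q (Y : Omega -> 'M[R]_(p, q)) :=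
  measmx Y /\ intg (fun w => `|Y w| ^+ 2).

Lemma intg_lq p q (Y : Omega -> 'M[R]_(p, q)) f : l2 Y -> lq f ->
  intg (fun w => f (Y w)).
Proof.
move=> [mY iY] lf; have [K K0 fK] := lq_quad lf.
apply: (intg_le (Y := fun w => K * (1 + `|Y w| ^+ 2))) => //.
  exact: measurable_lq.
by apply/intgZ/intgD => //; exact: intg_cst.
Qed.

Definition box d (N : Omega -> 'rV[R]_d) (B : 'I_d -> set R) : set Omega :=
  [set w | forall i, B i (N w 0 i)].

Lemma mxcell_box d (N : Omega -> 'rV[R]_d) n c :
  [set w | mxcell_of n (N w) = c] = box N (fun i => @cell_of R n @^-1` [set c (0, i)]).
Proof.
apply/seteqP; split => w /=; first by move=> <- i; rewrite /= ffunE.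
by move=> h; apply/ffunP => -[i j]; rewrite ffunE /= ord1; exact: h.
Qed.

(* Independence is only needed, and only assumed, on boxes: they contain the cells
   of the rounding, and phi (N) is the limit of phi (mxround n N). *)
Lemma indepE d (N N' : Omega -> 'rV[R]_d) (A : set Omega) (phi : 'rV[R]_d -> R) :
  measurable A -> l2 N -> l2 N' ->
  (forall B, (forall i, measurable (B i)) ->
    P (A `&` box N B) = (P A * P (box N' B))%E) ->
  lq phi ->
  Ex (fun w => \1_A w * phi (N w)) = fine (P A) * Ex (fun w => phi (N' w)).
Proof.
move=> mA lN lN' Hind lphi.
have [K K0 phiK] := lq_quad lphi.
have stepn n : Ex (fun w => \1_A w * phi (mxround n (N w))) =
    fine (P A) * Ex (fun w => phi (mxround n (N' w))).
  have := @mean_fin _ (fun w => mxcell_of n (N w)) (fun c => phi (mxcell_val R c)) A mA.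
  rewrite -/(mxround _ _) => -> => [|k]; last by apply: measurable_mxcell; case: lN.
  have := @mean_fin _ (fun w => mxcell_of n (N' w)) (fun c => phi (mxcell_val R c)) setT measurableT.
  rewrite (_ : (fun w => _ * _) = (fun w => phi (mxround n (N' w)))); last first.
    by apply/funext => w; rewrite indicT mul1r.
  move=> -> => [|k]; last by apply: measurable_mxcell; case: lN'.
  rewrite big_distrr/=; apply: eq_bigr => c _; rewrite [RHS]mulrCA; congr (_ * _).
  rewrite mxcell_box Hind ?mxcell_box ?setTI; last by move=> i; exact: measurable_cell.
  have mb : measurable (box N' (fun i => cell_of (R:=R) n @^-1` [set c (0, i)])).
    by rewrite -mxcell_box; apply: measurable_mxcell; case: lN'.
  by rewrite fineM//; apply: fin_num_measure.
have dom (Y : Omega -> 'rV[R]_d) n w : `|phi (mxround n (Y w))| <= K * (1 + `|Y w| ^+ 2).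
  apply: (le_trans (phiK _)); rewrite ler_wpM2l// lerD2l ler_sqr ?nnegrE//.
  exact: mxround_le.
have mround (Y : Omega -> 'rV[R]_d) n : l2 Y ->
    measurable_fun [set: Omega] (fun w => phi (mxround n (Y w))).
  move=> [mY _]; apply: (measurable_fin (Q := fun w => mxcell_of n (Y w))
    (fun c => phi (mxcell_val R c))) => k; exact: measurable_mxcell.
have iD (Y : Omega -> 'rV[R]_d) : l2 Y -> intg (fun w => K * (1 + `|Y w| ^+ 2)).
  by move=> [_ iY]; apply/intgZ/intgD => //; exact: intg_cst.
have [_ c1] : intg (fun w => \1_A w * phi (N w)) /\
    Ex (fun w => \1_A w * phi (mxround n (N w))) @[n --> \oo] -->
    Ex (fun w => \1_A w * phi (N w)).
  apply: (mean_dct (Z := fun w => K * (1 + `|N w| ^+ 2))); last 2 first.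
  - exact: iD.
  - move=> n w; rewrite normrM (le_trans _ (dom N n w))// ler_piMl//.
    by rewrite indicE; case: (_ \in _); rewrite ?normr1 ?normr0.
  - by move=> n; apply: measurable_funM => //; exact: mround.
  - by move=> w; apply: cvgMr; apply: lq_cvg => //; exact: cvg_mxround.
have [_ c2] : intg (fun w => phi (N' w)) /\
    Ex (fun w => phi (mxround n (N' w))) @[n --> \oo] --> Ex (fun w => phi (N' w)).
  apply: (mean_dct (Z := fun w => K * (1 + `|N' w| ^+ 2))) => //; last exact: iD.
  - by move=> n; exact: mround.
  - by move=> w; apply: lq_cvg => //; exact: cvg_mxround.
have c3 : Ex (fun w => \1_A w * phi (mxround n (N w))) @[n --> \oo] -->
    fine (P A) * Ex (fun w => phi (N' w)).
  rewrite (_ : (fun n => _) = (fun n => fine (P A) * Ex (fun w => phi (mxround n (N' w))))); last first.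
    exact/funext.
  exact: cvgMr c2.
exact: (cvg_unique _ c1 c3).
Qed.

Section freezing.
Context (d : nat) (G : set (set Omega)).
Hypothesis Gm : forall A, <<s G>> A -> measurable A.
Let GT := g_sigma_algebraType G.

Lemma sub_meas (f : Omega -> R) : measurable_fun [set: GT] (f : GT -> R) ->
  measurable_fun [set: Omega] f.
Proof. by move=> mf _ B mB; apply: Gm; exact: mf. Qed.

Lemma sub_measmx p q (Y : Omega -> 'M[R]_(p, q)) : measmx (T := GT) Y -> measmx Y.
Proof. by move=> mY i j; apply: sub_meas; exact: mY. Qed.

Variables (N N' : Omega -> 'rV[R]_d).
Hypotheses (lN : l2 N) (lN' : l2 N').
Hypothesis Hind : forall A, <<s G>> A -> forall B, (forall i, measurable (B i)) ->
  P (A `&` box N B) = (P A * P (box N' B))%E.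

(* Lower bound for the conditional expectation given G of f (Y + N S^T), where Y, S
   are G-measurable and N is independent of G, without conditional expectations. *)
Lemma freeze (f : 'rV[R]_d -> R) (g : 'rV[R]_d -> 'M[R]_d -> R) (M C : R)
    (Y : Omega -> 'rV[R]_d) (S : Omega -> 'M[R]_d) :
  measmx (T := GT) Y -> measmx (T := GT) S -> l2 Y ->
  (forall w, frobenius (S w) <= M) -> lq f ->
  (forall y s, g (mxround n y) (mxround n s) @[n --> \oo] --> g y s) ->
  (forall y s, frobenius s <= M -> `|g y s| <= C * (1 + `|y| ^+ 2)) ->
  (forall y s, frobenius s <= M -> g y s <= Ex (fun w => f (y + N' w *m s^T))) ->
  [/\ intg (fun w => g (Y w) (S w)), intg (fun w => f (Y w + N w *m (S w)^T)) &
   Ex (fun w => g (Y w) (S w)) <= Ex (fun w => f (Y w + N w *m (S w)^T))].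
Proof.
move=> mY mS lY SM lf gc gC gf.
have [K K0 fK] := lq_quad lf.
have mY' := sub_measmx mY; have mS' := sub_measmx mS.
pose Q n w := (mxcell_of n (Y w), mxcell_of n (S w)).
have QG n k : <<s G>> [set w | Q n w = k].
  have -> : [set w | Q n w = k] =
      [set w | mxcell_of n (Y w) = k.1] `&` [set w | mxcell_of n (S w) = k.2].
    apply/seteqP; split => w; rewrite /Q /=; first by move=> <-.
    by case: k => k1 k2 /= [-> ->].
  have h1 := @measurable_mxcell R _ GT _ _ _ n k.1 mY.
  have h2 := @measurable_mxcell R _ GT _ _ _ n k.2 mS.
  exact: (@measurableI _ GT).
have mQ n k : measurable [set w | Q n w = k] by apply: Gm.
pose gn n w := g (mxround n (Y w)) (mxround n (S w)).
pose fn n w := f (mxround n (Y w) + N w *m (mxround n (S w))^T).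
have prodbd (z : 'rV[R]_d) (s : 'M[R]_d) : frobenius s <= M -> `|z *m s^T| <= d%:R * M * `|z| :> R.
  move=> sM; apply: (le_trans (mulmx_norm_le _ _)); rewrite norm_trmx mulrAC.
  by rewrite ler_wpM2r// ler_wpM2l//; exact: le_trans (mx_norm_frobenius _) sM.
have SnM n w : frobenius (mxround n (S w)) <= M.
  exact: le_trans (frobenius_round _ _) (SM w).
have lqphi (y : 'rV[R]_d) (s : 'M[R]_d) : lq (fun z : 'rV[R]_d => f (y + z *m s^T)).
  apply: (lq_comp (h := fun z : 'rV[R]_d => y + z *m s^T) (C := d%:R * `|s^T|)) => // z z'.
  rewrite opprD addrACA subrr add0r -mulmxBl (le_trans (mulmx_norm_le _ _))//.
  by rewrite [leLHS]mulrAC.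
(* Where [Q n] takes a given value, the rounded [Y] and [S] are constants: [indepE] applies to a
   function of [N] alone, and [gf] compares the two sums term by term. *)
have ineqn n : Ex (gn n) <= Ex (fn n).
  rewrite /gn /fn.
  have -> : Ex (fun w => g (mxround n (Y w)) (mxround n (S w))) =
     \sum_k g (mxcell_val R k.1) (mxcell_val R k.2) * fine (P [set w | Q n w = k]).
    have := @mean_fin _ (Q n) (fun k => g (mxcell_val R k.1) (mxcell_val R k.2)) setT measurableT (mQ n).
    rewrite (_ : (fun w => _ * _) = (fun w => g (mxround n (Y w)) (mxround n (S w)))); last first.
      by apply/funext => w; rewrite indicT mul1r.
    by move=> ->; apply: eq_bigr => k _; rewrite setTI.
  pose phi (k : mxcell n 1 d * mxcell n d d) z :=
    f (mxcell_val R k.1 + z *m (mxcell_val R k.2)^T).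
  have -> : Ex (fun w => f (mxround n (Y w) + N w *m (mxround n (S w))^T)) =
     \sum_k Ex (fun w => \1_[set w | Q n w = k] w * phi k (N w)).
    rewrite -mean_sum => [|k]; last first.
      have iphi : intg (fun w => phi k (N w)) by apply: intg_lq => //; exact: lqphi.
      apply: (intg_le (Y := fun w => `|phi k (N w)|)); last exact: intg_norm.
        by apply: measurable_funM; [exact: measurable_indic|exact: intg_meas iphi].
      move=> w; rewrite normrM ler_piMl//.
      by rewrite indicE; case: (_ \in _); rewrite ?normr1 ?normr0.
    congr Ex; apply/funext => w; rewrite (bigD1 (Q n w))//= big1 ?addr0.
      by rewrite indicE mem_set//= mul1r.
    move=> k kQ; rewrite indicE memNset ?mul0r//= => e.
    by rewrite -e eqxx in kQ.
  apply: ler_sum => k _.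
  rewrite (indepE (N' := N'))//; last 2 first.
  - by move=> B mB; apply: Hind.
  - exact: lqphi.
  rewrite mulrC.
  (* [gf] covers only matrices of norm at most [M]; a cell with a larger representative is empty,
     because rounding does not increase the norm. *)
  have [kM|kM] := lerP (frobenius (mxcell_val R k.2)) M.
    by rewrite ler_wpM2l ?fine_ge0//; exact: gf.
  rewrite (_ : [set w | Q n w = k] = set0) ?measure0 ?mul0r//.
  apply/seteqP; split => w //=; rewrite /Q => e.
  by move: kM; rewrite -e /= ltNge SnM.
have [ig cg] : intg (fun w => g (Y w) (S w)) /\
   Ex (gn n) @[n --> \oo] --> Ex (fun w => g (Y w) (S w)).
  apply: (mean_dct (Z := fun w => `|C| * (1 + `|Y w| ^+ 2))).
  - move=> n; apply: (measurable_fin (Q := Q n)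
      (fun k => g (mxcell_val R k.1) (mxcell_val R k.2))); exact: mQ.
  - by move=> w; exact: gc.
  - by apply/intgZ/intgD; [exact: intg_cst|case: lY].
  - move=> n w; apply: (le_trans (gC _ _ _)) => //.
    apply: (@le_trans _ _ (`|C| * (1 + `|mxround n (Y w)| ^+ 2))).
      by rewrite ler_wpM2r ?ler_norm// addr_ge0// sqr_ge0.
    by rewrite ler_wpM2l// lerD2l ler_sqr ?nnegrE// mxround_le.
have M0 (w : Omega) : 0 <= M by exact: le_trans (frobenius_ge0 _) (SM w).
have [iff cf] : intg (fun w => f (Y w + N w *m (S w)^T)) /\
   Ex (fn n) @[n --> \oo] --> Ex (fun w => f (Y w + N w *m (S w)^T)).
  apply: (mean_dct (Z := fun w => K * (1 + (2 * `|Y w| ^+ 2 + 2 * (d%:R * M) ^+ 2 * `|N w| ^+ 2)))).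
  - move=> n; rewrite /fn; apply: measurable_lq => // i j.
    apply: (@measurable_fun_cvg _ _ _ _ (fun m w => (mxround n (Y w) +
      mxround m (N w) *m (mxround n (S w))^T) i j)).
      move=> m; apply: (measurable_fin (Q := fun w => (Q n w, mxcell_of m (N w)))
        (fun k => (mxcell_val R k.1.1 + mxcell_val R k.2 *m (mxcell_val R k.1.2)^T) i j)).
      move=> k.
      rewrite (_ : [set w | _] = [set w | Q n w = k.1] `&` [set w | mxcell_of m (N w) = k.2]); last first.
        apply/seteqP; split => w /=; first by move=> <-.
        by case: k => k1 k2 /= [-> ->].
      by apply: measurableI => //; apply: measurable_mxcell; case: lN.
    move=> w _.
    have lqe : lq (fun z : 'rV[R]_d => (mxround n (Y w) + z *m (mxround n (S w))^T) i j).
      exists (d%:R * `|(mxround n (S w))^T|) => [|x y]; first by rewrite mulr_ge0.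
      rewrite !mxE opprD addrACA subrr add0r.
      have := mx_entry_le ((x - y) *m (mxround n (S w))^T) i j.
      rewrite mulmxBl !mxE => /le_trans; apply.
      rewrite -mulmxBl (le_trans (mulmx_norm_le _ _))// [leLHS]mulrAC.
      by rewrite ler_wpM2r// ler_peMr ?mulr_ge0// -addrA lerDl addr_ge0.
    by apply: (lq_cvg lqe); exact: cvg_mxround.
  - move=> w.
    apply: lq_cvg => //; apply: cvgD; first exact: cvg_mxround.
    apply/cvgrPdist_le => e e0; near=> n.
    rewrite -mulmxBr (le_trans (mulmx_norm_le _ _))//.
    rewrite (_ : (S w)^T - _ = (S w - mxround n (S w))^T); last by rewrite linearB.
    rewrite norm_trmx.
    have c0 : 0 < d%:R * `|N w| + 1 :> R by rewrite ltr_wpDl// mulr_ge0.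
    apply: (@le_trans _ _ ((d%:R * `|N w| + 1) * `|S w - mxround n (S w)|)).
      by rewrite ler_wpM2r// lerDl.
    rewrite mulrC -ler_pdivlMr//; near: n.
    by apply: (cvgrPdist_le _ _).1; [exact: cvg_mxround|rewrite divr_gt0].
  - apply/intgZ/intgD; first exact: intg_cst.
    by apply: intgD; apply: intgZ; [case: lY|case: lN].
  - move=> n w; apply: (le_trans (fK _)); rewrite ler_wpM2l// lerD2l.
    have h : `|mxround n (Y w) + N w *m (mxround n (S w))^T| <= `|Y w| + d%:R * M * `|N w|.
      by rewrite (le_trans (ler_normD _ _))// lerD ?mxround_le ?prodbd.
    apply: (@le_trans _ _ ((`|Y w| + d%:R * M * `|N w|) ^+ 2)).
      by rewrite ler_sqr ?nnegrE// addr_ge0// !mulr_ge0// (M0 w).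
    by rewrite (le_trans (sqrD_le _ _))// lerD2l exprMn mulrA.
split => //.
apply: (ler_cvg_to cg cf); exact: nearW.
Unshelve. all: by end_near. Qed.

End freezing.
End independence.

(** * Gaussian increments *)

Section normal_moments.
Context (R : realType).
Local Notation mu := (@lebesgue_measure R).
Local Notation pdf s := (normal_pdf (0 : R) s).

Import HBNNSimple.

Lemma measurable_EFin_pdf (s : R) :
  measurable_fun [set: R] (fun x => (pdf s x)%:E).
Proof. by apply/measurable_EFinP; apply: measurable_normal_pdf. Qed.

(** By the usual ascent from indicators through simple functions to monotone limits. *)
Lemma ge0_integral_normal_prob (s : R) (f : R -> \bar R) :
  measurable_fun [set: R] f -> (forall x, 0 <= f x)%E ->
  (\int[normal_prob 0 s]_x f x = \int[mu]_x (f x * (pdf s x)%:E))%E.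
Proof.
move=> mf f0.
have p0 x : (0 <= (pdf s x)%:E)%E by rewrite lee_fin normal_pdf_ge0.
have mp : measurable_fun [set: R] (fun x => (pdf s x)%:E).
  exact: measurable_EFin_pdf.
have ind (E : set R) : measurable E ->
    (\int[normal_prob 0 s]_x (\1_E x)%:E = \int[mu]_x ((\1_E x)%:E * (pdf s x)%:E))%E.
  move=> mE; rewrite integral_indic//= setIT /normal_prob integral_mkcond.
  apply: eq_integral => x _; rewrite patchE indicE.
  by case: ifPn => _ /=; rewrite ?mul1e ?mul0e.
have nns (g : {nnsfun R >-> R}) :
    (\int[normal_prob 0 s]_x (g x)%:E = \int[mu]_x ((g x)%:E * (pdf s x)%:E))%E.
  have mlev (r : R) : measurable_fun [set: R] (\1_(g @^-1` [set r]) : R -> R).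
    apply: measurable_indic; rewrite -[X in measurable X]setTI.
    by have := @measurable_funP _ _ _ _ _ g; apply.
  under [LHS]eq_integral do rewrite fimfunE -fsumEFin//.
  rewrite [LHS]ge0_integral_fsum//; last 2 first.
    - by move=> r; apply/measurable_EFinP; apply: measurable_funM => //; exact: mlev.
    - by move=> n x _; rewrite EFinM nnfun_muleindic_ge0.
  under [RHS]eq_integral.
    move=> x xD; rewrite fimfunE -fsumEFin// muleC ge0_mule_fsumr; last first.
      by move=> r; rewrite EFinM nnfun_muleindic_ge0.
    over.
  rewrite [RHS]ge0_integral_fsum//; last 2 first.
    - move=> r; apply: emeasurable_funM; first exact: mp.
      by apply/measurable_EFinP; apply: measurable_funM => //; exact: mlev.
    - by move=> n x _; rewrite EFinM mule_ge0// nnfun_muleindic_ge0.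
  apply: eq_fsbigr => r rg.
  have r0 : 0 <= r by move: rg; rewrite inE => -[x _ <-].
  have i0 x : (0 <= (\1_(g @^-1` [set r]) x : R)%:E)%E by rewrite lee_fin.
  have mi : measurable_fun [set: R] (fun x => (\1_(g @^-1` [set r]) x : R)%:E).
    by apply/measurable_EFinP; exact: mlev.
  transitivity (r%:E * \int[normal_prob 0 s]_x (\1_(g @^-1` [set r]) x)%:E)%E.
    by rewrite -ge0_integralZl//; apply: eq_integral => x _; rewrite EFinM.
  rewrite ind; last by rewrite measurable_indicP.
  rewrite -ge0_integralZl//.
  - by apply: eq_integral => x _; rewrite EFinM muleA muleC.
  - exact: emeasurable_funM.
  - by move=> x _; rewrite mule_ge0.
pose f_ := nnsfun_approx measurableT mf.
have mf_ n : measurable_fun [set: R] (fun x => (f_ n x)%:E).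
  by apply/measurable_EFinP; exact: measurable_funP.
have nd_f n m : (n <= m)%N -> forall x, f_ n x <= f_ m x.
  by move=> /(nd_nnsfun_approx measurableT mf)/lefP.
transitivity (lim (\int[normal_prob 0 s]_x (f_ n x)%:E @[n --> \oo])%E).
  rewrite -monotone_convergence//=.
  - apply: eq_integral => ? /[!inE] xD; apply/esym/cvg_lim => //=.
    exact: cvg_nnsfun_approx.
  - by move=> n ? _; rewrite lee_fin.
  - by move=> x _ n m nm; rewrite lee_fin; exact: nd_f.
under eq_fun do rewrite nns.
rewrite -monotone_convergence//=.
- apply: eq_integral => x /[!inE] xD; apply/cvg_lim => //=.
  by apply: cvgeZr => //; exact: cvg_nnsfun_approx.
- by move=> n; apply: emeasurable_funM; [exact: mf_|exact: mp].
- by move=> n x _; rewrite mule_ge0// lee_fin.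
- by move=> x _ n m nm; rewrite lee_wpmul2r// lee_fin; exact: nd_f.
Qed.

(** Moments of N(0, 1); [gmoment_fin] shows that [fine] loses nothing for the even orders up to
    6. *)
Definition gmoment (k : nat) : R := fine (\int[mu]_x ((x ^+ k)%:E * (pdf 1 x)%:E))%E.

(** Cube the inequality 1 + u / 3 <= e^(u / 3). *)
Lemma expR_cube (u : R) : 0 <= u -> u ^+ 3 <= 27 * expR u.
Proof.
move=> u0.
have -> : expR u = expR (u / 3) ^+ 3.
  by rewrite -expRM_natr; congr expR; field.
have h : 1 + u / 3 <= expR (u / 3) by exact: expR_ge1Dx.
have h3 : (1 + u / 3) ^+ 3 <= expR (u / 3) ^+ 3.
  by rewrite lerXn2r// nnegrE ?expR_ge0// addr_ge0// divr_ge0.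
have h2 : u ^+ 3 <= 27 * (1 + u / 3) ^+ 3.
  have -> : 27 * (1 + u / 3) ^+ 3 = (3 + u) ^+ 3 by field.
  by rewrite lerXn2r ?nnegrE ?addr_ge0//; lra.
by apply: (le_trans h2); rewrite ler_wpM2l.
Qed.

(* Integrability of x^6 against N(0, 1) follows from that of the density N(0, 4). *)
Lemma pdf1_moment6 : exists2 C : R, 0 <= C &
  forall x, x ^+ 6 * pdf 1 x <= C * pdf 2 x.
Proof.
have k1 : 0 < normal_peak (1 : R) by rewrite normal_peak_gt0// oner_neq0.
have k2 : 0 < normal_peak (2 : R) by rewrite normal_peak_gt0// pnatr_eq0.
exists (8 ^+ 3 * normal_peak 1 * (27 * (normal_peak 2)^-1)).
  by rewrite !mulr_ge0 ?exprn_ge0 ?invr_ge0 ?normal_peak_ge0.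
move=> x; rewrite !normal_pdfE ?oner_neq0 ?pnatr_eq0//.
rewrite /normal_fun subr0 expr1n.
set u := x ^+ 2 / 8.
have u0 : 0 <= u by rewrite divr_ge0// sqr_ge0.
have -> : x ^+ 6 = 8 ^+ 3 * u ^+ 3 by rewrite /u; field.
have -> : - x ^+ 2 / (1 *+ 2) = - (4 * u) by rewrite /u; field.
have -> : - x ^+ 2 / (2 ^+ 2 *+ 2) = - u by rewrite /u; field.
rewrite [leRHS](_ : _ = 8 ^+ 3 * normal_peak 1 * (27 * expR (- u))); last first.
  by field; rewrite gt_eqF.
rewrite [leLHS](_ : _ = 8 ^+ 3 * normal_peak 1 * (u ^+ 3 * expR (- (4 * u)))); last by ring.
rewrite ler_wpM2l//; first by rewrite mulr_ge0 ?exprn_ge0 ?normal_peak_ge0.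
apply: (@le_trans _ _ (27 * expR u * expR (- (4 * u)))).
  by rewrite ler_wpM2r ?expR_ge0 ?expR_cube.
by rewrite -mulrA -expRD ler_wpM2l// ler_expR; lra.
Qed.

(** Here x^(2k) <= 1 + x^6, and [pdf1_moment6] handles the sixth power. *)
Lemma gmoment_fin (k : nat) : (k <= 3)%N ->
  (\int[mu]_x ((x ^+ k.*2)%:E * (pdf 1 x)%:E) = (gmoment k.*2)%:E)%E.
Proof.
move=> k3; rewrite /gmoment fineK//.
have [C C0 hC] := pdf1_moment6.
have mp (s : R) : measurable_fun [set: R] (fun x => (pdf s x)%:E).
  exact: measurable_EFin_pdf.
have mX (j : nat) : measurable_fun [set: R] (fun x : R => (x ^+ j)%:E).
  exact/measurable_EFinP/measurable_funX.
have xk0 (x : R) : 0 <= x ^+ k.*2 by rewrite -mul2n exprM exprn_ge0// sqr_ge0.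
rewrite ge0_fin_numE; last first.
  by apply: integral_ge0 => x _; rewrite mule_ge0// lee_fin ?normal_pdf_ge0.
apply: (@le_lt_trans _ _ (\int[mu]_x ((pdf 1 x)%:E + C%:E * (pdf 2 x)%:E))%E).
  apply: ge0_le_integral => //.
  - by move=> x _; rewrite mule_ge0// lee_fin ?normal_pdf_ge0.
  - by apply: emeasurable_funM; [exact: mX|exact: mp].
  - apply: emeasurable_funD; first exact: mp.
    by apply: emeasurable_funM => //; exact: mp.
  move=> x _; rewrite -!EFinM -EFinD lee_fin.
  apply: le_trans (_ : (1 + x ^+ 6) * pdf 1 x <= _); last by rewrite mulrDl mul1r lerD2l.
  rewrite ler_wpM2r ?normal_pdf_ge0//.
  have := sqr_ge0 x; set y := x ^+ 2 => y0.
  have -> : x ^+ k.*2 = y ^+ k by rewrite /y -mul2n exprM.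
  have -> : x ^+ 6 = y ^+ 3 by rewrite /y -exprM.
  case: k k3 {xk0} => [|[|[|[|//]]]] _; rewrite ?expr0 ?expr1.
  - by rewrite lerDl exprn_ge0.
  - by have [y1|y1] := lerP y 1; nra.
  - by have [y1|y1] := lerP y 1; nra.
  - by rewrite lerDr.
rewrite ge0_integralD//; try exact: mp.
- rewrite ge0_integralZl//; try exact: mp.
    by rewrite !integral_normal_pdf mule1 -EFinD ltry.
  by move=> x _; rewrite lee_fin normal_pdf_ge0.
- by move=> x _; rewrite lee_fin normal_pdf_ge0.
- by move=> x _; rewrite mule_ge0// lee_fin ?normal_pdf_ge0.
- by apply: emeasurable_funM => //; exact: mp.
Qed.

Lemma normal_moment (s : R) (k : nat) : 0 < s -> (k <= 3)%N ->
  (\int[normal_prob 0 s]_x (x ^+ k.*2)%:E = (s ^+ k.*2 * gmoment k.*2)%:E)%E.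
Proof.
move=> s0 k3.
have xk0 (x : R) : 0 <= x ^+ k.*2 by rewrite -mul2n exprM exprn_ge0// sqr_ge0.
have mX (j : nat) : measurable_fun [set: R] (fun x : R => (x ^+ j)%:E).
  exact/measurable_EFinP/measurable_funX.
rewrite ge0_integral_normal_prob//.
under eq_integral do rewrite -EFinM.
pose F (z : R) := s * z.
have dF (x : R) : is_derive x 1 F s.
  by apply: is_derive_eq; rewrite /GRing.scale/= mulr1.
have F'E : F^`()%classic = cst s.
  by apply/funext => x; rewrite derive1E; apply: derive_val.
rewrite (@increasing_ge0_integration_by_substitutionT R F (fun x => x ^+ k.*2 * pdf s x)) ?F'E//.
- rewrite EFinM -gmoment_fin// -ge0_integralZl//.
  + apply: eq_integral => x _; rewrite -!EFinM; congr EFin.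
    have E : pdf s (s * x) * s = pdf 1 x.
      rewrite !normal_pdfE ?gt_eqF// mulrAC; congr (_ * _).
        rewrite /normal_peak -!mulrnAr expr1n mul1r sqrtrM ?sqr_ge0// sqrtr_sqr gtr0_norm//.
        by rewrite invfM mulrAC mulVf ?mul1r// gt_eqF.
      rewrite /normal_fun; congr expR; rewrite !subr0 exprMn expr1n.
      by field; rewrite gt_eqF.
    transitivity ((s * x) ^+ k.*2 * pdf s (s * x) * s) => //.
    by rewrite exprMn -E; ring.
  + by apply: emeasurable_funM; [exact: mX|exact: measurable_EFin_pdf].
  + by move=> x _; rewrite mule_ge0// lee_fin ?normal_pdf_ge0.
  + by rewrite lee_fin.
- by move=> x y xy; rewrite /F ltr_pM2l.
- by move=> x; exact: cvg_cst.
- exact: is_cvg_cst.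
- exact: is_cvg_cst.
- exact: (gt0_cvgMrNy s0 cvg_id).
- exact: (gt0_cvgMry s0 cvg_id).
- move=> x; apply: cvgM; last by apply: continuous_normal_pdf; rewrite gt_eqF.
  exact: exprn_continuous.
- by move=> x; rewrite mulr_ge0// normal_pdf_ge0.
Qed.

(** If the second moment vanished, the mass of |x| > dl would be 0 by Chebyshev, while |x| <= dl
    carries at most the peak of the density times 2 dl, which is 1/2 by the choice of [dl]; the
    total mass could not be 1. *)
Lemma gmoment2_gt0 : 0 < gmoment 2.
Proof.
rewrite lt_neqAle; apply/andP; split; last first.
  by apply: fine_ge0; apply: integral_ge0 => x _; rewrite -EFinM lee_fin mulr_ge0 ?sqr_ge0 ?normal_pdf_ge0.
apply/eqP => e0.
have := @gmoment_fin 1 isT; rewrite -e0 => i0.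
pose dl : R := (4 * normal_peak 1)^-1.
have k1 : 0 < normal_peak (1 : R) by rewrite normal_peak_gt0// oner_neq0.
have dl0 : 0 < dl by rewrite invr_gt0 mulr_gt0.
have mp (s : R) : measurable_fun [set: R] (fun x => (pdf s x)%:E).
  exact: measurable_EFin_pdf.
have mq : measurable_fun [set: R] (fun x : R => ((x ^+ 2)%:E * (pdf 1 x)%:E)%E).
  by apply: emeasurable_funM; [exact/measurable_EFinP/measurable_funX|exact: mp].
have mi : measurable_fun [set: R] (fun x => (\1_`[- dl, dl] x : R)%:E).
  by apply/measurable_EFinP; exact: measurable_indic.
have := integral_normal_pdf (0 : R) 1.
have : (\int[mu]_x (pdf 1 x)%:E <= \int[mu]_x ((dl ^- 2)%:E * ((x ^+ 2)%:E * (pdf 1 x)%:E) +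
    (normal_peak 1)%:E * (\1_`[- dl, dl] x)%:E))%E.
  apply: ge0_le_integral => //.
  - by move=> x _; rewrite lee_fin normal_pdf_ge0.
  - exact: mp.
  - by apply: emeasurable_funD; [exact: emeasurable_funM|exact: emeasurable_funM].
  move=> x _; rewrite -!EFinM -EFinD lee_fin indicE.
  have p0 := normal_pdf_ge0 0 1 x.
  have pk := normal_pdf_ub 0 x (oner_neq0 R).
  case: (boolP (x \in _)) => xi.
    rewrite mulr1 (le_trans pk)// lerDr mulr_ge0 ?invr_ge0 ?sqr_ge0//.
    exact: (mulr_ge0 (sqr_ge0 _)).
  rewrite mulr0 addr0 mulrA ler_peMl// mulrC ler_pdivlMr ?exprn_gt0// mul1r.
  move: xi; rewrite notin_setE /= in_itv /= => /negP; rewrite -ler_norml -ltNge => h.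
  by rewrite -[leRHS]real_normK ?num_real// ler_sqr ?nnegrE ?(ltW h) ?(ltW dl0).
rewrite ge0_integralD//; last 4 first.
- by move=> x _; rewrite !mule_ge0// lee_fin ?normal_pdf_ge0 ?sqr_ge0 ?invr_ge0 ?sqr_ge0.
- exact: emeasurable_funM.
- by move=> x _; rewrite !mule_ge0// lee_fin ltW.
- exact: emeasurable_funM.
rewrite ge0_integralZl//; last 2 first.
- by move=> x _; rewrite !mule_ge0// lee_fin ?normal_pdf_ge0 ?sqr_ge0.
- by rewrite lee_fin invr_ge0 sqr_ge0.
rewrite i0 mule0 add0e ge0_integralZl//; last 1 first.
- by rewrite lee_fin ltW.
rewrite integral_indic//= setIT lebesgue_measure_itv/= lte_fin ifT; last by lra.
rewrite -EFinB -EFinM => h1 h2; move: h1; rewrite h2 lee_fin.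
have -> : normal_peak 1 * (dl - - dl) = 2^-1 by rewrite /dl; field; rewrite gt_eqF.
lra.
Qed.

Lemma normal_probN (s : R) (A : set R) : s != 0 -> measurable A ->
  normal_prob 0 s ((-%R) @^-1` A) = normal_prob 0 s A.
Proof.
move=> s0 mA.
have mN : measurable_fun [set: R] (-%R : R -> R) by exact: oppr_measurable.
have mp : measurable_fun [set: R] (fun x => (pdf s x)%:E).
  exact: measurable_EFin_pdf.
transitivity (\int[pushforward mu (-%R : _ -> measurableTypeR R)]_(x in A) (pdf s x)%:E)%E.
  rewrite ge0_integral_pushforward//=.
  - apply: eq_integral => x _; rewrite !normal_pdfE// /normal_fun !subr0.
    by rewrite /= sqrrN.
  - exact: measurable_funS mp.
  - by move=> x _; rewrite lee_fin normal_pdf_ge0.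
by apply: eq_measure_integral => B mB _; exact: lebesgue_measureN.
Qed.

End normal_moments.

Section brownian.
Context (R : realType) (d : nat) (dO : measure_display)
  (Omega : measurableType dO) (P : probability Omega R)
  (W : R -> Omega -> 'rV[R]_d) (hW : standard_brownian_motion P W).
Local Notation Ex := (mean P).
Local Notation intg := (intg P).

Definition increment (s t : R) (w : Omega) : 'rV[R]_d := W t w - W s w.

Lemma past_sub t A : <<s past_events W t>> A -> measurable A.
Proof.
apply: smallest_sub; first exact: sigma_algebra_measurable.
move=> _ [s [i [B [/andP[s0 _] mB ->]]]].
have [mW _ _ _] := hW.
by rewrite -[X in measurable X]setTI; exact: mW.
Qed.

Lemma past_mono s t : s <= t ->
  <<s past_events W s>> `<=` <<s past_events W t>>.
Proof.
move=> st; apply: sub_sigma_algebra2 => A [r [i [B [/andP[r0 rs] mB ->]]]].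
by exists r, i, B; split => //; rewrite r0 (le_trans rs).
Qed.

Lemma measmx_incr s t : 0 <= s -> 0 <= t -> measmx (increment s t).
Proof.
move=> s0 t0 i j; have [mW _ _ _] := hW.
rewrite ord1 (_ : (fun w => _) = (fun w => W t w 0 j - W s w 0 j)).
  by apply: measurable_funB; exact: mW.
by apply/funext => w; rewrite !mxE.
Qed.

Lemma past_incr s t u : 0 <= s <= u -> 0 <= t <= u ->
  measmx (T := g_sigma_algebraType (past_events W u)) (increment s t).
Proof.
move=> su tu i j.
have mW r : 0 <= r <= u -> measurable_fun
    [set: g_sigma_algebraType (past_events W u)] (fun w => W r w 0 j : R).
  move=> ru _ B mB; rewrite setTI; apply: sub_sigma_algebra.
  by exists r, j, B.
rewrite ord1 (_ : (fun w => _) = (fun w => W t w 0 j - W s w 0 j)).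
  by apply: measurable_funB; exact: mW.
by apply/funext => w; rewrite !mxE.
Qed.

Lemma incr_box s t A B : 0 <= s -> s < t -> <<s past_events W s>> A ->
  (forall i, measurable (B i)) ->
  P (A `&` box (increment s t) B) =
  (P A * \prod_(i < d) normal_prob 0 (Num.sqrt (t - s)) (B i))%E.
Proof.
move=> s0 st FA mB; have [_ _ _ /(_ s t s0 st A FA B mB) <-] := hW.
by congr (P (_ `&` _)); apply/seteqP; split => w /= h i; have := h i; rewrite !mxE.
Qed.

Lemma past_setT s : <<s past_events W s>> setT.
Proof. by apply: (@measurableT _ (g_sigma_algebraType (past_events W s))). Qed.

Lemma incr_law0 s t B : 0 <= s -> s < t -> (forall i, measurable (B i)) ->
  P (box (increment s t) B) = (\prod_(i < d) normal_prob 0 (Num.sqrt (t - s)) (B i))%E.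
Proof.
move=> s0 st mB.
by rewrite -[box _ _]setTI incr_box//; [rewrite probability_setT mul1e|exact: past_setT].
Qed.

(** A constant is independent of every event. This covers increments over an interval of length 0,
    whereas the definition of Brownian motion treats s < t. *)
Lemma box_cst0 (N : Omega -> 'rV[R]_d) A B : (forall w, N w = 0) ->
  P (A `&` box N B) = (P A * P (box N B))%E.
Proof.
move=> N0; have [h|h] := pselect (forall i, B i 0).
  rewrite (_ : box N B = setT) ?setIT ?probability_setT ?mule1//.
  by apply/seteqP; split => w //= _ i; rewrite N0 mxE.
rewrite (_ : box N B = set0) ?setI0 ?measure0 ?mule0//.
by apply/seteqP; split => w //= h'; apply: h => i; have := h' i; rewrite N0 mxE.
Qed.

(** The independent copy required by [freeze] is realised as the increment from time 0, so that a
    single function [cost] of the duration describes every step. *)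
Lemma incr_indep s t : 0 <= s -> s <= t ->
  forall A, <<s past_events W s>> A -> forall B, (forall i, measurable (B i)) ->
  P (A `&` box (increment s t) B) = (P A * P (box (increment 0 (t - s)) B))%E.
Proof.
move=> s0; rewrite le_eqVlt => /predU1P[<- A FA B mB|st A FA B mB].
  have e r w : increment r r w = 0 by rewrite /increment subrr.
  rewrite (box_cst0 _ _ (e s)); congr (_ * P _)%E.
  by apply/seteqP; split => w /= h i; have := h i; rewrite subrr !e.
rewrite incr_box//; congr (_ * _)%E; rewrite -[in LHS](subr0 (t - s)).
by apply/esym/incr_law0 => //; rewrite subr_gt0.
Qed.

Lemma incr_indepN s t : 0 <= s -> s <= t ->
  forall A, <<s past_events W s>> A -> forall B, (forall i, measurable (B i)) ->
  P (A `&` box (fun w => - increment s t w) B) = (P A * P (box (increment 0 (t - s)) B))%E.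
Proof.
move=> s0; rewrite le_eqVlt => /predU1P[<- A FA B mB|st A FA B mB].
  have e r w : increment r r w = 0 by rewrite /increment subrr.
  have e' w : - increment s s w = 0 by rewrite e oppr0.
  rewrite (box_cst0 _ _ e'); congr (_ * P _)%E.
  by apply/seteqP; split => w /= h i; have := h i; rewrite subrr !e ?oppr0.
have mB' i : measurable ((-%R) @^-1` (B i)).
  by rewrite -[X in measurable X]setTI; exact: oppr_measurable.
rewrite (_ : box _ B = box (increment s t) (fun i => (-%R) @^-1` (B i))); last first.
  by apply/seteqP; split => w /= h i; have := h i; rewrite /= !mxE.
rewrite incr_box//; congr (_ * _)%E.
have -> : P (box (increment 0 (t - s)) B) = (\prod_(i < d) normal_prob 0 (Num.sqrt (t - s)) (B i))%E.
  by rewrite -[in RHS](subr0 (t - s)); apply: incr_law0; rewrite ?subr_gt0.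
apply: eq_bigr => i _; rewrite normal_probN//.
by rewrite gt_eqF// sqrtr_gt0 subr_gt0.
Qed.

Lemma incr_law s t i (A : set R) : 0 <= s -> s < t -> measurable A ->
  P [set w | A (increment s t w 0 i)] = normal_prob 0 (Num.sqrt (t - s)) A.
Proof.
move=> s0 st mA.
pose B (j : 'I_d) : set R := if j == i then A else setT.
have mB j : measurable (B j) by rewrite /B; case: ifP.
rewrite (_ : [set w | _] = box (increment s t) B); last first.
  apply/seteqP; split => w /=; first by move=> h j; rewrite /B; case: eqP => // ->.
  by move=> /(_ i); rewrite /B eqxx.
rewrite incr_law0// (bigD1 i)//= {1}/B eqxx big1 ?mule1// => j ji.
by rewrite /B (negbTE ji) probability_setT.
Qed.

Lemma incr_moment s t i (k : nat) : 0 <= s -> s <= t -> (0 < k <= 3)%N ->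
  intg (fun w => increment s t w 0 i ^+ k.*2) /\
  Ex (fun w => increment s t w 0 i ^+ k.*2) = (t - s) ^+ k * gmoment R k.*2.
Proof.
move=> s0; rewrite le_eqVlt => /predU1P[<- /andP[k0 k3]|st /andP[k0 k3]].
  rewrite (_ : (fun w => _) = cst 0); last first.
    by apply/funext => w; rewrite /increment subrr mxE expr0n double_eq0 gtn_eqF.
  split; first exact: intg_cst.
  by rewrite mean_cst subrr expr0n gtn_eqF// mul0r.
have t0 : 0 <= t by rewrite (le_trans s0)// ltW.
pose N w := increment s t w 0 i.
have mN : measurable_fun [set: Omega] (N : Omega -> measurableTypeR R).
  exact: measmx_incr.
have mX : measurable_fun [set: R] (fun x : R => (x ^+ k.*2)%:E).
  exact/measurable_EFinP/measurable_funX.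
have xk0 (x : R) : 0 <= x ^+ k.*2 by rewrite -mul2n exprM exprn_ge0// sqr_ge0.
have E : (\int[P]_w (N w ^+ k.*2)%:E = ((t - s) ^+ k * gmoment R k.*2)%:E)%E.
  have s2 : 0 < Num.sqrt (t - s) by rewrite sqrtr_gt0 subr_gt0.
  rewrite -[X in X ^+ k](@sqr_sqrtr _ (t - s)) ?subr_ge0 1?ltW// -exprM mul2n.
  rewrite -normal_moment//.
  transitivity (\int[pushforward P (N : Omega -> measurableTypeR R)]_x (x ^+ k.*2)%:E)%E.
    rewrite ge0_integral_pushforward//.
    by move=> x _; rewrite lee_fin.
  apply: eq_measure_integral => A mA _.
  exact: incr_law.
split; last by rewrite /Ex /Rintegral E.
apply/integrableP; split.
  apply/measurable_EFinP; apply: measurable_funX; exact: measmx_incr.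
under eq_integral do rewrite /= ger0_norm//.
by rewrite E ltry.
Qed.

Lemma norm_row_sq (x : 'rV[R]_d) : `|x| ^+ 2 <= \sum_i x 0 i ^+ 2.
Proof.
have S0 : 0 <= \sum_i x 0 i ^+ 2 by apply: sumr_ge0 => i _; rewrite sqr_ge0.
rewrite -[leRHS]sqr_sqrtr// ler_sqr ?nnegrE ?sqrtr_ge0//.
apply: mx_norm_le => [|i j]; first exact: sqrtr_ge0.
rewrite ord1 -ler_sqr ?nnegrE ?sqrtr_ge0// sqr_sqrtr// real_normK ?num_real//.
by rewrite (bigD1 j)//= lerDl; apply: sumr_ge0 => k _; rewrite sqr_ge0.
Qed.

Lemma incr_sq s t : 0 <= s -> s <= t ->
  intg (fun w => `|increment s t w| ^+ 2) /\
  Ex (fun w => `|increment s t w| ^+ 2) <= d%:R * gmoment R 2 * (t - s).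
Proof.
move=> s0 st; have t0 : 0 <= t by exact: le_trans st.
have h i := @incr_moment s t i 1 s0 st isT.
have iS : intg (fun w => \sum_i increment s t w 0 i ^+ 2).
  by apply: intg_sum => i; have [] := h i.
have iN : intg (fun w => `|increment s t w| ^+ 2).
  apply: (intg_le _ _ iS) => [|w].
    apply: measurable_funX; apply: (measurable_lq (measmx_incr s0 t0)).
    exists 1 => // x y; rewrite mul1r (le_trans (ler_dist_dist _ _))//.
    by rewrite ler_peMl// -addrA lerDl addr_ge0.
  by rewrite ger0_norm ?sqr_ge0// norm_row_sq.
split => //; apply: (@le_trans _ _ (Ex (fun w => \sum_i increment s t w 0 i ^+ 2))).
  by apply: mean_le => // w; exact: norm_row_sq.
rewrite mean_sum => [|i]; last by have [] := h i.
rewrite (eq_bigr (fun=> (t - s) * gmoment R 2)) => [|i _]; last first.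
  by have [_ ->] := h i; rewrite expr1.
by rewrite sumr_const card_ord -[leLHS]mulr_natl mulrAC mulrA.
Qed.

Lemma l2_incr s t : 0 <= s -> s <= t -> l2 P (increment s t).
Proof.
move=> s0 st; split; last by have [] := incr_sq s0 st.
by apply: measmx_incr => //; exact: le_trans st.
Qed.

(** A centred normal law is even, so an increment and its opposite agree on boxes. This is what
    cancels first order terms later on. *)
Lemma incr_sym h (phi : 'rV[R]_d -> R) : 0 <= h -> lq phi ->
  Ex (fun w => phi (- increment 0 h w)) = Ex (fun w => phi (increment 0 h w)).
Proof.
move=> h0 lphi.
have lN := l2_incr (lexx 0) h0.
have lN' : l2 P (fun w => - increment 0 h w).
  have [mN iN] := lN; split.
    move=> i j; rewrite (_ : (fun w => _) = (fun w => - (increment 0 h w i j))).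
      exact: measurableT_comp.
    by apply/funext => w; rewrite !mxE.
  by apply: eq_integrable iN => // w _; rewrite /= normrN.
have := @indepE _ _ _ P d _ _ setT phi measurableT lN' lN _ lphi.
rewrite probability_setT mul1r => <-.
  by congr Ex; apply/funext => w; rewrite indicT mul1r.
move=> B mB; rewrite (incr_indepN (lexx 0) h0)// ?subr0//.
  by rewrite probability_setT.
exact: past_setT.
Qed.

End brownian.

Section normal_scaling.
Context (R : realType).
Local Notation mu := (@lebesgue_measure R).

(** By uniqueness of Lebesgue measure: both sides are measures that agree on half-open intervals. *)
Lemma lebesgue_measureZ (c : R) (A : set R) : 0 < c -> measurable A ->
  (c%:E * mu ((fun x : R => (c * x)%R) @^-1` A) = mu A)%E.
Proof.
move=> c0 mA.
pose F : measurableTypeR R -> measurableTypeR R := fun x => (c * (x : R))%R.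
have mc : measurable_fun [set: measurableTypeR R] F by exact: measurable_funM.
pose nu := mscale (NngNum (ltW c0)) (pushforward mu F).
suff -> : mu A = nu mc A by [].
apply: (lebesgue_measure_unique (mu := nu mc)) => //= _ [[a b]] _ <-.
rewrite /nu /mscale /= /pushforward.
have -> : (fun x : R => c * x) @^-1` `]a, b] = `](a / c), (b / c)]%classic.
  apply/seteqP; split => x /=; rewrite !in_itv/= ltr_pdivrMr// ler_pdivlMr//;
    by rewrite (mulrC c).
rewrite !lebesgue_measure_itv/= !lte_fin ltr_pM2r ?invr_gt0//.
case: ifP => _; last by rewrite mule0.
by rewrite -!EFinB -EFinM -mulrBl mulrCA divff ?gt_eqF// mulr1.
Qed.

Lemma normal_probZ (c s : R) (A : set R) : 0 < c -> 0 < s -> measurable A ->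
  normal_prob 0 s ((fun x : R => c * x) @^-1` A) = normal_prob 0 (c * s) A.
Proof.
move=> c0 s0 mA.
pose F : measurableTypeR R -> measurableTypeR R := fun x => (c * (x : R))%R.
have mc : measurable_fun [set: measurableTypeR R] F by exact: measurable_funM.
pose nu := mscale (NngNum (ltW c0)) (pushforward mu F).
have cs0 : 0 < c * s by rewrite mulr_gt0.
transitivity (\int[nu mc]_(x in A) (normal_pdf 0 (c * s) x)%:E)%E; last first.
  by apply: eq_measure_integral => B mB _; apply: lebesgue_measureZ.
have mp := measurable_EFin_pdf (c * s).
rewrite ge0_integral_mscale//; last by move=> x _; rewrite lee_fin normal_pdf_ge0.
  rewrite ge0_integral_pushforward//=; last 2 first.
  - exact: measurable_funS mp.
  - by move=> x _; rewrite lee_fin normal_pdf_ge0.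
  have mFA : measurable (F @^-1` A) by rewrite -[X in measurable X]setTI; exact: mc.
  have mpF : measurable_fun (F @^-1` A) (fun x => (normal_pdf 0 (c * s) (F x))%:E).
    by apply: measurable_funTS; exact: (measurableT_comp mp mc).
  rewrite -ge0_integralZl//=; try exact: mpF; last first.
  - by rewrite lee_fin ltW.
  - by move=> x _; rewrite lee_fin normal_pdf_ge0.
  apply: eq_integral => x _; rewrite -EFinM; congr EFin.
  rewrite !normal_pdfE ?gt_eqF// mulrA; congr (_ * _).
    rewrite /normal_peak -!mulrnAr exprMn -[c ^+ 2 * s ^+ 2 * _]mulrA (sqrtrM _ (sqr_ge0 c)) sqrtr_sqr gtr0_norm//.
    by rewrite invfM mulrA mulfV ?mul1r// gt_eqF.
  rewrite /normal_fun; congr expR; rewrite !subr0 !exprMn.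
  by field; rewrite !gt_eqF.
exact: measurable_funS mp.
Qed.

End normal_scaling.

Section random_vectors.
Context (R : realType).

Lemma measmx_add_mul dT (T : measurableType dT) d (Y N : T -> 'rV[R]_d) (S : T -> 'M[R]_d) :
  measmx Y -> measmx N -> measmx S -> measmx (fun w => Y w + N w *m (S w)^T).
Proof.
move=> mY mN mS i j.
rewrite (_ : (fun w => _) = (fun w => Y w i j + \sum_k N w i k * S w j k)).
  apply: measurable_funD => //; apply: measurable_sum => k.
  exact: measurable_funM.
apply/funext => w; rewrite !mxE; congr (_ + _); apply: eq_bigr => k _.
by rewrite mxE.
Qed.

Lemma measmx_cst dT (T : measurableType dT) p q (A : 'M[R]_(p, q)) :
  measmx (fun=> A : 'M[R]_(p, q)) (T := T).
Proof. by move=> i j; exact: measurable_cst. Qed.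

Lemma mul_frob_le d (z : 'rV[R]_d) (s : 'M[R]_d) M : frobenius s <= M ->
  `|z *m s^T| <= d%:R * M * `|z|.
Proof.
move=> sM; apply: (le_trans (mulmx_norm_le _ _)); rewrite norm_trmx mulrAC.
by rewrite ler_wpM2r// ler_wpM2l//; exact: le_trans (mx_norm_frobenius _) sM.
Qed.

Context (dO : measure_display) (Omega : measurableType dO) (P : probability Omega R).

Lemma lq_norm2 (V : normedModType R) : lq (fun x : V => `|x| ^+ 2).
Proof.
exists 1 => // x y; rewrite mul1r subr_sqr normrM mulrC.
rewrite ler_pM// ?ler_dist_dist// ger0_norm ?addr_ge0//.
by rewrite -addrA lerDr.
Qed.

Lemma l2_of_sq p q (Y : Omega -> 'M[R]_(p, q)) Z :
  measmx Y -> intg P Z -> (forall w, `|Y w| ^+ 2 <= Z w) -> l2 P Y.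
Proof.
move=> mY iZ YZ; split => //; apply: (intg_le _ _ iZ).
  exact: (measurable_lq mY (@lq_norm2 _)).
by move=> w; rewrite ger0_norm ?sqr_ge0.
Qed.

Lemma l2_add_mul d (Y N : Omega -> 'rV[R]_d) (S : Omega -> 'M[R]_d) M :
  l2 P Y -> l2 P N -> measmx S -> (forall w, frobenius (S w) <= M) ->
  l2 P (fun w => Y w + N w *m (S w)^T).
Proof.
move=> [mY iY] [mN iN] mS SM.
apply: (@l2_of_sq _ _ _ (fun w => 2 * `|Y w| ^+ 2 + 2 * (d%:R * M) ^+ 2 * `|N w| ^+ 2)).
- exact: measmx_add_mul.
- by apply: intgD; exact: intgZ.
move=> w; rewrite (_ : 2 * _ * _ = 2 * (d%:R * M * `|N w|) ^+ 2); last by ring.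
have M0 : 0 <= M by exact: le_trans (frobenius_ge0 _) (SM w).
apply: le_trans (sqrD_le _ _); rewrite ler_sqr ?nnegrE ?addr_ge0 ?mulr_ge0//.
by rewrite (le_trans (ler_normD _ _))// lerD2l mul_frob_le.
Qed.

Lemma l2_cst p q (A : 'M[R]_(p, q)) : l2 P (fun=> A).
Proof. by split; [exact: measmx_cst|exact: intg_cst]. Qed.

Lemma lqD (V : normedModType R) (f g : V -> R) : lq f -> lq g -> lq (fun x => f x + g x).
Proof.
move=> [K K0 fK] [L L0 gL]; exists (K + L); first exact: addr_ge0.
move=> x y; rewrite opprD addrACA (le_trans (ler_normD _ _))//.
by rewrite !mulrDl lerD.
Qed.

Lemma lqZ (V : normedModType R) c (f : V -> R) : lq f -> lq (fun x => c * f x).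
Proof.
move=> [K K0 fK]; exists (`|c| * K); first exact: mulr_ge0.
by move=> x y; rewrite -mulrBr normrM -!mulrA ler_wpM2l// mulrA.
Qed.

Lemma lq_cst (V : normedModType R) (c : R) : lq (fun _ : V => c).
Proof. by exists 0 => // x y; rewrite subrr normr0 !mul0r. Qed.

Lemma lqN (V : normedModType R) (f : V -> R) : lq f -> lq (fun x => - f x).
Proof.
move=> lf; rewrite (_ : (fun x => _) = (fun x => -1 * f x)); first exact: lqZ.
by apply/funext => x; rewrite mulN1r.
Qed.

End random_vectors.

(** * The one-step operator *)

Section operator.
Context (R : realType) (d : nat) (dO : measure_display)
  (Omega : measurableType dO) (P : probability Omega R)
  (W : R -> Omega -> 'rV[R]_d) (hW : standard_brownian_motion P W).
Local Notation Ex := (mean P).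
Local Notation intg := (intg P).
Local Notation incr := (increment W).
Local Notation vec := 'rV[R]_d.
Local Notation mat := 'M[R]_d.
Implicit Types (f g : vec -> R) (x y : vec) (s : mat) (h : R).

(* The factor sqrt 2 in the definition of the value function is absorbed in the
   control set [ctl]. *)
Definition cost h f x s : R := Ex (fun w => f (x + incr 0 h w *m s^T)).

Definition ctl : set mat := [set s | frobenius s <= Num.sqrt 2].

Definition opT h f x : R := inf [set cost h f x s | s in ctl].

Let sq2 : R := Num.sqrt 2.
Let B : R := d%:R * sq2.

Lemma ctl0 : ctl 0.
Proof. by rewrite /ctl /= frobeniusE big1 ?sqrtr0// => i _; rewrite big1// => j _; rewrite mxE expr0n. Qed.

Lemma sq2_ge0 : 0 <= sq2. Proof. exact: sqrtr_ge0. Qed.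

Lemma B_ge0 : 0 <= B. Proof. by rewrite mulr_ge0 ?sq2_ge0. Qed.

Lemma l2_shift h x s : 0 <= h -> l2 P (fun w => x + incr 0 h w *m s^T).
Proof.
move=> h0; apply: (l2_add_mul (M := frobenius s)) => //; first exact: l2_cst.
- exact: l2_incr.
Qed.

Lemma intg_cost h f x s : 0 <= h -> lq f -> intg (fun w => f (x + incr 0 h w *m s^T)).
Proof. by move=> h0 lf; apply: intg_lq => //; exact: l2_shift. Qed.

(** Uniformity over [ctl] makes the infimum in [opT] finite and supplies the domination hypothesis
    of [freeze]. *)
Lemma cost_bound h f : 0 <= h -> lq f -> exists2 C : R, 0 <= C &
  forall x s, ctl s -> `|cost h f x s| <= C * (1 + `|x| ^+ 2).
Proof.
move=> h0 lf; have [K K0 fK] := lq_quad lf.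
have [iN _] := incr_sq hW (lexx 0) h0.
set e := Ex (fun w => `|incr 0 h w| ^+ 2) in iN *.
have e0 : 0 <= e by apply: mean_ge0 => w; rewrite sqr_ge0.
exists (K * (2 + 2 * B ^+ 2 * e)).
  by rewrite mulr_ge0// addr_ge0// mulr_ge0// mulr_ge0// sqr_ge0.
move=> x s cs; rewrite (le_trans (mean_norm_le (intg_cost _ _ h0 lf)))//.
have ib : intg (fun w => K * (1 + (2 * `|x| ^+ 2 + 2 * B ^+ 2 * `|incr 0 h w| ^+ 2))).
  by apply/intgZ/intgD; [exact: intg_cst|apply: intgD; [exact: intg_cst|exact: intgZ]].
apply: (@le_trans _ _ (Ex (fun w => K * (1 + (2 * `|x| ^+ 2 + 2 * B ^+ 2 * `|incr 0 h w| ^+ 2))))).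
  apply: mean_le => //; first by apply: intg_norm; exact: intg_cost.
  move=> w; apply: (le_trans (fK _)); rewrite ler_wpM2l// lerD2l.
  apply: (@le_trans _ _ ((`|x| + B * `|incr 0 h w|) ^+ 2)).
    rewrite ler_sqr ?nnegrE ?addr_ge0 ?mulr_ge0 ?sq2_ge0//.
    by rewrite (le_trans (ler_normD _ _))// lerD2l mul_frob_le.
  by rewrite (le_trans (sqrD_le _ _))// lerD2l (_ : 2 * B ^+ 2 * _ = 2 * (B * `|incr 0 h w|) ^+ 2)//; ring.
rewrite meanZ; last by apply/intgD; [exact: intg_cst|apply: intgD; [exact: intg_cst|exact: intgZ]].
rewrite -mulrA ler_wpM2l// meanD ?mean_cst; last 2 first.
- exact: intg_cst.
- by apply: intgD; [exact: intg_cst|exact: intgZ].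
rewrite meanD ?mean_cst; last 2 first.
- exact: intg_cst.
- exact: intgZ.
rewrite meanZ// -/e.
have : 0 <= B ^+ 2 * e by rewrite mulr_ge0// sqr_ge0.
have := sqr_ge0 `|x|; rewrite -mulrA; move: (`|x| ^+ 2) (B ^+ 2 * e) => a b a0 b0.
nra.
Qed.

Lemma has_inf_cost h f x : 0 <= h -> lq f -> has_inf [set cost h f x s | s in ctl].
Proof.
move=> h0 lf; have [C C0 hC] := cost_bound h0 lf.
split; first by exists (cost h f x 0), 0 => //; exact: ctl0.
exists (- (C * (1 + `|x| ^+ 2))) => _ [s cs <-].
by have := hC x s cs; rewrite ler_norml => /andP[].
Qed.

Lemma opT_le_cost h f x s : 0 <= h -> lq f -> ctl s -> opT h f x <= cost h f x s.
Proof. by move=> h0 lf cs; apply: ge_inf; [have [] := has_inf_cost x h0 lf|exists s]. Qed.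

Lemma opT_glb h f x c : 0 <= h -> lq f -> (forall s, ctl s -> c <= cost h f x s) ->
  c <= opT h f x.
Proof.
move=> h0 lf hc; apply: lb_le_inf; first by have [] := has_inf_cost x h0 lf.
by move=> _ [s cs <-]; exact: hc.
Qed.

Lemma opT_near h f x e : 0 <= h -> lq f -> 0 < e ->
  exists2 s, ctl s & cost h f x s <= opT h f x + e.
Proof.
move=> h0 lf e0; have [_ [s cs <-] hs] := inf_adherent e0 (has_inf_cost x h0 lf).
by exists s => //; exact: ltW.
Qed.

Lemma cost_mono h f g x s : 0 <= h -> lq f -> lq g -> (forall y, f y <= g y) ->
  cost h f x s <= cost h g x s.
Proof. by move=> h0 lf lg fg; apply: mean_le => //; exact: intg_cost. Qed.

Lemma opT_mono h f g x : 0 <= h -> lq f -> lq g -> (forall y, f y <= g y) ->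
  opT h f x <= opT h g x.
Proof.
move=> h0 lf lg fg; apply: opT_glb => // s cs.
exact: le_trans (opT_le_cost _ h0 lf cs) (cost_mono _ _ h0 lf lg fg).
Qed.

Lemma opT_lip h f x y c : 0 <= h -> lq f ->
  (forall s, ctl s -> cost h f x s <= cost h f y s + c) -> opT h f x <= opT h f y + c.
Proof.
move=> h0 lf hc; rewrite -lerBlDr; apply: opT_glb => // s cs.
by rewrite lerBlDr (le_trans (opT_le_cost _ h0 lf cs))// hc.
Qed.

Lemma opT_addc h f c : 0 <= h -> lq f -> opT h (fun y => f y - c) = fun x => opT h f x - c.
Proof.
move=> h0 lf; have lfc : lq (fun y => f y - c) by apply: lqD => //; exact: lq_cst.
have E x s : cost h (fun y => f y - c) x s = cost h f x s - c.
  rewrite /cost (meanB (Y := cst c)) ?mean_cst//; first exact: intg_cost.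
  exact: intg_cst.
apply/funext => x; apply/eqP; rewrite eq_le; apply/andP; split.
  rewrite lerBrDr; apply: opT_glb => // s cs.
  by rewrite -lerBrDr -E; exact: opT_le_cost.
apply: opT_glb => // s cs; rewrite E lerD2r; exact: opT_le_cost.
Qed.

Lemma opT_le h f x : 0 <= h -> lq f -> opT h f x <= f x.
Proof.
move=> h0 lf; rewrite (le_trans (opT_le_cost x h0 lf ctl0))// /cost.
rewrite (_ : (fun w => _) = cst (f x)) ?mean_cst//.
by apply/funext => w; rewrite trmx0 mulmx0 addr0.
Qed.

Lemma opT0 f x : lq f -> opT 0 f x = f x.
Proof.
move=> lf; apply/eqP; rewrite eq_le opT_le//=; apply: opT_glb => // s cs.
rewrite /cost (_ : (fun w => _) = cst (f x)) ?mean_cst//.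
by apply/funext => w; rewrite /incr subrr mul0mx addr0.
Qed.

(** With the same control and the same noise from [x] and from [y], the difference of the arguments
    stays x - y; the estimate is uniform in the control and thus passes to the infimum. *)
Lemma lq_opT h f : 0 <= h -> lq f -> lq (opT h f).
Proof.
move=> h0 lf; have [K K0 fK] := lf.
have [iN _] := incr_sq hW (lexx 0) h0.
set e := Ex (fun w => `|incr 0 h w| ^+ 2) in iN *.
have e0 : 0 <= e by apply: mean_ge0 => w; rewrite sqr_ge0.
have L0 : 0 <= 1 + 2 * B * (1 + e) by rewrite !addr_ge0// !mulr_ge0// ?sq2_ge0// addr_ge0.
suff main x y : opT h f x <= opT h f y + K * (1 + 2 * B * (1 + e)) * (1 + `|x| + `|y|) * `|x - y|.
  exists (K * (1 + 2 * B * (1 + e))); first exact: mulr_ge0.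
  move=> x y; rewrite ler_norml; apply/andP; split.
    have := main y x; rewrite distrC -addrA [`|y| + _]addrC addrA.
    move: (opT h f x) (opT h f y) (K * _ * _ * _) => a b c; lra.
  by have := main x y; rewrite lerBlDl addrC.
apply: opT_lip => // s cs; rewrite -lerBlDl /cost -meanB; try exact: intg_cost.
have ib : intg (fun w => (K * (1 + 2 * B * (1 + `|incr 0 h w| ^+ 2)) * (1 + `|x| + `|y|)) * `|x - y|).
  rewrite (_ : (fun w => _) = (fun w => (K * (1 + `|x| + `|y|) * `|x - y|) * (1 + 2 * B * (1 + `|incr 0 h w| ^+ 2)))).
    by apply/intgZ/intgD; [exact: intg_cst|apply/intgZ/intgD => //; exact: intg_cst].
  by apply/funext => w; ring.
apply: (le_trans (mean_le (intgB (intg_cost x s h0 lf) (intg_cost y s h0 lf)) ib _)).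
  move=> w; apply: (le_trans (ler_norm _)); apply: (le_trans (fK _ _)).
  set b := incr 0 h w *m s^T.
  rewrite (_ : x + b - (y + b) = x - y); last by rewrite opprD addrACA subrr addr0.
  rewrite ler_wpM2r// -mulrA ler_wpM2l//.
  have hb : `|b| <= B * (1 + `|incr 0 h w| ^+ 2).
    apply: (le_trans (mul_frob_le _ cs)); rewrite ler_wpM2l ?B_ge0//.
    have := sqr_ge0 (`|incr 0 h w| - 1); have := normr_ge0 (incr 0 h w).
    move: `|incr 0 h w| => a; nra.
  have h1 := ler_normD x b; have h2 := ler_normD y b.
  have := normr_ge0 x; have := normr_ge0 y; have b0 := normr_ge0 b.
  move: hb h1 h2 b0.
  move: `|x + b| `|y + b| `|b| `|x| `|y| (B * (1 + `|incr 0 h w| ^+ 2)) (2 * B * (1 + `|incr 0 h w| ^+ 2)) (mulrA 2 B (1 + `|incr 0 h w| ^+ 2)) => xb yb nb nx ny c c2 <-.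
  by move: c => c; nra.
rewrite (_ : (fun w => _) = (fun w => (K * (1 + `|x| + `|y|) * `|x - y|) * (1 + 2 * B * (1 + `|incr 0 h w| ^+ 2)))); last first.
  by apply/funext => w; ring.
rewrite meanZ; last by apply: intgD; [exact: intg_cst|apply/intgZ/intgD => //; exact: intg_cst].
rewrite meanD ?mean_cst; last 2 first.
- exact: intg_cst.
- by apply/intgZ/intgD => //; exact: intg_cst.
rewrite meanZ; last by apply/intgD => //; exact: intg_cst.
rewrite meanD ?mean_cst//; last exact: intg_cst.
by rewrite -/e [leRHS](_ : _ = K * (1 + `|x| + `|y|) * `|x - y| * (1 + 2 * B * (1 + e)))//; ring.
Qed.

End operator.

(** Turns the product of linear terms met in [step_upper] into squares, which are integrable. *)
Lemma dom_aux (R : realType) (a b c : R) : (1 + 2 * a + b * c) * (2 * a) <=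
  (1 + 5 * a ^+ 2 + b ^+ 2 * c ^+ 2) * 2.
Proof.
rewrite -exprMn; move: (b * c) => e.
have := sqr_ge0 (a - 1); have := sqr_ge0 (a - e); have := sqr_ge0 e; have := sqr_ge0 a; nra.
Qed.

Lemma sum_quarters (R : realType) (a b c d e : R) : 0 < e ->
  a - b <= e / 4 -> c <= d + e / 4 -> b <= c + e / 4 -> a <= d + e.
Proof. lra. Qed.

Section one_step.
Context (R : realType) (d : nat) (dO : measure_display)
  (Omega : measurableType dO) (P : probability Omega R)
  (W : R -> Omega -> 'rV[R]_d) (hW : standard_brownian_motion P W).
Local Notation Ex := (mean P).
Local Notation intg := (intg P).
Local Notation incr := (increment W).
Local Notation vec := 'rV[R]_d.
Local Notation mat := 'M[R]_d.
Local Notation Jc := (cost P W).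
Local Notation opT := (opT P W).
Local Notation past s := (g_sigma_algebraType (past_events W s)).
Implicit Types (f g : vec -> R) (x y : vec) (h : R).

(** Brownian scaling. With the trivial event, [indepE] says that two vectors with the same law on
    boxes give the same mean to every [lq] function. *)
Lemma incr_scale h h' (phi : vec -> R) : 0 < h -> 0 < h' -> lq phi ->
  Ex (fun w => phi (incr 0 h w)) = Ex (fun w => phi (Num.sqrt (h / h') *: incr 0 h' w)).
Proof.
move=> h0 h'0 lphi.
have lN := l2_incr hW (lexx 0) (ltW h0).
have c0 : 0 < Num.sqrt (h / h') by rewrite sqrtr_gt0 divr_gt0.
set c := Num.sqrt (h / h') in c0 *.
have lN' : l2 P (fun w => c *: incr 0 h' w).
  have [mN iN] := l2_incr hW (lexx 0) (ltW h'0); split.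
    move=> i j; rewrite (_ : (fun w => _) = (fun w => c * incr 0 h' w i j)).
      by apply: measurable_funM => //; exact: mN.
    by apply/funext => w; rewrite !mxE.
  apply: (eq_integrable _ _ _ _ (intgZ (c ^+ 2) iN)) => // w _.
  by rewrite /= normrZ exprMn gtr0_norm.
have := @indepE _ _ _ P d _ _ setT phi measurableT lN lN' _ lphi.
rewrite probability_setT mul1r => <-.
  by congr Ex; apply/funext => w; rewrite indicT mul1r.
move=> B mB; rewrite setTI mul1e.
have mc i : measurable ((fun x : R => c * x) @^-1` B i).
  rewrite -[X in measurable X]setTI.
  by apply: (measurable_funM (f := cst c) (g := id)) => //; exact: measurable_id.
have -> : box (fun w => c *: incr 0 h' w) B =
    box (incr 0 h') (fun i => (fun x : R => c * x) @^-1` B i).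
  by apply/seteqP; split => w /= hB i; have := hB i; rewrite /= !mxE.
have -> := incr_law0 hW (lexx 0) h'0 mc.
have -> := incr_law0 hW (lexx 0) h0 mB.
apply: eq_bigr => i _.
have sh' : 0 < Num.sqrt h' by rewrite sqrtr_gt0.
have sh : c * Num.sqrt h' = Num.sqrt h.
  by rewrite -sqrtrM ?divr_ge0 ?ltW// divfK// gt_eqF.
have -> : h - 0 = h by rewrite subr0.
have -> : h' - 0 = h' by rewrite subr0.
by rewrite -sh; apply/esym; exact: (normal_probZ c0 sh' (mB i)).
Qed.

(* Over a longer time step one may use the control scaled by sqrt (h / h'). *)
Lemma opT_nincr h h' f x : 0 <= h -> h <= h' -> lq f -> opT h' f x <= opT h f x.
Proof.
move=> h0; rewrite le_eqVlt => /predU1P[<-//|hh'] lf.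
have h'0 : 0 < h' by exact: le_lt_trans hh'.
move: h0; rewrite le_eqVlt => /predU1P[<-|h0].
  by rewrite opT0// opT_le// ltW.
apply: opT_glb => //; first exact: ltW.
move=> s cs.
have lphi : lq (fun z : vec => f (x + z *m s^T)).
  apply: (lq_comp (h := fun z : vec => x + z *m s^T) (C := d%:R * `|s^T|)) => // z z'.
  rewrite opprD addrACA subrr add0r -mulmxBl (le_trans (mulmx_norm_le _ _))//.
  by rewrite mulrAC.
rewrite /cost (incr_scale h0 h'0 lphi).
set c := Num.sqrt (h / h').
have -> : Ex (fun w => f (x + (c *: incr 0 h' w) *m s^T)) = Jc h' f x (c *: s).
  congr mean; apply/funext => w; congr (f (_ + _)).
  by rewrite linearZ/= -scalemxAl scalemxAr.
apply: opT_le_cost => //; first exact: ltW.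
rewrite /ctl /=; apply: le_trans cs.
have c1 : c ^+ 2 <= 1.
  rewrite sqr_sqrtr; first by rewrite ler_pdivrMr// mul1r ltW.
  by rewrite divr_ge0 ?ltW.
rewrite !frobeniusE ler_wsqrtr//; apply: ler_sum => i _; apply: ler_sum => j _.
by rewrite mxE exprMn ler_piMl// sqr_ge0.
Qed.

Lemma cvg_addmul x (z : vec) (s : mat) :
  mxround n x + z *m (mxround n s)^T @[n --> \oo] --> x + z *m s^T.
Proof.
apply: cvgD; first exact: cvg_mxround.
apply/cvgrPdist_le => e e0; near=> n.
rewrite -mulmxBr (le_trans (mulmx_norm_le _ _))//.
rewrite (_ : s^T - _ = (s - mxround n s)^T); last by rewrite linearB.
rewrite norm_trmx.
have c0 : 0 < d%:R * `|z| + 1 by rewrite ltr_wpDl// mulr_ge0.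
apply: (@le_trans _ _ ((d%:R * `|z| + 1) * `|s - mxround n s|)).
  by rewrite ler_wpM2r// lerDl.
rewrite mulrC -ler_pdivlMr//; near: n.
by apply: (cvgrPdist_le _ _).1; [exact: cvg_mxround|rewrite divr_gt0].
Unshelve. all: by end_near. Qed.

(** Continuity along the roundings is the form in which [freeze] asks for it. *)
Lemma cvg_cost h f x (s : mat) : 0 <= h -> lq f ->
  Jc h f (mxround n x) (mxround n s) @[n --> \oo] --> Jc h f x s.
Proof.
move=> h0 lf; have [K K0 fK] := lq_quad lf.
have [iN _] := incr_sq hW (lexx 0) h0.
have [_ c] : intg (fun w => f (x + incr 0 h w *m s^T)) /\
  Ex (fun w => f (mxround n x + incr 0 h w *m (mxround n s)^T)) @[n --> \oo] -->
  Ex (fun w => f (x + incr 0 h w *m s^T)); last exact: c.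
apply: (mean_dct (Z := fun w => K * (1 + (2 * `|x| ^+ 2 +
    2 * (d%:R * frobenius s) ^+ 2 * `|incr 0 h w| ^+ 2)))).
- by move=> n; apply: (intg_meas (P := P)); exact: intg_cost.
- by move=> w; apply: lq_cvg => //; exact: cvg_addmul.
- apply/intgZ/intgD; first exact: intg_cst.
  by apply: intgD; [exact: intg_cst|exact: intgZ].
move=> n w; apply: (le_trans (fK _)); rewrite ler_wpM2l// lerD2l.
rewrite (_ : 2 * (d%:R * frobenius s) ^+ 2 * _ = 2 * (d%:R * frobenius s * `|incr 0 h w|) ^+ 2); last by ring.
apply: le_trans (sqrD_le _ _); rewrite ler_sqr ?nnegrE ?addr_ge0 ?mulr_ge0 ?frobenius_ge0//.
rewrite (le_trans (ler_normD _ _))// lerD ?mxround_le// mul_frob_le//.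
exact: frobenius_round.
Qed.

Section conditioning.
Variables (s t : R) (Y : Omega -> vec) (S : Omega -> mat).
Hypotheses (s0 : 0 <= s) (st : s <= t).
Hypotheses (mY : measmx (T := past s) Y) (mS : measmx (T := past s) S) (lY : l2 P Y).
Hypothesis (cS : forall w, ctl (S w)).

Let h0 : 0 <= t - s. Proof. by rewrite subr_ge0. Qed.

(** [freeze] yields one inequality; the other one is [freeze] for the opposite functions. *)
Lemma step_cost f : lq f ->
  [/\ intg (fun w => Jc (t - s) f (Y w) (S w)),
      intg (fun w => f (Y w + incr s t w *m (S w)^T)) &
      Ex (fun w => f (Y w + incr s t w *m (S w)^T)) =
      Ex (fun w => Jc (t - s) f (Y w) (S w))].
Proof.
move=> lf; have [C C0 hC] := cost_bound hW h0 lf.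
have [i1 i2 h1] := @freeze _ _ _ P d (past_events W s) (@past_sub _ _ _ _ _ _ hW s)
  (incr s t) (incr 0 (t - s)) (l2_incr hW s0 st) (l2_incr hW (lexx 0) h0)
  (incr_indep hW s0 st) f (fun y s' => Jc (t - s) f y s') (Num.sqrt 2) C Y S mY mS lY cS lf
  (fun y s' => @cvg_cost (t - s) f y s' h0 lf) hC (fun y s' _ => lexx _).
have lfN := lqN lf.
have hCN y s' : frobenius s' <= Num.sqrt 2 -> `|- Jc (t - s) f y s'| <= C * (1 + `|y| ^+ 2).
  by move=> cs; rewrite normrN; exact: hC.
have [i3 i4 h2] := @freeze _ _ _ P d (past_events W s) (@past_sub _ _ _ _ _ _ hW s)
  (incr s t) (incr 0 (t - s)) (l2_incr hW s0 st) (l2_incr hW (lexx 0) h0)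
  (incr_indep hW s0 st) (fun y => - f y) (fun y s' => - Jc (t - s) f y s')
  (Num.sqrt 2) C Y S mY mS lY cS lfN
  (fun y s' => cvgN (@cvg_cost (t - s) f y s' h0 lf)) hCN
  (fun y s' _ => ltac:(by rewrite /cost -meanN//; exact: intg_cost)).
split => //; apply/eqP; rewrite eq_le h1 andbT.
by move: h2; rewrite !meanN// lerN2.
Qed.

Lemma l2_step : l2 P (fun w => Y w + incr s t w *m (S w)^T).
Proof.
apply: (l2_add_mul (M := Num.sqrt 2)) => //; first exact: l2_incr.
by move=> i j; apply: (sub_meas (@past_sub _ _ _ _ _ _ hW s)); exact: mS.
Qed.

Lemma step_lower f : lq f ->
  Ex (fun w => opT (t - s) f (Y w)) <= Ex (fun w => f (Y w + incr s t w *m (S w)^T)).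
Proof.
move=> lf; have [i1 i2 ->] := step_cost lf.
apply: mean_le => //; first by apply: intg_lq => //; exact: lq_opT.
by move=> w; exact: opT_le_cost.
Qed.

End conditioning.

(* A measurable near-optimal feedback: the control is near-optimal at the rounded
   position, hence takes finitely many values. *)
Lemma step_upper s t (Y : Omega -> vec) f e : 0 <= s -> s <= t ->
  measmx (T := past s) Y -> l2 P Y -> lq f -> 0 < e ->
  exists S : Omega -> mat, [/\ measmx (T := past s) S, (forall w, ctl (S w)) &
    Ex (fun w => f (Y w + incr s t w *m (S w)^T)) <=
    Ex (fun w => opT (t - s) f (Y w)) + e].
Proof.
move=> s0 st mY lY lf e0.
have h0 : 0 <= t - s by rewrite subr_ge0.
have e2 : 0 < e / 4 by rewrite divr_gt0.
have near_opt y : exists s' : mat, ctl s' /\ Jc (t - s) f y s' <= opT (t - s) f y + e / 4.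
  by have [s' cs' hs'] := opT_near hW y h0 lf e2; exists s'.
have [feedback hfb] := choice near_opt.
pose Yn n w := mxround n (Y w); pose Sn n w := feedback (Yn n w).
have mY' : measmx Y := sub_measmx (@past_sub _ _ _ _ _ _ hW s) mY.
have mYn n : measmx (T := past s) (Yn n).
  move=> i j; apply: (measurable_fin (T := past s) (Q := fun w => mxcell_of n (Y w))
    (fun c => mxcell_val R c i j)) => k.
  exact: (@measurable_mxcell R _ (past s)).
have mSn n : measmx (T := past s) (Sn n).
  move=> i j; apply: (measurable_fin (T := past s) (Q := fun w => mxcell_of n (Y w))
    (fun c => feedback (mxcell_val R c) i j)) => k.
  exact: (@measurable_mxcell R _ (past s)).
have cSn n w : ctl (Sn n w) by have [] := hfb (Yn n w).
have lYn n : l2 P (Yn n).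
  have [_ iY] := lY.
  apply: (l2_of_sq _ iY); first exact: (sub_measmx (@past_sub _ _ _ _ _ _ hW s)).
  by move=> w; rewrite ler_sqr ?nnegrE// mxround_le.
have lT := lq_opT hW h0 lf.
have h1 n : Ex (fun w => f (Yn n w + incr s t w *m (Sn n w)^T)) <=
    Ex (fun w => opT (t - s) f (Yn n w)) + e / 4.
  have [i1 i2 ->] := step_cost s0 st (mYn n) (mSn n) (lYn n) (cSn n) lf.
  have iT : intg (fun w => opT (t - s) f (Yn n w)) by exact: intg_lq.
  rewrite -[e / 4](mean_cst P) -meanD//; last exact: intg_cst.
  apply: mean_le => //; first by apply: intgD => //; exact: intg_cst.
  by move=> w; have [] := hfb (Yn n w).
have c1 : Ex (fun w => opT (t - s) f (Yn n w)) @[n --> \oo] --> Ex (fun w => opT (t - s) f (Y w)).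
  have [K K0 TK] := lq_quad lT.
  suff [] : intg (fun w => opT (t - s) f (Y w)) /\
   Ex (fun w => opT (t - s) f (Yn n w)) @[n --> \oo] --> Ex (fun w => opT (t - s) f (Y w)) by [].
  apply: (mean_dct (Z := fun w => K * (1 + `|Y w| ^+ 2))).
  - by move=> n; apply: (intg_meas (P := P)); exact: intg_lq.
  - by move=> w; apply: lq_cvg => //; exact: cvg_mxround.
  - by apply/intgZ/intgD; [exact: intg_cst|case: lY].
  - move=> n w; apply: (le_trans (TK _)); rewrite ler_wpM2l// lerD2l.
    by rewrite ler_sqr ?nnegrE// mxround_le.
have ifY n : intg (fun w => f (Y w + incr s t w *m (Sn n w)^T)).
  apply: intg_lq => //; exact: (l2_step s0 st (mSn n) lY (cSn n)).
have ifYn n : intg (fun w => f (Yn n w + incr s t w *m (Sn n w)^T)).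
  apply: intg_lq => //; exact: (l2_step s0 st (mSn n) (lYn n) (cSn n)).
(* The control is chosen for the rounded position but applied at [Y]; the error so made tends to 0
   by domination, whatever the controls are. *)
have c2 : Ex (fun w => f (Y w + incr s t w *m (Sn n w)^T) -
    f (Yn n w + incr s t w *m (Sn n w)^T)) @[n --> \oo] --> Ex (cst 0).
  have [K K0 fK] := lf.
  have [iN _] := incr_sq hW s0 st.
  pose B : R := d%:R * Num.sqrt 2.
  have B0 : 0 <= B by rewrite mulr_ge0 ?sqrtr_ge0.
  have bd n w : `|f (Y w + incr s t w *m (Sn n w)^T) -
    f (Yn n w + incr s t w *m (Sn n w)^T)| <=
    K * (1 + 2 * `|Y w| + 2 * B * `|incr s t w|) * `|Y w - Yn n w|.
    apply: (le_trans (fK _ _)).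
    rewrite opprD addrACA subrr addr0 ler_wpM2r// ler_wpM2l//.
    have hb := mul_frob_le (incr s t w) (cSn n w).
    have h3 := ler_normD (Y w) (incr s t w *m (Sn n w)^T).
    have h4 := ler_normD (Yn n w) (incr s t w *m (Sn n w)^T).
    have h5 : `|Yn n w| <= `|Y w| by exact: mxround_le.
    rewrite -/B in hb.
    move: h3 h4 h5 hb.
    move: `|Y w + _| `|Yn n w + _| `|_ *m _| `|Y w| `|Yn n w| `|incr s t w| => a1 a2 a3 a4 a5 a6.
    have -> : 2 * B * a6 = 2 * (B * a6) by rewrite mulrA.
    move: (B * a6) => a7; lra.
  suff [] : intg (cst 0 : Omega -> R) /\ Ex (fun w => f (Y w + incr s t w *m (Sn n w)^T) -
    f (Yn n w + incr s t w *m (Sn n w)^T)) @[n --> \oo] --> Ex (cst 0) by [].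
  apply: (mean_dct (Z := fun w => K * (1 + 5 * `|Y w| ^+ 2 + (2 * B) ^+ 2 * `|incr s t w| ^+ 2) * 2)).
  - by move=> n; apply: (intg_meas (P := P)); exact: intgB.
  - move=> w; apply/norm_cvg0P.
    apply: (@squeeze_cvgr _ _ _ _ (cst 0) (fun n => K * (1 + 2 * `|Y w| + 2 * B * `|incr s t w|) * `|Y w - Yn n w|)).
    + by apply: nearW => n; rewrite normr_ge0 bd.
    + exact: cvg_cst.
    + rewrite -[X in _ --> X](mulr0 (K * (1 + 2 * `|Y w| + 2 * B * `|incr s t w|))).
      apply: cvgMr; apply/norm_cvg0P; rewrite -(subrr (Y w)).
      apply: cvgB; [exact: cvg_cst|exact: cvg_mxround].
  - rewrite (_ : (fun w => _) = (fun w => (2 * K) * (1 + 5 * `|Y w| ^+ 2 + (2 * B) ^+ 2 * `|incr s t w| ^+ 2))); last first.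
      by apply/funext => w; rewrite mulrC mulrA.
    have [_ iY] := lY.
    by apply: intgZ; apply: intgD; [apply: intgD; [exact: intg_cst|exact: intgZ]|exact: intgZ].
  - move=> n w; apply: (le_trans (bd n w)); rewrite -[leLHS]mulrA -[leRHS]mulrA ler_wpM2l//.
    have h12 : `|Y w - Yn n w| <= 2 * `|Y w|.
      rewrite (le_trans (ler_normB _ _))// mulr_natl mulr2n lerD2l; exact: mxround_le.
    apply: (@le_trans _ _ ((1 + 2 * `|Y w| + 2 * B * `|incr s t w|) * (2 * `|Y w|))).
      by rewrite ler_wpM2l// !addr_ge0// !mulr_ge0.
    exact: dom_aux.
rewrite mean_cst in c2.
have E1 : \forall n \near \oo, Ex (fun w => f (Y w + incr s t w *m (Sn n w)^T) -
    f (Yn n w + incr s t w *m (Sn n w)^T)) <= e / 4.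
  have /cvgrPdist_le /(_ _ e2) := c2.
  by apply: filterS => n; rewrite sub0r normrN => h; exact: le_trans (ler_norm _) h.
have E2 : \forall n \near \oo,
    Ex (fun w => opT (t - s) f (Yn n w)) <= Ex (fun w => opT (t - s) f (Y w)) + e / 4.
  have /cvgrPdist_le /(_ _ e2) := c1.
  apply: filterS => n; rewrite distrC => h.
  by rewrite -lerBlDl (le_trans (ler_norm _) h).
have [n [hn1 hn2]] := filter_ex (filterI E1 E2).
exists (Sn n); split => //.
rewrite meanB// in hn1.
exact: (sum_quarters e0 hn1 hn2 (h1 n)).
Qed.

End one_step.

(** For a Euclidean norm this is concavity of f - L |x|^2. The formulation with chords makes sense
    for any norm, in particular for the sup norm of row vectors. *)
Definition semiconcave (R : realType) (V : normedModType R) (L : R) (f : V -> R) :=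
  forall x y s, 0 <= s <= 1 ->
    (1 - s) * f x + s * f y - L * (s * (1 - s)) * `|x - y| ^+ 2 <=
    f ((1 - s) *: x + s *: y).

(** * Semigroup inequality, semiconcavity and iteration of the one-step operator *)

Section operator_properties.
Context (R : realType) (d : nat) (dO : measure_display)
  (Omega : measurableType dO) (P : probability Omega R)
  (W : R -> Omega -> 'rV[R]_d) (hW : standard_brownian_motion P W).
Local Notation Ex := (mean P).
Local Notation intg := (intg P).
Local Notation incr := (increment W).
Local Notation vec := 'rV[R]_d.
Local Notation Jc := (cost P W).
Local Notation opT := (opT P W).
Implicit Types (f g : vec -> R) (x y : vec) (h : R).

(** On the left the control may be revised at time [a], according to the position reached; on the
    right it is frozen over the whole interval. *)
Lemma opT_semigroup a b f x : 0 <= a -> 0 <= b -> lq f ->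
  opT a (opT b f) x <= opT (a + b) f x.
Proof.
move=> a0 b0 lf; apply: opT_glb => //; first exact: addr_ge0.
move=> s cs.
have ab : a <= a + b by rewrite lerDl.
have eb : a + b - a = b by rewrite addrC addKr.
have mY : measmx (T := g_sigma_algebraType (past_events W a)) (fun w => x + incr 0 a w *m s^T).
  apply: measmx_add_mul; [exact: measmx_cst|apply: past_incr|exact: measmx_cst].
    by rewrite lexx.
  by rewrite a0 lexx.
have := @step_lower _ _ _ _ _ _ hW a (a + b) _ (fun=> s) a0 ab mY
  (@measmx_cst _ _ _ _ _ s) (l2_shift hW x s a0) (fun=> cs) f lf.
rewrite eb => h1.
have -> : Jc (a + b) f x s =
  Ex (fun w => f (x + incr 0 a w *m s^T + incr a (a + b) w *m s^T)).
  congr (mean _); apply/funext => w; congr f.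
  have -> : incr 0 (a + b) w = incr 0 a w + incr a (a + b) w.
    by rewrite /increment [RHS]addrC addrA subrK.
  by rewrite mulmxDl addrA.
apply: le_trans h1; apply: opT_le_cost => //; exact: lq_opT.
Qed.

(** [kap * h] bounds the mean of |W_h s^T|^2 over [ctl]: the factor d sqrt 2 comes from
    [mul_frob_le], and the mean square of an increment from [incr_sq]. *)
Definition kap : R := d%:R * Num.sqrt 2 * (d%:R * Num.sqrt 2) * (d%:R * gmoment R 2).

Lemma kap_ge0 : 0 <= kap.
Proof. by rewrite !mulr_ge0 ?sqrtr_ge0// ltW// gmoment2_gt0. Qed.

Lemma cost_sym h f x s : 0 <= h -> lq f ->
  intg (fun w => f (x + incr 0 h w *m s^T) + f (x - incr 0 h w *m s^T)) /\
  Jc h f x s = Ex (fun w => 2^-1 * (f (x + incr 0 h w *m s^T) + f (x - incr 0 h w *m s^T))).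
Proof.
move=> h0 lf.
have lphi : lq (fun z : vec => f (x + z *m s^T)).
  apply: (lq_comp (h := fun z : vec => x + z *m s^T) (C := d%:R * `|s^T|)) => // z z'.
  rewrite opprD addrACA subrr add0r -mulmxBl (le_trans (mulmx_norm_le _ _))//.
  by rewrite mulrAC.
have i1 := intg_cost hW x s h0 lf.
have i2 : intg (fun w => f (x - incr 0 h w *m s^T)).
  rewrite (_ : (fun w => _) = (fun w => f (x + incr 0 h w *m (- s)^T))); first exact: intg_cost.
  by apply/funext => w; rewrite linearN/= mulmxN.
have E2 : Jc h f x s = Ex (fun w => f (x - incr 0 h w *m s^T)).
  rewrite /cost -(incr_sym hW h0 lphi); congr (mean _); apply/funext => w.
  by rewrite mulNmx.
split; first exact: intgD.
rewrite meanZ ?meanD//; last exact: intgD.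
by rewrite -E2 -/(cost _ _ _ _ _ _); move: (cost _ _ _ _ _ _) => j; field.
Qed.

(** By symmetry of the noise, only symmetric averages of [f] around [x] matter, so no derivative is
    involved. It serves twice: with L = 0 for minorants that are midpoint convex, and with L > 0 for
    the time regularity of u0. *)
Lemma opT_sym_lower h f x c L : 0 <= h -> lq f -> 0 <= L ->
  (forall b, c - L * `|b| ^+ 2 <= (f (x + b) + f (x - b)) / 2) ->
  c - L * kap * h <= opT h f x.
Proof.
move=> h0 lf L0 hf; apply: opT_glb => // s cs.
have [iS E] := cost_sym x s h0 lf.
rewrite E.
have [iN eN] := incr_sq hW (lexx 0) h0.
rewrite subr0 in eN.
pose B : R := d%:R * Num.sqrt 2.
have ib : intg (fun w => c - L * (B * B) * `|incr 0 h w| ^+ 2).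
  by apply: intgB; [exact: intg_cst|exact: intgZ].
apply: (@le_trans _ _ (Ex (fun w => c - L * (B * B) * `|incr 0 h w| ^+ 2))).
  rewrite meanB ?mean_cst ?meanZ//; [|exact: intg_cst|exact: intgZ].
  rewrite lerD2l lerN2 -[leLHS]mulrA -[leRHS]mulrA ler_wpM2l//.
  have B0 : 0 <= B * B by rewrite -expr2 sqr_ge0.
  by rewrite /kap -/B -[leRHS]mulrA ler_wpM2l.
apply: mean_le => //; first exact: intgZ.
move=> w; rewrite [leRHS]mulrC; apply: le_trans (hf _).
rewrite lerD2l lerN2 -[leRHS]mulrA ler_wpM2l//.
rewrite -expr2 -exprMn ler_sqr ?nnegrE ?mulr_ge0 ?sqrtr_ge0//.
exact: mul_frob_le.
Qed.

(** Run the same control from [x], from [y] and from their mixture: the mixture of the trajectories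
    is the trajectory of the mixture, and their difference stays x - y. *)
Lemma opT_semiconcave h f L : 0 <= h -> lq f -> semiconcave L f ->
  semiconcave L (opT h f).
Proof.
move=> h0 lf sc x y r r01.
apply: opT_glb => // s cs; have /andP[r0 r1] := r01.
have r1' : 0 <= 1 - r by rewrite subr_ge0.
apply: (@le_trans _ _ ((1 - r) * Jc h f x s + r * Jc h f y s -
    L * (r * (1 - r)) * `|x - y| ^+ 2)).
  by rewrite lerD2r lerD// ler_wpM2l// opT_le_cost.
have ix := intg_cost hW x s h0 lf; have iy := intg_cost hW y s h0 lf.
rewrite /cost -!meanZ// -meanD; [|exact: intgZ|exact: intgZ].
rewrite -[X in _ - X](mean_cst P) -meanB; last 2 first.
- by apply: intgD; exact: intgZ.
- exact: intg_cst.
apply: mean_le => //.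
- by apply: intgB; [apply: intgD; exact: intgZ|exact: intg_cst].
- exact: intg_cost.
move=> w; set b := incr 0 h w *m s^T.
have := sc (x + b) (y + b) r r01.
rewrite opprD addrACA subrr addr0 => /le_trans; apply.
rewrite !scalerDr addrACA -scalerDl subrK scale1r.
exact: lexx.
Qed.

Section iterates.
Variables (h : R) (h0 : 0 <= h).

Lemma lq_iter n f : lq f -> lq (iter n (opT h) f).
Proof. by move=> lf; elim: n => //= n IH; exact: lq_opT. Qed.

Lemma iter_mono n f g x : lq f -> lq g -> (forall y, f y <= g y) ->
  iter n (opT h) f x <= iter n (opT h) g x.
Proof.
move=> lf lg fg; elim: n x => //= n IH x.
by apply: opT_mono => //; exact: lq_iter.
Qed.

Lemma iter_addc n f c : lq f ->
  iter n (opT h) (fun y => f y - c) = fun x => iter n (opT h) f x - c.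
Proof.
move=> lf; elim: n => //= n ->; rewrite (opT_addc hW)//; exact: lq_iter.
Qed.

Lemma iter_semiconcave n f L : lq f -> semiconcave L f -> semiconcave L (iter n (opT h) f).
Proof.
by move=> lf sc; elim: n => //= n IH; apply: opT_semiconcave => //; exact: lq_iter.
Qed.

Lemma iter_le n f x : lq f -> iter n (opT h) f x <= f x.
Proof.
move=> lf; elim: n x => //= n IH x.
by apply: le_trans (IH x); apply: opT_le => //; exact: lq_iter.
Qed.

Lemma iter_ndec n m f x : lq f -> (n <= m)%N -> iter m (opT h) f x <= iter n (opT h) f x.
Proof.
by move=> lf nm; rewrite -(subnK nm) iterD; apply: iter_le; exact: lq_iter.
Qed.

Lemma iter_lower n f v x : lq f -> (forall y, v y <= f y) ->
  (forall y b, v y <= (v (y + b) + v (y - b)) / 2) -> v x <= iter n (opT h) f x.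
Proof.
move=> lf vf vc; elim: n x => //= n IH x.
have := @opT_sym_lower h (iter n (opT h) f) x (v x) 0 h0 (lq_iter n lf) (lexx 0).
rewrite !mul0r subr0; apply => b; rewrite mul0r subr0 (le_trans (vc x b))//.
by rewrite ler_wpM2r// lerD.
Qed.

Lemma iter_sub n f c : lq f -> (forall x, f x - c <= opT h f x) ->
  forall x, f x - n%:R * c <= iter n (opT h) f x.
Proof.
move=> lf hf; elim: n => [x|n IH x]; first by rewrite mul0r subr0.
have lfc : lq (fun y => f y - n%:R * c) by apply: lqD => //; exact: lq_cst.
have := @opT_mono _ _ _ _ _ _ hW h _ _ x h0 lfc (lq_iter n lf) IH.
rewrite (opT_addc hW)//= => /(le_trans _); apply.
by rewrite -natr1 mulrDl mul1r opprD addrCA [leRHS]addrC lerD2l.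
Qed.

Lemma iter_refine n f x : lq f -> iter n (opT h) f x <= opT (n%:R * h) f x.
Proof.
move=> lf; elim: n x => [x|n IH x]; first by rewrite mul0r opT0.
rewrite -natr1 mulrDl mul1r addrC /=.
have nh : 0 <= n%:R * h by rewrite mulr_ge0.
apply: le_trans (opT_semigroup x h0 nh lf).
by apply: opT_mono => //; [exact: lq_iter|exact: lq_opT].
Qed.

End iterates.

Lemma iter_double h n f x : 0 <= h -> lq f ->
  iter (n * 2) (opT h) f x <= iter n (opT (2 * h)) f x.
Proof.
move=> h0 lf; have h2 : 0 <= 2 * h by rewrite mulr_ge0.
elim: n x => [x|n IH x]; first by rewrite mul0n /= lexx.
rewrite mulSn iterD.
change (iter n.+1 (opT (2 * h)) f x) with (opT (2 * h) (iter n (opT (2 * h)) f) x).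
have l1 := lq_iter h0 (n * 2) lf; have l2 := lq_iter h2 n lf.
apply: (le_trans (iter_refine h0 2 x l1)).
exact: opT_mono.
Qed.

Lemma foldr_lq (hs : seq R) f : all (fun h => 0 <= h) hs -> lq f ->
  lq (foldr opT f hs).
Proof. by move=> + lf; elim: hs => //= h hs IH /andP[h0 /IH]; exact: lq_opT. Qed.

(* Rounds each step up to a multiple of dl. *)
Lemma foldr_lower (hs : seq R) f dl : 0 < dl -> all (fun h => 0 <= h) hs -> lq f ->
  exists N : nat, N%:R * dl <= \sum_(h <- hs) h + (size hs)%:R * dl /\
   forall x, iter N (opT dl) f x <= foldr opT f hs x.
Proof.
move=> dl0 + lf; elim: hs => [_|h hs IH /=/andP[h0 /[dup] hs0 /IH[N [hN HN]]]].
  by exists 0; split => //; rewrite big_nil /= !mul0r addr0.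
(* The successor ensures h <= k dl, while k dl exceeds h by at most one [dl]. *)
pose k := (Num.truncn (h / dl)).+1.
have hk : h <= k%:R * dl by rewrite -ler_pdivrMr// ltW// truncnS_gt.
have hk2 : k%:R * dl <= h + dl.
  rewrite -natr1 mulrDl mul1r lerD2r -ler_pdivlMr// truncn_le divr_ge0//.
  exact: ltW.
exists (k + N)%N; split.
  rewrite big_cons natrD mulrDl -natr1 mulrDl mul1r.
  move: hN hk2; move: (k%:R * dl) (N%:R * dl) ((size hs)%:R * dl) (\sum_(_ <- hs) _).
  move=> a b c e; lra.
move=> x; rewrite iterD.
have dl0' := ltW dl0.
have l1 := foldr_lq hs0 lf.
apply: (@le_trans _ _ (iter k (opT dl) (foldr opT f hs) x)).
  by apply: iter_mono => //; exact: lq_iter.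
apply: (le_trans (iter_refine dl0' k x l1)).
exact: opT_nincr.
Qed.

End operator_properties.

(** * Elementary controls *)

Section walks.
Context (R : realType) (d : nat) (dO : measure_display)
  (Omega : measurableType dO) (P : probability Omega R)
  (W : R -> Omega -> 'rV[R]_d) (hW : standard_brownian_motion P W).
Local Notation Ex := (mean P).
Local Notation intg := (intg P).
Local Notation incr := (increment W).
Local Notation vec := 'rV[R]_d.
Local Notation mat := 'M[R]_d.
Local Notation opT := (opT P W).
Local Notation past s := (g_sigma_algebraType (past_events W s)).
Implicit Types (f g : vec -> R) (x y : vec) (h : R) (kn : nat -> R) (lev : nat -> Omega -> mat).

Definition walk kn lev x n (w : Omega) : vec :=
  x + \sum_(j < n) incr (kn j) (kn j.+1) w *m (lev j w)^T.

Lemma walkS kn lev x n w :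
  walk kn lev x n.+1 w = walk kn lev x n w + incr (kn n) (kn n.+1) w *m (lev n w)^T.
Proof. by rewrite /walk big_ord_recr /= addrA. Qed.

Definition controls M kn n lev := forall j, (j < n)%N ->
  measmx (T := past (kn j)) (lev j) /\ forall w, frobenius (lev j w) <= M.

Lemma controlsW M kn n lev : controls M kn n.+1 lev -> controls M kn n lev.
Proof. by move=> h j jn; apply: h; exact: ltnW. Qed.

Lemma knot_ge0 kn n : kn 0%N = 0 -> (forall k, (k < n)%N -> kn k <= kn k.+1) ->
  forall j, (j <= n)%N -> 0 <= kn j.
Proof.
move=> k0 kn_mono; elim=> [|j IH] jn; first by rewrite k0.
exact: le_trans (IH (ltnW jn)) (kn_mono _ jn).
Qed.

Lemma walk_meas M kn n lev x : kn 0%N = 0 -> (forall k, (k < n)%N -> kn k <= kn k.+1) ->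
  controls M kn n lev ->
  measmx (T := past (kn n)) (walk kn lev x n) /\ l2 P (walk kn lev x n).
Proof.
move=> k0; elim: n => [|n IH] kn_mono hl.
  have -> : walk kn lev x 0 = cst x by apply/funext => w; rewrite /walk big_ord0 addr0.
  by split; [exact: measmx_cst|exact: l2_cst].
have [mY lY] := IH (fun k ltk => kn_mono k (ltnW ltk)) (controlsW hl).
have kn0 := knot_ge0 k0 kn_mono (leqnSn n).
have [mS cS] := hl n (ltnSn n).
have kS := kn_mono n (ltnSn n).
have -> : walk kn lev x n.+1 =
    (fun w => walk kn lev x n w + incr (kn n) (kn n.+1) w *m (lev n w)^T).
  by apply/funext => w; rewrite walkS.
have up (X : Omega -> R) : measurable_fun [set: past (kn n)] (X : past (kn n) -> R) ->
    measurable_fun [set: past (kn n.+1)] (X : past (kn n.+1) -> R).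
  move=> mX _ A mA; apply: (past_mono kS); exact: mX.
have kn1 := le_trans kn0 kS.
split.
  apply: measmx_add_mul; [|apply: past_incr|]; rewrite ?kn0 ?kn1 ?lexx ?kS//.
  - by move=> i j; apply: up; exact: mY.
  - by move=> i j; apply: up; exact: mS.
apply: (l2_add_mul (M := M)) => //; first exact: l2_incr.
by move=> i j; apply: (sub_meas (@past_sub _ _ _ _ _ _ hW (kn n))); exact: mS.
Qed.

(** The last increment is peeled off first: given the past, it costs at least one application of
    [opT] to the terminal cost. The induction therefore runs over all [f]. *)
Lemma walk_lower kn n lev x f : kn 0%N = 0 -> (forall k, (k < n)%N -> kn k <= kn k.+1) ->
  controls (Num.sqrt 2) kn n lev -> lq f ->
  foldr opT f (mkseq (fun k => kn k.+1 - kn k) n) x <= Ex (fun w => f (walk kn lev x n w)).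
Proof.
move=> k0; elim: n f => [|n IH] f kn_mono hl lf.
  rewrite /= (_ : (fun w => _) = cst (f x)) ?mean_cst//.
  by apply/funext => w; rewrite /walk big_ord0 addr0.
have kn_mono' k (ltk : (k < n)%N) := kn_mono k (ltnW ltk).
have hl' := controlsW hl.
have [mY lY] := walk_meas x k0 kn_mono' hl'.
have kn0 := knot_ge0 k0 kn_mono (leqnSn n).
have [mS cS] := hl n (ltnSn n).
have kS := kn_mono n (ltnSn n).
have h0 : 0 <= kn n.+1 - kn n by rewrite subr_ge0.
rewrite mkseqS foldr_rcons.
apply: (le_trans (IH _ kn_mono' hl' (lq_opT hW h0 lf))).
apply: (le_trans (step_lower hW kn0 kS mY mS lY cS lf)).
by rewrite (_ : (fun w => f (walk kn lev x n.+1 w)) =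
  (fun w => f (walk kn lev x n w + incr (kn n) (kn n.+1) w *m (lev n w)^T)))//;
  apply/funext => w; rewrite walkS.
Qed.

Lemma walk_upper h n x f e : 0 <= h -> 0 < e -> lq f ->
  exists lev, controls (Num.sqrt 2) (fun k => k%:R * h) n lev /\
   Ex (fun w => f (walk (fun k => k%:R * h) lev x n w)) <= iter n (opT h) f x + n%:R * e.
Proof.
move=> h0 e0; elim: n f => [|n IH] f lf.
  exists (fun _ _ => 0); split => //.
  rewrite mul0r addr0 /= (_ : (fun w => _) = cst (f x)) ?mean_cst//.
  by apply/funext => w; rewrite /walk big_ord0 addr0.
(* Build the first n controls for the terminal cost [opT h f]; the last one is then chosen by
   [step_upper], at the price of one more [e]. *)
have [lev [hl hE]] := IH _ (lq_opT hW h0 lf).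
set kn := fun k : nat => k%:R * h in hl hE *.
have k0 : kn 0%N = 0 by rewrite /kn mul0r.
have kn_mono k : (k < n)%N -> kn k <= kn k.+1 by rewrite /kn ler_wpM2r// ler_nat.
have [mY lY] := walk_meas x k0 kn_mono hl.
have kn0 : 0 <= kn n by rewrite mulr_ge0.
have kS : kn n <= kn n.+1 by rewrite /kn ler_wpM2r// ler_nat.
have eh : kn n.+1 - kn n = h by rewrite /kn -natr1 mulrDl mul1r addrC addKr.
have [S [mS cS hS]] := step_upper hW kn0 kS mY lY lf e0.
exists (fun j => if (j < n)%N then lev j else S); split.
  move=> j; rewrite ltnS leq_eqVlt => /orP[/eqP ->|jn]; last by rewrite jn; exact: hl.
  by rewrite ltnn.
rewrite iterSr -natr1 mulrDl mul1r addrA.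
apply: (@le_trans _ _ (Ex (fun w => opT h f (walk kn lev x n w)) + e)); last by rewrite lerD2r.
rewrite eh in hS; apply: le_trans hS.
rewrite (_ : (fun w => f (walk _ _ x n.+1 w)) =
  (fun w => f (walk kn lev x n w + incr (kn n) (kn n.+1) w *m (S w)^T)))//.
apply/funext => w; rewrite walkS ltnn; congr (f (_ + _)).
rewrite /walk; congr (_ + _); apply: eq_bigr => j _.
by rewrite ltn_ord.
Qed.

Lemma enorm_sq (x : vec) : enorm x ^+ 2 = \sum_i x 0 i ^+ 2.
Proof. by rewrite sqr_sqrtr// sumr_ge0// => i _; rewrite sqr_ge0. Qed.

Lemma frobeniusZ c (A : mat) : frobenius (c *: A) = `|c| * frobenius A.
Proof.
rewrite !frobeniusE -sqrtr_sqr -sqrtrM ?sqr_ge0//; congr Num.sqrt.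
rewrite big_distrr; apply: eq_bigr => i _; rewrite big_distrr; apply: eq_bigr => j _.
by rewrite mxE exprMn.
Qed.

Lemma frobenius0 : frobenius (0 : mat) = 0.
Proof. by rewrite frobeniusE big1 ?sqrtr0// => i _; rewrite big1// => j _; rewrite mxE expr0n. Qed.

Lemma step_value_in (S : step_process R d Omega) s w k :
  (forall k, (k < steps S)%N -> knot S k <= knot S k.+1) ->
  (k < steps S)%N -> knot S k < s <= knot S k.+1 -> step_value S s w = level S k w.
Proof.
move=> mono kn ks; rewrite /step_value (bigD1 (Ordinal kn))//= ks scale1r big1 ?addr0//.
move=> j jk.
have mono' a b : (a <= b)%N -> (b <= steps S)%N -> knot S a <= knot S b.
  move=> ab; rewrite -(subnK ab); elim: (b - a)%N => // m IH h.
  by apply: (le_trans (IH (ltnW h))); exact: mono.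
rewrite (_ : (_ < _ <= _) = false) ?scale0r//; apply/negbTE/negP => /andP[h1 h2].
move/andP : ks => [h3 h4].
have [jk'|kj|jk'] := ltngtP j k.
- by have := lt_le_trans h3 (le_trans h2 (mono' _ _ jk' (ltnW kn))); rewrite ltxx.
- by have := lt_le_trans h1 (le_trans h4 (mono' _ _ kj (ltnW (ltn_ord j)))); rewrite ltxx.
- by move/eqP : jk; apply; apply: val_inj.
Qed.

Lemma step_value_out (S : step_process R d Omega) s w :
  (forall k, (k < steps S)%N -> ~~ (knot S k < s <= knot S k.+1)) -> step_value S s w = 0.
Proof. by move=> h; rewrite /step_value big1// => k _; rewrite (negbTE (h k _)) ?scale0r. Qed.

Lemma step_value_cases (S : step_process R d Omega) s :
  (exists2 k, (k < steps S)%N & knot S k < s <= knot S k.+1) \/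
  (forall k, (k < steps S)%N -> ~~ (knot S k < s <= knot S k.+1)).
Proof.
have [h|h] := pselect (exists2 k, (k < steps S)%N & knot S k < s <= knot S k.+1).
  by left.
by right => k kn; apply/negP => hk; apply: h; exists k.
Qed.

Lemma elementary_admissible t (S : step_process R d Omega) : elementary W t S ->
  (forall k w, (k < steps S)%N -> frobenius (level S k w) <= 1) ->
  admissible_control W (step_value S).
Proof.
move=> [k0 kt mono mlev _] lev1; split; last first.
  move=> s w s0; have [[k kn ks]|h] := step_value_cases S s.
    by rewrite (step_value_in w mono kn ks); exact: lev1.
  by rewrite step_value_out// frobenius0.
move=> t' t'0 i j.
pose T2 : measurableType _ := (measurableTypeR R * past t')%type.
have mD : measurable (`[0, t'] `*` [set: Omega] : set T2).
  by apply: measurableX => //; exact: (@measurableT _ (past t')).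
rewrite (_ : (fun p => _) = (fun p : T2 => \sum_(k < steps S)
    ((knot S k < p.1 <= knot S k.+1)%R%:R * level S k p.2 i j))); last first.
  apply/funext => p; rewrite /step_value summxE; apply: eq_bigr => k _.
  by rewrite mxE.
apply: measurable_sum => k.
(* A step starting at t' or later vanishes on [0, t']; the levels of the other steps are measurable
   for the past of t' by [past_mono]. *)
have [kt'|t'k] := ltP (knot S k) t'; last first.
  apply: (@eq_measurable_fun _ _ T2 R _ (fun=> 0 : R)); last exact: measurable_cst.
  move=> p; rewrite inE => -[/= + _]; rewrite in_itv/= => /andP[_ pt].
  by rewrite ltNge (le_trans pt t'k) mul0r.
apply: measurable_funM.
  rewrite (_ : (fun p => _) = (\1_(`]knot S k, knot S k.+1]) \o (fst : T2 -> measurableTypeR R))); last first.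
    by apply/funext => p; rewrite /= indicE mem_setE in_itv.
  apply: measurable_funTS; apply: measurableT_comp; last exact: measurable_fst.
  exact: measurable_indic.
apply: measurable_funTS.
have ml : measurable_fun [set: past t'] (fun w : past t' => level S k w i j).
  by move=> _ A mA; apply: (past_mono (ltW kt')); exact: mlev.
exact: (measurableT_comp ml (@measurable_snd _ _ (measurableTypeR R) (past t'))).
Qed.

Lemma elementary_ito t (S : step_process R d Omega) : 0 <= t -> elementary W t S ->
  is_ito_integral P W (step_value S) t (step_integral W S).
Proof.
move=> t0 eS; have [k0 kt mono mlev [M hM]] := eS.
have hl : controls M (knot S) (steps S) (level S).
  by move=> j jn; split=> [i k|w]; [exact: mlev|exact: hM].
have E : step_integral W S = walk (knot S) (level S) 0 (steps S).
  by apply/funext => w; rewrite /walk add0r.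
split.
  move=> i; rewrite E; have [_ [mW _]] := walk_meas 0 k0 mono hl; exact: mW.
exists (fun=> S); split=> //.
- rewrite (_ : (fun n => _) = cst 0%E); first exact: cvg_cst.
  apply/funext => n; rewrite integral0_eq// => w _.
  rewrite integral0_eq// => s _.
  by rewrite subrr frobenius0 expr0n.
- rewrite (_ : (fun n => _) = cst 0%E); first exact: cvg_cst.
  apply/funext => n; rewrite expectation_mean.
    rewrite (_ : (fun w => _) = cst 0) ?mean_cst//.
    by apply/funext => w; rewrite subrr enorm_sq big1// => i _; rewrite mxE expr0n.
  rewrite (_ : (fun w => _) = cst 0); first exact: intg_cst.
  by apply/funext => w; rewrite subrr enorm_sq big1// => i _; rewrite mxE expr0n.
Qed.

Lemma value_upper t (N : nat) x f e : 0 <= t -> (0 < N)%N -> 0 < e -> lq f ->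
  exists sigma X, [/\ admissible_control W sigma, is_ito_integral P W sigma t X,
    intg (fun w => f (x + Num.sqrt 2 *: X w)) &
    Ex (fun w => f (x + Num.sqrt 2 *: X w)) <= iter N (opT (t / N%:R)) f x + e].
Proof.
move=> t0 N0 e0 lf.
have N0' : 0 < N%:R :> R by rewrite ltr0n.
have h0 : 0 <= t / N%:R by rewrite divr_ge0.
have [lev [hl hE]] := walk_upper N x h0 (divr_gt0 e0 N0') lf.
set kn := fun k : nat => k%:R * (t / N%:R) in hl hE *.
have s2 : 0 < Num.sqrt 2 :> R by rewrite sqrtr_gt0.
(* The walk is driven by matrices of norm at most sqrt 2; dividing by sqrt 2 makes them admissible,
   and the factor sqrt 2 of the value function restores the walk. *)
pose S := @StepProcess R d dO Omega N kn (fun k w => (Num.sqrt 2)^-1 *: lev k w).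
have lev1 k w : (k < steps S)%N -> frobenius (level S k w) <= 1.
  move=> kN; rewrite /= frobeniusZ gtr0_norm ?invr_gt0// mulrC ler_pdivrMr// mul1r.
  by have [_] := hl k kN.
have eS : elementary W t S.
  split => /=.
  - by rewrite /kn mul0r.
  - by rewrite /kn mulrC divfK// gt_eqF.
  - by move=> k _; rewrite /kn ler_wpM2r// ler_nat.
  - move=> k i j kN.
    rewrite (_ : (fun w => _) = (fun w => (Num.sqrt 2)^-1 * lev k w i j)).
      by apply: measurable_funM => //; have [] := hl k kN.
    by apply/funext => w; rewrite mxE.
  - by exists 1 => k w; exact: lev1.
have E w : x + Num.sqrt 2 *: step_integral W S w = walk kn lev x N w.
  rewrite /walk /step_integral scaler_sumr; congr (_ + _); apply: eq_bigr => k _ /=.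
  by rewrite linearZ/= -scalemxAr scalerA mulfV ?scale1r// gt_eqF.
have kn_mono k : (k < N)%N -> kn k <= kn k.+1 by rewrite /kn ler_wpM2r// ler_nat.
have k0 : kn 0%N = 0 by rewrite /kn mul0r.
have [_ lY] := walk_meas x k0 kn_mono hl.
have EE : (fun w => f (x + Num.sqrt 2 *: step_integral W S w)) = (fun w => f (walk kn lev x N w)).
  by apply/funext => w; rewrite E.
exists (step_value S), (step_integral W S); split.
- exact: elementary_admissible eS lev1.
- exact: elementary_ito.
- by rewrite EE; exact: intg_lq.
- by rewrite EE (le_trans hE)// [N%:R * _]mulrC divfK// gt_eqF.
Qed.

End walks.

(** * Lower bound for arbitrary Ito integrals *)

Section nonneg_integrals.
Context (R : realType).
Import HBNNSimple.

(** The integral of a nonnegative function is a supremum over the simple functions below it, and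
    this family grows with the function. *)
Lemma ge0_le_integral_set dT (T : measurableType dT) (mu : {measure set T -> \bar R})
  (D : set T) (f g : T -> \bar R) :
  (forall x, D x -> (0 <= f x)%E) -> (forall x, D x -> (f x <= g x)%E) ->
  (\int[mu]_(x in D) f x <= \int[mu]_(x in D) g x)%E.
Proof.
move=> f0 fg.
have g0 x : D x -> (0 <= g x)%E by move=> Dx; exact: le_trans (f0 x Dx) (fg x Dx).
rewrite !ge0_integralE//; apply: le_ereal_sup => _ [h hf <-].
exists h => // x; apply: (le_trans (hf x)); rewrite !patchE.
by case: ifPn => // xD; apply: fg; rewrite inE in xD.
Qed.

(* [g] is not assumed measurable: nothing is known about the joint measurability
   of the integrand of the Ito approximation on [0, t] x Omega. *)
Lemma integral_steps_le (kn c : nat -> R) (n : nat) (t : R) (g : R -> \bar R) :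
  kn 0%N = 0 -> kn n = t -> (forall k, (k < n)%N -> kn k <= kn k.+1) ->
  (forall k, (k < n)%N -> 0 <= c k) ->
  (forall s, 0 <= s <= t -> (0 <= g s)%E) ->
  (forall k s, (k < n)%N -> kn k < s <= kn k.+1 -> ((c k)%:E <= g s)%E) ->
  ((\sum_(k < n) c k * (kn k.+1 - kn k))%:E <= \int[lebesgue_measure]_(s in `[0%R, t]) g s)%E.
Proof.
move=> k0 kt mono c0 g0 cg.
have mono' a b : (a <= b)%N -> (b <= n)%N -> kn a <= kn b.
  move=> ab; rewrite -(subnK ab); elim: (b - a)%N => // m IH h.
  by apply: (le_trans (IH (ltnW h))); exact: mono.
pose I k : set R := `]kn k, kn k.+1]%classic.
have mI k : measurable_fun [set: R] (fun s => (\1_(I k) s : R)%:E).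
  apply/measurable_EFinP; apply: measurable_indic; exact: measurable_itv.
apply: (@le_trans _ _ (\int[lebesgue_measure]_(s in `[0%R, t])
   (\sum_(k < n) (c k)%:E * (\1_(I k) s)%:E))%E); last first.
  apply: ge0_le_integral_set => s; rewrite /= in_itv/= => st.
    by apply: sume_ge0 => k _; rewrite mule_ge0// lee_fin c0.
  have [[k kn' ks]|h] := pselect (exists2 k, (k < n)%N & kn k < s <= kn k.+1).
    rewrite (bigD1 (Ordinal kn'))//= big1 ?adde0.
      by rewrite indicE mem_set ?mule1 ?cg// /I /= in_itv.
    move=> j jk; rewrite indicE (_ : (s \in I j) = false) ?mule0//; apply/negbTE/negP.
    rewrite inE /I /= in_itv /= => /andP[h1 h2].
    move/andP : ks => [h3 h4].
    have [jk'|kj|jk'] := ltngtP j k.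
    - by have := lt_le_trans h3 (le_trans h2 (mono' _ _ jk' (ltnW kn'))); rewrite ltxx.
    - by have := lt_le_trans h1 (le_trans h4 (mono' _ _ kj (ltnW (ltn_ord j)))); rewrite ltxx.
    - by move/eqP : jk; apply; apply: val_inj.
  rewrite big1 ?g0// => k _; rewrite indicE (_ : (s \in I k) = false) ?mule0//.
  by apply/negbTE/negP; rewrite inE /I /= in_itv /= => hk; apply: h; exists k.
rewrite ge0_integral_sum//; last 2 first.
- by move=> k; apply: measurable_funTS; apply: emeasurable_funM => //; exact: mI.
- by move=> k s _; rewrite mule_ge0// lee_fin c0.
rewrite -sumEFin; apply: lee_sum => k _.
have kn' := ltn_ord k.
rewrite ge0_integralZl//; try (by apply: measurable_funTS; exact: mI);
  try (by rewrite lee_fin c0).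
rewrite EFinM lee_wpmul2l ?lee_fin ?c0//.
rewrite integral_indic//=; last exact: measurable_itv.
rewrite setIidl; last first.
  move=> s; rewrite /I /= !in_itv/= => /andP[h1 h2].
  rewrite (le_trans _ (ltW h1)) -?k0 ?mono'//=; last exact: ltnW.
  by rewrite (le_trans h2)// -kt mono'.
rewrite lebesgue_measure_itv/= lte_fin.
case: ltP => h; first by rewrite -EFinB.
by rewrite lee_fin subr_le0.
Qed.

Lemma cvg0_ereal_le (a : nat -> \bar R) e : a n @[n --> \oo] --> 0%E -> 0 < e ->
  \forall n \near \oo, (a n <= e%:E)%E.
Proof.
move=> /fine_cvgP[fin /cvgrPdist_le h] e0.
have := h e e0; apply: filterS2 fin => n fn; rewrite sub0r normrN => h'.
by rewrite -(fineK fn) lee_fin (le_trans (ler_norm _)).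
Qed.

End nonneg_integrals.

Section ito_estimates.
Context (R : realType) (d : nat) (dO : measure_display)
  (Omega : measurableType dO) (P : probability Omega R)
  (W : R -> Omega -> 'rV[R]_d) (hW : standard_brownian_motion P W).
Local Notation Ex := (mean P).
Local Notation intg := (intg P).
Local Notation incr := (increment W).
Local Notation vec := 'rV[R]_d.
Local Notation mat := 'M[R]_d.
Local Notation Jc := (cost P W).
Local Notation opT := (opT P W).

(** Common form of the squares of [enorm] and [frobenius]; it obeys the parallelogram law [sqnD],
    which the sup norm does not. *)
Definition sqn p q (A : 'M[R]_(p, q)) : R := \sum_i \sum_j A i j ^+ 2.

Lemma sqn_ge0 p q (A : 'M[R]_(p, q)) : 0 <= sqn A.
Proof. by apply: sumr_ge0 => i _; apply: sumr_ge0 => j _; rewrite sqr_ge0. Qed.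

Lemma sqn_row (x : vec) : sqn x = enorm x ^+ 2.
Proof. by rewrite enorm_sq /sqn big_ord1. Qed.

Lemma sqn_frob (A : mat) : sqn A = frobenius A ^+ 2.
Proof. by rewrite frobenius_sq. Qed.

Lemma sqn_le p q (A : 'M[R]_(p, q)) : sqn A <= p%:R * q%:R * `|A| ^+ 2.
Proof.
apply: (@le_trans _ _ (\sum_(i < p) \sum_(j < q) `|A| ^+ 2)).
  apply: ler_sum => i _; apply: ler_sum => j _.
  by rewrite -[leLHS]real_normK ?num_real// ler_sqr ?nnegrE// mx_entry_le.
rewrite (eq_bigr (fun=> `|A| ^+ 2 *+ q)) => [|i _]; last by rewrite sumr_const card_ord.
by rewrite sumr_const card_ord -mulrnA mulnC -natrM mulr_natl.
Qed.

Lemma le_sqn (x : vec) : `|x| ^+ 2 <= sqn x.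
Proof. by rewrite sqn_row enorm_sq norm_row_sq. Qed.

Lemma sqnD p q (A B : 'M[R]_(p, q)) : sqn (A + B) + sqn (A - B) = 2 * sqn A + 2 * sqn B.
Proof.
rewrite /sqn !mulr_sumr -!big_split; apply: eq_bigr => i _ /=.
rewrite !mulr_sumr -!big_split; apply: eq_bigr => j _ /=.
by rewrite !mxE; ring.
Qed.

Lemma sqnD_le p q (A B : 'M[R]_(p, q)) : sqn (A + B) <= 2 * sqn A + 2 * sqn B.
Proof. by rewrite -sqnD lerDl sqn_ge0. Qed.

Lemma lq_sqn p q : lq (@sqn p q).
Proof.
exists (p%:R * q%:R); first exact: mulr_ge0.
move=> A B.
rewrite /sqn -sumrB (le_trans (ler_norm_sum _ _ _))//.
apply: (@le_trans _ _ (\sum_(i < p) \sum_(j < q) (1 + `|A| + `|B|) * `|A - B|)).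
  apply: ler_sum => i _; rewrite -sumrB (le_trans (ler_norm_sum _ _ _))//.
  apply: ler_sum => j _; rewrite subr_sqr normrM mulrC ler_pM//.
    rewrite (le_trans (ler_normD _ _))// -addrA -[leLHS]add0r lerD// lerD// mx_entry_le//.
  by have := mx_entry_le (A - B) i j; rewrite !mxE.
rewrite (eq_bigr (fun=> ((1 + `|A| + `|B|) * `|A - B|) *+ q)) => [|i _]; last by rewrite sumr_const card_ord.
by rewrite sumr_const card_ord -mulrnA mulnC -mulrA -natrM mulr_natl.
Qed.

(** The Ito isometry has constant 1; the powers of d come from the comparison with the sup norm in
    [cost_sqn]. *)
Definition itoC : R := d%:R * d%:R ^+ 2 * (d%:R * gmoment R 2).

Lemma itoC_ge0 : 0 <= itoC.
Proof. by rewrite !mulr_ge0 ?sqr_ge0// ltW// gmoment2_gt0. Qed.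

Lemma cost_sqn h (y : vec) (s : mat) : 0 <= h ->
  Jc h (@sqn 1 d) y s <= sqn y + itoC * h * sqn s.
Proof.
move=> h0; have lf := @lq_sqn 1 d.
have [iS E] := cost_sym hW y s h0 lf.
rewrite E.
have [iN eN] := incr_sq hW (lexx 0) h0.
rewrite subr0 in eN.
have F0 := sqr_ge0 (frobenius s).
have ib : intg (fun w => sqn y + d%:R * d%:R ^+ 2 * sqn s * `|incr 0 h w| ^+ 2).
  by apply: intgD; [exact: intg_cst|exact: intgZ].
apply: (@le_trans _ _ (Ex (fun w => sqn y + d%:R * d%:R ^+ 2 * sqn s * `|incr 0 h w| ^+ 2))).
  apply: mean_le => //; first exact: intgZ.
  move=> w; rewrite sqnD -mulrDr mulrA mulVf ?pnatr_eq0// mul1r lerD2l.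
  apply: (le_trans (sqn_le _)); rewrite mul1r sqn_frob.
  rewrite [leRHS](_ : _ = d%:R * (d%:R * frobenius s * `|incr 0 h w|) ^+ 2); last by ring.
  rewrite ler_wpM2l//.
  rewrite ler_sqr ?nnegrE ?mulr_ge0 ?frobenius_ge0//.
  exact: mul_frob_le.
rewrite meanD ?mean_cst ?meanZ//; [|exact: intg_cst|exact: intgZ].
rewrite lerD2l /itoC.
rewrite [leRHS](_ : _ = d%:R * d%:R ^+ 2 * sqn s * (d%:R * gmoment R 2 * h)); last by ring.
by rewrite ler_wpM2l// mulr_ge0 ?sqn_ge0// mulr_ge0 ?sqr_ge0.
Qed.

(** Ito inequality for elementary integrals: by [cost_sqn], each step adds at most a multiple of its
    duration times the mean square of its level. *)
Lemma walk_sqn M (kn : nat -> R) (n : nat) (lev : nat -> Omega -> mat) :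
  kn 0%N = 0 -> (forall k, (k < n)%N -> kn k <= kn k.+1) -> controls W M kn n lev ->
  (forall k, (k < n)%N -> intg (fun w => sqn (lev k w))) /\
  Ex (fun w => sqn (walk W kn lev 0 n w)) <=
  itoC * \sum_(k < n) (kn k.+1 - kn k) * Ex (fun w => sqn (lev k w)).
Proof.
move=> k0 mono hl.
have il k : (k < n)%N -> intg (fun w => sqn (lev k w)).
  move=> kn'; have [mS cS] := hl k kn'.
  apply: (intg_le (Y := cst (M ^+ 2))); last exact: intg_cst.
    apply: (measurable_lq _ (@lq_sqn d d)) => i j.
    by apply: (sub_meas (@past_sub _ _ _ _ _ _ hW (kn k))); exact: mS.
  move=> w; rewrite ger0_norm ?sqn_ge0// sqn_frob ler_sqr ?nnegrE ?frobenius_ge0//.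
  exact: le_trans (frobenius_ge0 _) (cS w).
split => //.
elim: n mono hl il => [|n IH] mono hl il.
  rewrite (_ : (fun w => _) = cst 0) ?mean_cst ?big_ord0 ?mulr0//.
  apply/funext => w; rewrite /walk big_ord0 addr0 /sqn big1// => i _.
  by rewrite big1// => j _; rewrite mxE expr0n.
have mono' k (ltk : (k < n)%N) := mono k (ltnW ltk).
have [mY lY] := walk_meas hW 0 k0 mono' (controlsW hl).
have kn0 := knot_ge0 k0 mono (leqnSn n).
have [mS cS] := hl n (ltnSn n).
have kS := mono n (ltnSn n).
have h0 : 0 <= kn n.+1 - kn n by rewrite subr_ge0.
set h := kn n.+1 - kn n in h0 *.
have iS := il n (ltnSn n).
have ltkn : lq (fun y : vec => - sqn y) by apply: lqN; exact: lq_sqn.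
have M0 (w : Omega) : 0 <= M by exact: le_trans (frobenius_ge0 _) (cS w).
(* [freeze] bounds means from below, whence the opposite signs. *)
pose g (y : vec) (s : mat) := - (sqn y + itoC * h * sqn s).
have c0 : 0 <= itoC * h by rewrite mulr_ge0 ?itoC_ge0.
have gc (y : vec) (s : mat) : g (mxround m y) (mxround m s) @[m --> \oo] --> g y s.
  apply: cvgN; apply: cvgD.
    exact: (lq_cvg (@lq_sqn 1 d) (@cvg_mxround _ _ _ y)).
  by apply: cvgMr; exact: (lq_cvg (@lq_sqn d d) (@cvg_mxround _ _ _ s)).
have gC (y : vec) (s : mat) : frobenius s <= M ->
    `|g y s| <= (d%:R + itoC * h * M ^+ 2) * (1 + `|y| ^+ 2).
  move=> sM; rewrite normrN ger0_norm; last by rewrite addr_ge0 ?sqn_ge0// mulr_ge0 ?sqn_ge0.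
  have h1 := sqn_le y; rewrite mul1r in h1.
  have h2 : itoC * h * sqn s <= itoC * h * M ^+ 2.
    rewrite ler_wpM2l// sqn_frob ler_sqr ?nnegrE ?frobenius_ge0//.
    exact: le_trans (frobenius_ge0 _) sM.
  have h3 : 0 <= itoC * h * M ^+ 2 by rewrite mulr_ge0 ?sqr_ge0.
  apply: (le_trans (lerD h1 h2)).
  rewrite [leRHS](_ : _ = d%:R * `|y| ^+ 2 + itoC * h * M ^+ 2 +
    (d%:R + itoC * h * M ^+ 2 * `|y| ^+ 2)); last by ring.
  by rewrite lerDl addr_ge0// mulr_ge0// sqr_ge0.
have gf (y : vec) (s : mat) : frobenius s <= M ->
    g y s <= Ex (fun w => - sqn (y + incr 0 h w *m s^T)).
  move=> _; rewrite meanN; first by rewrite lerN2; exact: cost_sqn.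
  exact: (intg_cost hW y s h0 (@lq_sqn 1 d)).
have [i1 i2 hE] := @freeze _ _ _ P d (past_events W (kn n)) (@past_sub _ _ _ _ _ _ hW (kn n))
  (incr (kn n) (kn n.+1)) (incr 0 h) (l2_incr hW kn0 kS) (l2_incr hW (lexx 0) h0)
  (incr_indep hW kn0 kS) (fun y => - sqn y) g M _
  (walk W kn lev 0 n) (lev n) mY mS lY cS ltkn gc gC gf.
have j1 : intg (fun w => sqn (walk W kn lev 0 n w + incr (kn n) (kn n.+1) w *m (lev n w)^T)).
  have [_ lY1] := walk_meas hW 0 k0 mono hl.
  rewrite (_ : (fun w => _) = (fun w => sqn (walk W kn lev 0 n.+1 w))).
    exact: (intg_lq lY1 (@lq_sqn 1 d)).
  by apply/funext => w; rewrite walkS.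
have j2 : intg (fun w => sqn (walk W kn lev 0 n w)) by exact: (intg_lq lY (@lq_sqn 1 d)).
have j3 : intg (fun w => itoC * h * sqn (lev n w)) by exact: intgZ.
have j4 : intg (fun w => sqn (walk W kn lev 0 n w) + itoC * h * sqn (lev n w)) by exact: intgD.
move: hE; rewrite /g (meanN j4) (meanN j1) lerN2 (meanD j2 j3) (meanZ _ iS) => hE.
rewrite (_ : (fun w => sqn (walk W kn lev 0 n.+1 w)) =
  (fun w => sqn (walk W kn lev 0 n w + incr (kn n) (kn n.+1) w *m (lev n w)^T))); last first.
  by apply/funext => w; rewrite walkS.
apply: (le_trans hE); rewrite big_ord_recr /= [leRHS]mulrDr lerD//; last by rewrite mulrA.
apply: IH => //; first exact: controlsW hl.
by move=> k ltk; apply: il; exact: ltnW.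
Qed.

End ito_estimates.

Section clipping.
Context (R : realType) (d : nat).
Local Notation mat := 'M[R]_d.
Implicit Types (A : mat).

(* The nearest point of the unit ball: clipping an elementary approximation of an
   admissible control makes it admissible and at most doubles the error. *)
Definition clip A : mat := (Num.max 1 (frobenius A))^-1 *: A.

Lemma max1_gt0 (x : R) : 0 < Num.max 1 x.
Proof. by rewrite lt_max ltr01. Qed.

Lemma clip_le1 A : frobenius (clip A) <= 1.
Proof.
rewrite frobeniusZ gtr0_norm ?invr_gt0 ?max1_gt0// mulrC.
by rewrite ler_pdivrMr ?max1_gt0// mul1r le_max lexx orbT.
Qed.

(** When the norm F of [A] exceeds 1, the left side is (F - 1)^2, the squared distance from [A] to
    the unit ball. The inequality [h] in the proof is the positivity of |A - F s|^2 / F. *)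
Lemma clip_dist A s : frobenius s <= 1 -> sqn (clip A - A) <= sqn (A - s).
Proof.
move=> s1; have [F1|F1] := lerP (frobenius A) 1.
  rewrite /clip (max_idPl F1) invr1 scale1r subrr /sqn big1 ?sqn_ge0// => i _.
  by rewrite big1// => j _; rewrite mxE expr0n.
have F0 : 0 < frobenius A by exact: lt_trans F1.
rewrite /clip (max_idPr (ltW F1)).
set F := frobenius A in F1 F0 *.
have -> : F^-1 *: A - A = (F^-1 - 1) *: A by rewrite scalerBl scale1r.
rewrite sqn_frob frobeniusZ exprMn -/F real_normK ?num_real//.
have -> : (F^-1 - 1) ^+ 2 * F ^+ 2 = (F - 1) ^+ 2 by field; rewrite gt_eqF.
have h : (1 - F^-1) * sqn A + (1 - F) * sqn s <= sqn (A - s).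
  rewrite /sqn !mulr_sumr -big_split; apply: ler_sum => i _ /=.
  rewrite !mulr_sumr -big_split; apply: ler_sum => j _ /=.
  rewrite !mxE -subr_ge0.
  rewrite (_ : _ - _ = F^-1 * (A i j - F * s i j) ^+ 2); last by field; rewrite gt_eqF.
  by rewrite mulr_ge0 ?sqr_ge0// invr_ge0 ltW.
apply: le_trans h; rewrite !sqn_frob -/F.
have -> : (1 - F^-1) * F ^+ 2 = F ^+ 2 - F by field; rewrite gt_eqF.
have s2 : frobenius s ^+ 2 <= 1 by rewrite exprn_ile1// frobenius_ge0.
have : (F - 1) * frobenius s ^+ 2 <= (F - 1) * 1 by rewrite ler_wpM2l// subr_ge0 ltW.
move: (frobenius s ^+ 2) => z; nra.
Qed.

Lemma measurable_frobenius dT (T : measurableType dT) (L : T -> mat) : measmx L ->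
  measurable_fun [set: T] (fun w => frobenius (L w)).
Proof.
move=> mL.
rewrite (_ : (fun w => _) = Num.sqrt \o (fun w => sqn (L w))).
  apply: measurableT_comp; last exact: (measurable_lq mL (@lq_sqn R d d)).
  by apply: continuous_measurable_fun; exact: sqrt_continuous.
by apply/funext => w; rewrite frobeniusE.
Qed.

Lemma measmx_clip dT (T : measurableType dT) (L : T -> mat) : measmx L ->
  measmx (fun w => clip (L w)).
Proof.
move=> mL i j.
rewrite (_ : (fun w => _) = (fun w => (Num.max 1 (frobenius (L w)))^-1 * L w i j)).
  apply: measurable_funM; last exact: mL.
  apply: (measurableT_comp (f := fun x : R => (Num.max 1 x)^-1)); last exact: measurable_frobenius.
  apply: continuous_measurable_fun => x.
  apply: cvgV; first by rewrite gt_eqF// max1_gt0.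
  by apply: (continuous_max (f := cst (1 : R)) (g := id)); [exact: cst_continuous|exact: cvg_id].
by apply/funext => w; rewrite mxE.
Qed.

End clipping.

Section ito_lower_bound.
Context (R : realType) (d : nat) (dO : measure_display)
  (Omega : measurableType dO) (P : probability Omega R)
  (W : R -> Omega -> 'rV[R]_d) (hW : standard_brownian_motion P W).
Local Notation Ex := (mean P).
Local Notation intg := (intg P).
Local Notation vec := 'rV[R]_d.
Local Notation mat := 'M[R]_d.

Definition clipped (S : step_process R d Omega) : step_process R d Omega :=
  StepProcess (steps S) (knot S) (fun k w => clip (level S k w)).

Lemma elementary_clipped t S : elementary W t S -> elementary W t (clipped S).
Proof.
move=> [k0 kt mono mlev [M hM]]; split => //=.
  move=> k i j kn; apply: measmx_clip => i' j'; exact: mlev.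
by exists 1 => k w _; exact: clip_le1.
Qed.

Lemma controls_elementary t S : elementary W t S -> exists M, controls W M (knot S) (steps S) (level S).
Proof.
move=> [k0 kt mono mlev [M hM]]; exists M => j jn.
by split => [i k|w]; [exact: mlev|exact: hM].
Qed.

Lemma elementary_l2 t S : elementary W t S -> l2 P (step_integral W S).
Proof.
move=> eS; have [M hM] := controls_elementary eS; case: eS => k0 kt mono _ _.
have [_] := walk_meas hW 0 k0 mono hM.
by congr (l2 P _); apply/funext => w; rewrite /walk add0r.
Qed.

(** The difference is again an elementary integral, so [walk_sqn] bounds it by the time integral of
    the clipping error; [clip_dist] bounds that error pointwise by the distance to sigma. *)
Lemma clipped_dist t S (sigma : R -> Omega -> mat) (a : R) :
  0 <= t -> elementary W t S -> (forall s w, 0 <= s -> frobenius (sigma s w) <= 1) ->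
  (\int[P]_w \int[lebesgue_measure]_(s in `[0%R, t])
    (frobenius (step_value S s w - sigma s w)%R ^+ 2)%:E <= a%:E)%E ->
  Ex (fun w => sqn (step_integral W (clipped S) w - step_integral W S w)) <= itoC R d * a.
Proof.
move=> t0 eS hs ha; have [M hM] := controls_elementary eS.
have [k0 kt mono mlev _] := eS.
pose lev k w := clip (level S k w) - level S k w.
have hlev : controls W (1 + M) (knot S) (steps S) lev.
  move=> k kn; have [mS cS] := hM k kn; split.
    move=> i j; rewrite (_ : (fun w => _) = (fun w => clip (level S k w) i j - level S k w i j)).
      by apply: measurable_funB; [exact: measmx_clip|exact: mS].
    by apply/funext => w; rewrite !mxE.
  move=> w; have M0 : 0 <= M by exact: le_trans (frobenius_ge0 _) (cS w).
  rewrite -ler_sqr ?nnegrE ?frobenius_ge0 ?addr_ge0// -sqn_frob.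
  have z1 : frobenius (0 : mat) <= 1 by rewrite frobenius0.
  apply: (le_trans (clip_dist _ z1)); rewrite subr0 sqn_frob.
  rewrite ler_sqr ?nnegrE ?frobenius_ge0 ?addr_ge0//.
  by apply: (le_trans (cS w)); rewrite lerDr.
have [il hE] := walk_sqn hW k0 mono hlev.
rewrite (_ : (fun w => sqn _) = (fun w => sqn (walk W (knot S) lev 0 (steps S) w))); last first.
  apply/funext => w; congr sqn; rewrite /walk add0r /step_integral /= -sumrB.
  by apply: eq_bigr => k _; rewrite -mulmxBr -linearB.
apply: (le_trans hE); rewrite ler_wpM2l ?itoC_ge0//.
rewrite -lee_fin; apply: le_trans ha.
have ilk (k : 'I_(steps S)) : intg (fun w => sqn (lev k w) * (knot S k.+1 - knot S k)).
  rewrite (_ : (fun w => _) = (fun w => (knot S k.+1 - knot S k) * sqn (lev k w))).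
    by apply: intgZ; exact: il.
  by apply/funext => w; rewrite mulrC.
have iS : intg (fun w => \sum_(k < steps S) sqn (lev k w) * (knot S k.+1 - knot S k)).
  by apply: intg_sum => k; exact: ilk.
have -> : \sum_(k < steps S) (knot S k.+1 - knot S k) * Ex (fun w => sqn (lev k w)) =
    Ex (fun w => \sum_(k < steps S) sqn (lev k w) * (knot S k.+1 - knot S k)).
  rewrite mean_sum => [|k].
    apply: eq_bigr => k _; rewrite -meanZ; last exact: il.
    by congr (mean _); apply/funext => w; rewrite mulrC.
  exact: ilk.
rewrite -EFin_mean//; apply: ge0_le_integral_set => w _.
  rewrite lee_fin; apply: sumr_ge0 => k _; rewrite mulr_ge0 ?sqn_ge0// subr_ge0.
  by apply: mono.
apply: (integral_steps_le (kn := knot S) (c := fun k => sqn (lev k w))) => //.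
- by move=> k _; exact: sqn_ge0.
- by move=> s _; rewrite lee_fin sqr_ge0.
move=> k s kn ks; rewrite lee_fin (step_value_in w mono kn ks) -sqn_frob.
apply: clip_dist; apply: hs; case/andP: ks => ks _.
by apply: le_trans (ltW ks); apply: (knot_ge0 k0 mono); exact: ltnW.
Qed.

(** Young's inequality: the local Lipschitz bound splits into a small multiple of an integrable term
    and a large multiple of D^2, itself small in mean. *)
Lemma cross_le (K a D eta : R) : 0 <= K -> 0 <= a -> 0 <= D -> 0 < eta ->
  K * (1 + 2 * a + D) * D <= K * (eta * (1 + 2 * a ^+ 2) + (eta^-1 + 1) * D ^+ 2).
Proof.
move=> K0 a0 D0 e0; rewrite -mulrA ler_wpM2l//.
have h : 0 <= eta^-1 * (D - eta * ((1 + 2 * a) / 2)) ^+ 2.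
  by rewrite mulr_ge0 ?sqr_ge0// invr_ge0 ltW.
have E : eta^-1 * (D - eta * ((1 + 2 * a) / 2)) ^+ 2 =
  eta^-1 * D ^+ 2 - (1 + 2 * a) * D + eta * ((1 + 2 * a) ^+ 2 / 4) by field; rewrite gt_eqF.
rewrite E in h.
have h2 : eta * ((1 + 2 * a) ^+ 2 / 4) <= eta * (1 + 2 * a ^+ 2).
  by rewrite ler_wpM2l ?(ltW e0)//; have := sqr_ge0 (a - 1); nra.
have -> : (1 + 2 * a + D) * D = (1 + 2 * a) * D + D ^+ 2 by ring.
have -> : (eta^-1 + 1) * D ^+ 2 = eta^-1 * D ^+ 2 + D ^+ 2 by ring.
move: h h2; move: (eta^-1 * D ^+ 2) ((1 + 2 * a) * D) (eta * ((1 + 2 * a) ^+ 2 / 4)) (eta * (1 + 2 * a ^+ 2)).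
move=> u1 u2 u3 u4; lra.
Qed.

(** Clip the elementary approximations of sigma: their integrals satisfy the bound by hypothesis and
    still converge to [X] in L^2, by [clipped_dist]. *)
Lemma ito_lower t x f L sigma X : 0 <= t -> lq f ->
  (forall S, elementary W t S -> (forall k w, frobenius (level S k w) <= 1) ->
     L <= Ex (fun w => f (x + Num.sqrt 2 *: step_integral W S w))) ->
  admissible_control W sigma -> is_ito_integral P W sigma t X ->
  intg (fun w => f (x + Num.sqrt 2 *: X w)) /\
  L <= Ex (fun w => f (x + Num.sqrt 2 *: X w)).
Proof.
move=> t0 lf hL [_ hs] [mX [S [eS cv1 cv2]]].
have mX' : measmx X by move=> i j; rewrite ord1; exact: mX.
have lI n := elementary_l2 (eS n).
have lI' n := elementary_l2 (elementary_clipped (eS n)).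
have measB (Y Z : Omega -> vec) : measmx Y -> measmx Z -> measmx (fun w => Y w - Z w).
  move=> mY mZ i j; rewrite (_ : (fun w => _) = (fun w => Y w i j - Z w i j)).
    by apply: measurable_funB; [exact: mY|exact: mZ].
  by apply/funext => w; rewrite !mxE.
have msq (Y : Omega -> vec) : measmx Y -> measurable_fun [set: Omega] (fun w => sqn (Y w)).
  by move=> mY; exact: (measurable_lq mY (@lq_sqn R 1 d)).
have b_fin n (b : R) : ('E_P[fun w => (enorm (step_integral W (S n) w - X w) ^+ 2)%R] <= b%:E)%E ->
   intg (fun w => sqn (step_integral W (S n) w - X w)) /\
   Ex (fun w => sqn (step_integral W (S n) w - X w)) <= b.
  rewrite unlock; under eq_fun do rewrite -sqn_row.
  move=> hb.
  have i0 : intg (fun w => sqn (step_integral W (S n) w - X w)).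
    apply/integrableP; split.
      by apply/measurable_EFinP; apply: msq; apply: measB => //; case: (lI n).
    under eq_integral do rewrite /= ger0_norm ?sqn_ge0//.
    exact: le_lt_trans hb (ltry _).
  by split => //; rewrite -lee_fin -EFin_mean.
(* A single approximation at finite L^2 distance shows that [X] is square integrable. *)
have /filter_ex[n0 hn0] := cvg0_ereal_le cv2 ltr01.
have [i0 _] := b_fin n0 1 hn0.
have intg_sqn (Y : Omega -> vec) : l2 P Y -> intg (fun w => sqn (Y w)).
  by move=> lY; exact: (intg_lq lY (@lq_sqn R 1 d)).
have lX : l2 P X.
  apply: (l2_of_sq (Z := fun w => 2 * sqn (step_integral W (S n0) w) +
     2 * sqn (step_integral W (S n0) w - X w))) => //.
    by apply: intgD; apply: intgZ => //; exact: intg_sqn.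
  move=> w; apply: (le_trans (le_sqn _)).
  rewrite -{1}[X w](subKr (step_integral W (S n0) w)).
  apply: (le_trans (sqnD_le _ _)); rewrite lerD2l.
  rewrite ler_wpM2l// /sqn; apply: ler_sum => i _; apply: ler_sum => j _.
  by rewrite mxE sqrrN.
have s2 : 0 <= Num.sqrt 2 :> R by exact: sqrtr_ge0.
have affine (Y : Omega -> vec) : l2 P Y -> l2 P (fun w => x + Num.sqrt 2 *: Y w).
  move=> lY; have [mY iY] := lY; apply: (l2_of_sq (Z := fun w => 2 * `|x| ^+ 2 + 2 * 2 * `|Y w| ^+ 2)).
  - move=> i j; rewrite (_ : (fun w => _) = (fun w => x i j + Num.sqrt 2 * Y w i j)).
      by apply: measurable_funD => //; apply: measurable_funM => //; exact: mY.
    by apply/funext => w; rewrite !mxE.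
  - by apply: intgD; [exact: intg_cst|exact: intgZ].
  - move=> w; apply: (@le_trans _ _ ((`|x| + `|Num.sqrt 2 *: Y w|) ^+ 2)).
      by rewrite ler_sqr ?nnegrE ?addr_ge0// ler_normD.
    by rewrite (le_trans (sqrD_le _ _))// lerD2l normrZ exprMn ger0_norm// sqr_sqrtr// mulrA.
have lZ := affine _ lX.
have iZ : intg (fun w => f (x + Num.sqrt 2 *: X w)) by exact: intg_lq.
split => //.
have [K K0 fK] := lf.
pose A := Ex (fun w => 1 + 2 * `|x + Num.sqrt 2 *: X w| ^+ 2).
have A1 : 1 <= A.
  apply: (@le_trans _ _ (Ex (cst 1))); first by rewrite mean_cst.
  apply: mean_le.
  - exact: intg_cst.
  - by apply: intgD; [exact: intg_cst|apply: intgZ; case: lZ].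
  - by move=> w; rewrite lerDl mulr_ge0// sqr_ge0.
have A0 : 0 < A by exact: lt_le_trans A1.
apply/ler_addgt0Pr => e e0.
(* First [eta], then [q], so that each of the two terms of [cross_le] contributes e / 2; K + 1
   replaces K, which may be 0. *)
pose eta := e / (2 * (K + 1) * A).
have eta0 : 0 < eta by rewrite divr_gt0// !mulr_gt0// ltr_wpDl.
pose q := e / (2 * ((K + 1) * (eta^-1 + 1) * 2) * (2 * itoC R d + 2)).
have ci0 : 0 < 2 * itoC R d + 2 by rewrite ltr_wpDl// mulr_ge0// itoC_ge0.
have e10 : 0 < eta^-1 + 1 by rewrite ltr_wpDl// invr_ge0 ltW.
have K1 : 0 < K + 1 by rewrite ltr_wpDl.
have q0 : 0 < q by rewrite divr_gt0 ?mulr_gt0.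
have [n [hn1 hn2]] := filter_ex (filterI (cvg0_ereal_le cv1 q0) (cvg0_ereal_le cv2 q0)).
have hc := clipped_dist t0 (eS n) hs hn1.
have [ib hb] := b_fin n q hn2.
set I' := step_integral W (clipped (S n)) in hc.
have lI'n : l2 P I' := lI' n.
have hL' : L <= Ex (fun w => f (x + Num.sqrt 2 *: I' w)).
  by apply: hL; [exact: elementary_clipped|move=> k w; exact: clip_le1].
apply: (le_trans hL').
have lZ' := affine _ lI'n.
have iZ' : intg (fun w => f (x + Num.sqrt 2 *: I' w)) by exact: intg_lq.
rewrite -lerBlDl -meanB//.
pose D w := sqn (I' w - X w).
have mI' : measmx I' by case: lI'n.
have iC : intg (fun w => sqn (I' w - step_integral W (S n) w)).
  apply: intg_sqn.
  have [m1 i1] := lI'n; have [m2 i2] := lI n.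
  apply: (l2_of_sq (Z := fun w => 2 * `|I' w| ^+ 2 + 2 * `|step_integral W (S n) w| ^+ 2)).
  - exact: measB.
  - by apply: intgD; exact: intgZ.
  - move=> w; apply: le_trans (sqrD_le _ _).
    by rewrite ler_sqr ?nnegrE ?addr_ge0// ler_normB.
have Dle w : D w <= 2 * sqn (I' w - step_integral W (S n) w) + 2 * sqn (step_integral W (S n) w - X w).
  by apply: le_trans (sqnD_le _ _); rewrite addrA subrK.
have iDs : intg (fun w => 2 * sqn (I' w - step_integral W (S n) w) + 2 * sqn (step_integral W (S n) w - X w)).
  by apply: intgD; exact: intgZ.
have iD : intg D.
  apply: (intg_le _ _ iDs); first by apply: msq; exact: measB.
  by move=> w; rewrite ger0_norm ?sqn_ge0.
have ED : Ex D <= (2 * itoC R d + 2) * q.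
  apply: (le_trans (mean_le iD iDs Dle)).
  rewrite meanD; [|exact: intgZ|exact: intgZ].
  rewrite !meanZ// [leRHS](_ : _ = 2 * (itoC R d * q) + 2 * q); last by ring.
  by rewrite lerD// ler_wpM2l.
have iZ2 : intg (fun w => 1 + 2 * `|x + Num.sqrt 2 *: X w| ^+ 2).
  by apply: intgD; [exact: intg_cst|apply: intgZ; case: lZ].
have iB : intg (fun w => K * (eta * (1 + 2 * `|x + Num.sqrt 2 *: X w| ^+ 2) + (eta^-1 + 1) * (2 * D w))).
  by apply/intgZ/intgD; apply: intgZ => //; exact: intgZ.
apply: (@le_trans _ _ (Ex (fun w => K * (eta * (1 + 2 * `|x + Num.sqrt 2 *: X w| ^+ 2) + (eta^-1 + 1) * (2 * D w))))).
  apply: mean_le => //; first exact: intgB.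
  move=> w; apply: (le_trans (ler_norm _)); apply: (le_trans (fK _ _)).
  set z' := x + _ *: I' w; set z := x + _ *: X w.
  have zz : `|z' - z| ^+ 2 <= 2 * D w.
    rewrite /z' /z opprD addrACA subrr add0r -scalerBr normrZ exprMn ger0_norm//.
    by rewrite sqr_sqrtr// ler_wpM2l// le_sqn.
  have hz : 1 + `|z'| + `|z| <= 1 + 2 * `|z| + `|z' - z|.
    have := ler_normD (z' - z) z; rewrite subrK; lra.
  apply: (@le_trans _ _ (K * (1 + 2 * `|z| + `|z' - z|) * `|z' - z|)).
    by rewrite ler_wpM2r// ler_wpM2l.
  apply: (le_trans (cross_le K0 (normr_ge0 z) (normr_ge0 _) eta0)).
  by rewrite ler_wpM2l// lerD2l ler_wpM2l// ltW.
rewrite meanZ; last by apply/intgD; apply: intgZ => //; exact: intgZ.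
rewrite meanD; [|exact: intgZ|by apply: intgZ; exact: intgZ].
rewrite meanZ// meanZ; last exact: intgZ.
rewrite meanZ// -/A.
have e1 : 0 <= eta^-1 + 1 by rewrite addr_ge0// invr_ge0 ltW.
apply: (@le_trans _ _ ((K + 1) * (eta * A + (eta^-1 + 1) * (2 * ((2 * itoC R d + 2) * q))))).
  apply: ler_pM => //.
  - rewrite addr_ge0// mulr_ge0 ?(ltW eta0) ?(ltW A0)// mulr_ge0// ; exact: mean_ge0 (fun w => sqn_ge0 _).
  - by rewrite lerDl.
  - by rewrite lerD2l ler_wpM2l// ler_wpM2l.
rewrite mulrDr [X in _ + X](_ : _ = e / 2); last first.
  rewrite /q; move: (2 * itoC R d + 2) (eta^-1 + 1) (K + 1) ci0 e10 K1 => c v k c0 v0 kk0.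
  by field; rewrite !gt_eqF.
rewrite [X in X + _](_ : _ = e / 2); last first.
  by rewrite /eta; move: (K + 1) K1 => k kk0; field; rewrite !gt_eqF.
by rewrite -splitr.
Qed.

End ito_lower_bound.

(** * The value function *)

Section value.
Context (R : realType) (d : nat) (dO : measure_display)
  (Omega : measurableType dO) (P : probability Omega R)
  (W : R -> Omega -> 'rV[R]_d) (hW : standard_brownian_motion P W).
Local Notation Ex := (mean P).
Local Notation intg := (intg P).
Local Notation incr := (increment W).
Local Notation vec := 'rV[R]_d.
Local Notation opT := (opT P W).

Variables (u0 : vec -> R) (c0 b0 : R).
Hypotheses (lu0 : lq u0) (c0_ge0 : 0 <= c0)
  (hc0 : forall h x, 0 <= h -> u0 x - c0 * h <= opT h u0 x)
  (hb0 : forall x, b0 <= u0 x).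

Definition dyadic (t : R) (m : nat) (x : vec) : R :=
  iter (2 ^ m) (opT (t / (2 ^ m)%:R)) u0 x.

(** The infimum is a limit: halving the step only lowers the value, by [dyadicS]. *)
Definition limval (t : R) (x : vec) : R := inf [set dyadic t m x | m in [set: nat]].

Let pow2_gt0 m : 0 < (2 ^ m)%:R :> R.
Proof. by rewrite ltr0n expn_gt0. Qed.

Let step_ge0 t m : 0 <= t -> 0 <= t / (2 ^ m)%:R :> R.
Proof. by move=> t0; rewrite divr_ge0. Qed.

Lemma lq_dyadic t m : 0 <= t -> lq (dyadic t m).
Proof. by move=> t0; apply: lq_iter => //; exact: step_ge0. Qed.

Lemma dyadicS t m x : 0 <= t -> dyadic t m.+1 x <= dyadic t m x.
Proof.
move=> t0; rewrite /dyadic expnSr.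
have -> : t / (2 ^ m)%:R = 2 * (t / (2 ^ m * 2)%:R).
  by rewrite natrM; field; rewrite gt_eqF.
by apply: iter_double => //; rewrite divr_ge0.
Qed.

Lemma dyadic_nincr t m m' x : 0 <= t -> (m <= m')%N -> dyadic t m' x <= dyadic t m x.
Proof.
move=> t0 mm; rewrite -(subnK mm); elim: (m' - m)%N => // k IH.
exact: le_trans (dyadicS _ _ t0) IH.
Qed.

Lemma dyadic_ge t m x v : 0 <= t -> (forall y, v y <= u0 y) ->
  (forall y b, v y <= (v (y + b) + v (y - b)) / 2) -> v x <= dyadic t m x.
Proof. by move=> t0 vu vc; apply: iter_lower => //; exact: step_ge0. Qed.

Lemma dyadic_ge_cst t m x : 0 <= t -> b0 <= dyadic t m x.
Proof.
move=> t0; apply: (@dyadic_ge t m x (fun=> b0) t0) => // _ _.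
lra.
Qed.

Lemma has_inf_dyadic t x : 0 <= t -> has_inf [set dyadic t m x | m in [set: nat]].
Proof.
move=> t0; split; first by exists (dyadic t 0 x), 0%N.
by exists b0 => _ [m _ <-]; exact: dyadic_ge_cst.
Qed.

Lemma limval_le t m x : 0 <= t -> limval t x <= dyadic t m x.
Proof. by move=> t0; apply: ge_inf; [have [] := has_inf_dyadic x t0|exists m]. Qed.

Lemma limval_glb t x c : 0 <= t -> (forall m, c <= dyadic t m x) -> c <= limval t x.
Proof.
move=> t0 h; apply: lb_le_inf; first by have [] := has_inf_dyadic x t0.
by move=> _ [m _ <-].
Qed.

Lemma limval_near t x e : 0 <= t -> 0 < e ->
  exists M, forall m, (M <= m)%N -> dyadic t m x <= limval t x + e.
Proof.
move=> t0 e0; have [_ [M _ <-] hM] := inf_adherent e0 (has_inf_dyadic x t0).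
exists M => m Mm; apply: le_trans (ltW hM); exact: dyadic_nincr.
Qed.

Lemma cvg_dyadic t x : 0 <= t -> dyadic t m x @[m --> \oo] --> limval t x.
Proof.
move=> t0; apply/cvgrPdist_le => e e0; have [M hM] := limval_near x t0 e0.
near=> m; rewrite distrC ger0_norm ?subr_ge0 ?limval_le// lerBlDl.
by apply: hM; near: m; exact: nbhs_infty_ge.
Unshelve. all: by end_near. Qed.

Lemma iter_time_lip h n x : 0 <= h -> u0 x - n%:R * (c0 * h) <= iter n (opT h) u0 x.
Proof. by move=> h0; apply: iter_sub => // y; exact: hc0. Qed.

Lemma iter_time_lipD h n k x : 0 <= h ->
  iter n (opT h) u0 x - k%:R * (c0 * h) <= iter (n + k) (opT h) u0 x.
Proof.
move=> h0; rewrite iterD.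
have := @iter_mono _ _ _ _ _ _ hW h h0 n (fun y => u0 y - k%:R * (c0 * h))
  (iter k (opT h) u0) x.
rewrite (iter_addc hW)//; apply.
- by apply: lqD => //; exact: lq_cst.
- exact: lq_iter.
- by move=> y; exact: iter_time_lip.
Qed.

(** Rounding up to multiples of [dl] overshoots the total time by at most one [dl] per step, and
    each extra step lowers the value by at most c0 dl. *)
Lemma foldr_ge (hs : seq R) (dl : R) (M : nat) x : 0 < dl -> all (fun h => 0 <= h) hs ->
  \sum_(h <- hs) h = M%:R * dl ->
  iter M (opT dl) u0 x - (size hs)%:R * (c0 * dl) <= foldr opT u0 hs x.
Proof.
move=> dl0 hs0 hM.
have [N [hN HN]] := foldr_lower hW dl0 hs0 lu0.
apply: le_trans (HN x).
have NM : (N <= M + size hs)%N.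
  by move: hN; rewrite hM -mulrDl ler_pM2r// -natrD ler_nat.
apply: (le_trans (iter_time_lipD M (size hs) x (ltW dl0))).
by apply: iter_ndec => //; exact: ltW.
Qed.

Lemma iter_opT0 n x : iter n (opT 0) u0 x = u0 x.
Proof.
elim: n => //= n IH; rewrite opT0 ?IH//; exact: lq_iter.
Qed.

Lemma dyadic_foldr (t : R) (hs : seq R) x : 0 <= t -> all (fun h => 0 <= h) hs ->
  \sum_(h <- hs) h = t -> limval t x <= foldr opT u0 hs x.
Proof.
move=> t0 hs0 hst; apply/ler_addgt0Pr => e e0.
set n := size hs.
(* Using t + 1 instead of t lets the same [k] serve the case t = 0, where a positive [dl] is still
   required. *)
have [k hk] : exists k : nat, n%:R * c0 * (t + 1) / e <= (2 ^ k)%:R.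
  exists (Num.truncn (n%:R * c0 * (t + 1) / e)).+1.
  apply: ltW; apply: (lt_le_trans (truncnS_gt _)).
  by rewrite ler_nat ltnW// ltn_expl.
have hk' : n%:R * (c0 * ((t + 1) / (2 ^ k)%:R)) <= e.
  by rewrite !mulrA ler_pdivrMr ?pow2_gt0// [leRHS]mulrC -ler_pdivrMr.
move: (t0); rewrite le_eqVlt => /predU1P[t00|t00].
  have dl0 : 0 < (t + 1) / (2 ^ k)%:R by rewrite divr_gt0// ltr_wpDl.
  have := @foldr_ge hs _ 0 x dl0 hs0; rewrite hst mul0r => /(_ (esym t00)) /= h1.
  rewrite (le_trans (limval_le 0 x t0))// /dyadic -t00 mul0r iter_opT0.
  by rewrite -lerBlDr (le_trans _ h1)// lerD2l lerN2.
have dl0 : 0 < t / (2 ^ k)%:R by rewrite divr_gt0.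
have := @foldr_ge hs _ (2 ^ k)%N x dl0 hs0.
rewrite hst mulrC divfK ?gt_eqF// => /(_ erefl) h1.
apply: (le_trans (limval_le k x t0)).
rewrite -lerBlDr (le_trans _ h1)// lerD2l lerN2; apply: le_trans hk'.
rewrite ler_wpM2l// ler_wpM2l// ler_wpM2r ?invr_ge0//.
by rewrite lerDl.
Qed.

Lemma elementary_lower t x S : 0 <= t -> elementary W t S ->
  (forall k w, frobenius (level S k w) <= 1) ->
  limval t x <= Ex (fun w => u0 (x + Num.sqrt 2 *: step_integral W S w)).
Proof.
move=> t0 eS lev1; have [M hM] := controls_elementary eS.
have [k0 kt mono _ _] := eS.
pose lev k w := Num.sqrt 2 *: level S k w.
have hl : controls W (Num.sqrt 2) (knot S) (steps S) lev.
  move=> k kn; have [mS cS] := hM k kn; split.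
    move=> i j; rewrite (_ : (fun w => _) = (fun w => Num.sqrt 2 * level S k w i j)).
      by apply: measurable_funM => //; exact: mS.
    by apply/funext => w; rewrite mxE.
  move=> w; rewrite frobeniusZ ger0_norm ?sqrtr_ge0//.
  by rewrite ler_piMr ?sqrtr_ge0.
rewrite (_ : (fun w => u0 _) = (fun w => u0 (walk W (knot S) lev x (steps S) w))); last first.
  apply/funext => w; congr (u0 (_ + _)); rewrite /step_integral scaler_sumr.
  by apply: eq_bigr => k _; rewrite /lev linearZ/= -scalemxAr.
apply: le_trans (walk_lower hW x k0 mono hl lu0).
apply: dyadic_foldr => //.
  apply/allP => _ /mapP[k + ->]; rewrite mem_iota => /andP[_ kn].
  by rewrite subr_ge0; apply: mono.
rewrite /mkseq big_map -{1}[steps S]subn0 (telescope_sumr (fun k => knot S k))//.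
by rewrite kt k0 subr0.
Qed.

Lemma cost_lower t x sigma X : 0 <= t -> admissible_control W sigma ->
  is_ito_integral P W sigma t X ->
  intg (fun w => u0 (x + Num.sqrt 2 *: X w)) /\
  limval t x <= Ex (fun w => u0 (x + Num.sqrt 2 *: X w)).
Proof.
move=> t0 adm ito; apply: (ito_lower hW t0 lu0 _ adm ito) => S eS lev1.
exact: elementary_lower.
Qed.

(** Here [N] is any positive number of steps: the iterate is nearly reached by an admissible
    control, whose cost is at least [limval] by [cost_lower]. *)
Lemma limval_le_iter t x N : 0 <= t -> (0 < N)%N -> limval t x <= iter N (opT (t / N%:R)) u0 x.
Proof.
move=> t0 N0; apply/ler_addgt0Pr => e e0.
have [sigma [X [adm ito _ hE]]] := value_upper hW x t0 N0 e0 lu0.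
have [_ h] := cost_lower x t0 adm ito.
exact: le_trans h hE.
Qed.

Lemma value_functionE t x : 0 <= t -> value_function P W u0 t x = limval t x.
Proof.
move=> t0; rewrite /value_function.
suff -> : ereal_inf [set y : \bar R | exists sigma X,
    [/\ admissible_control W sigma, is_ito_integral P W sigma t X &
        y = ('E_P[fun w => u0 (x + Num.sqrt 2 *: X w)%R])%E]] = (limval t x)%:E by [].
apply/eqP; rewrite eq_le; apply/andP; split.
  apply/lee_addgt0Pr => e e0.
  have e2 : 0 < e / 2 by rewrite divr_gt0.
  have [m hm] := limval_near x t0 e2.
  have [sigma [X [adm ito iX hE]]] := value_upper hW x t0 (expn_gt0 2 m) e2 lu0.
  apply: (@le_trans _ _ ('E_P[fun w => u0 (x + Num.sqrt 2 *: X w)%R])%E).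
    by apply: ereal_inf_lbound; exists sigma, X.
  rewrite expectation_mean// -EFinD lee_fin (le_trans hE)//.
  rewrite -/(dyadic t m x) [X in _ <= _ + X]splitr addrA lerD2r.
  exact: hm.
apply: le_ereal_inf_tmp => _ [sigma [X [adm ito ->]]].
have [iX h] := cost_lower x t0 adm ito.
by rewrite expectation_mean// lee_fin.
Qed.

Lemma limval_le_u0 t x : 0 <= t -> limval t x <= u0 x.
Proof.
by move=> t0; apply: (le_trans (limval_le 0 x t0)); apply: iter_le => //; exact: step_ge0.
Qed.

Lemma limval_ge t x v : 0 <= t -> (forall y, v y <= u0 y) ->
  (forall y b, v y <= (v (y + b) + v (y - b)) / 2) -> v x <= limval t x.
Proof. by move=> t0 vu vc; apply: limval_glb => // m; exact: dyadic_ge. Qed.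

Lemma limval_semiconcave t L : 0 <= t -> semiconcave L u0 -> semiconcave L (limval t).
Proof.
move=> t0 sc x y s s01; apply: limval_glb => // m.
have H := @iter_semiconcave _ _ _ _ _ _ hW _ (step_ge0 m t0) (2 ^ m) _ _ lu0 sc.
have := H x y s s01.
apply: le_trans; have /andP[s0 s1] := s01.
by rewrite lerD2r lerD// ler_wpM2l ?subr_ge0// limval_le.
Qed.

(** Being a dyadic fraction of t, [h] is a whole number of steps of every finer grid. On such a grid
    the additional time h costs at most c0 h, and the grid is then refined. *)
Lemma limval_time_lip t j x s : 0 <= t -> ctl s ->
  let h := t / (2 ^ j)%:R in
  intg (fun w => limval t (x + incr 0 h w *m s^T)) /\
  limval t x - c0 * h <= Ex (fun w => limval t (x + incr 0 h w *m s^T)).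
Proof.
move=> t0 cs h; have h0 : 0 <= h by exact: step_ge0.
have [iU cU] : intg (fun w => limval t (x + incr 0 h w *m s^T)) /\
   Ex (fun w => dyadic t m (x + incr 0 h w *m s^T)) @[m --> \oo] -->
   Ex (fun w => limval t (x + incr 0 h w *m s^T)).
  apply: (mean_dct (Z := fun w => `|u0 (x + incr 0 h w *m s^T)| + `|b0|)).
  - by move=> m; apply: (intg_meas (P := P)); apply: intg_cost => //; exact: lq_dyadic.
  - by move=> w; exact: cvg_dyadic.
  - by apply: intgD; [apply: intg_norm; exact: intg_cost|exact: intg_cst].
  - move=> m w; set y := x + _.
    have h1 := dyadic_ge_cst m y t0.
    have h2 : dyadic t m y <= u0 y by apply: iter_le => //; exact: step_ge0.
    move: h1 h2; move: (dyadic t m y) (u0 y) => p q h1 h2.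
    rewrite ler_norml; apply/andP; split.
      have hb : - `|b0| <= b0 by rewrite lerNl -normrN ler_norm.
      have := normr_ge0 q; move: h1 hb; move: `|q| `|b0| => a c; lra.
    by rewrite (le_trans h2)// (le_trans (ler_norm _))// lerDl.
split => //.
apply: (ler_cvg_to (cvg_cst (limval t x - c0 * h)) cU).
near=> m.
have jm : (j <= m)%N by near: m; exact: nbhs_infty_ge.
pose dl := t / (2 ^ m)%:R.
have dl0 : 0 <= dl by exact: step_ge0.
have hE : h = (2 ^ (m - j))%:R * dl.
  rewrite /h /dl -{2}(subnK jm) expnD natrM; field.
  by rewrite !gt_eqF.
apply: (@le_trans _ _ (dyadic t m x - c0 * h)); first by rewrite lerD2r limval_le.
apply: (@le_trans _ _ (iter (2 ^ m + 2 ^ (m - j)) (opT dl) u0 x)).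
  rewrite hE mulrCA; exact: iter_time_lipD.
(* The additional steps are the first ones in time, with terminal cost [dyadic t m]; they are then
   replaced by one frozen control. *)
rewrite addnC iterD -/(dyadic t m).
have ld := lq_dyadic m t0.
apply: (le_trans (iter_refine hW dl0 (2 ^ (m - j)) x ld)).
rewrite -hE; exact: opT_le_cost.
Unshelve. all: by end_near. Qed.

End value.

(** * The convex envelope *)

Section envelope.
Context (R : realType) (d : nat).
Local Notation vec := 'rV[R]_d.
Variables (f : vec -> R) (b0 : R).
Hypothesis hb0 : forall x, b0 <= f x.
Local Notation v := (convex_envelope f).

Lemma convex_functionP (h : vec -> R) :
  (forall x y s, 0 <= s <= 1 ->
    h ((1 - s) *: x + s *: y) <= (1 - s) * h x + s * h y) <->
  convex_function [set: vec] h.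
Proof.
split=> [H t x y _ _|H x y s s01].
  have /andP[t0 t1] : 0 <= t%:num <= 1 by rewrite ge0 le1.
  have := H y x t%:num; rewrite t0 t1 => /(_ isT).
  by rewrite addrC [X in _ <= X -> _]addrC.
have /andP[s0 s1] := s01.
pose t : {i01 R} := Itv01 s0 s1.
have := H t y x (mem_setT _) (mem_setT _).
suff [-> ->] : (1 - s) *: x + s *: y = conv t (y : convex_lmodType vec) x :> vec /\
  (1 - s) * h x + s * h y = conv t (h y : convex_lmodType R^o) (h x) by [].
by split; rewrite addrC.
Qed.

Lemma envelope_has_sup x : has_sup [set y | exists h : vec -> R,
    [/\ convex_function [set: vec] h, (forall z, h z <= f z) & y = h x]].
Proof.
split; last by exists (f x) => _ [h [_ hf ->]].
exists b0, (fun=> b0); split => //.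
by apply/convex_functionP => _ _ s _; rewrite -mulrDl subrK mul1r.
Qed.

Lemma envelope_le x : v x <= f x.
Proof.
apply: ge_sup; first by have [] := envelope_has_sup x.
by move=> _ [h [_ hf ->]].
Qed.

Lemma le_envelope (h : vec -> R) x : convex_function [set: vec] h ->
  (forall z, h z <= f z) -> h x <= v x.
Proof. by move=> hc hf; apply: ub_le_sup; [have [] := envelope_has_sup x|exists h]. Qed.

Lemma envelope_ge x : b0 <= v x.
Proof.
apply: (@le_envelope (fun=> b0)) => //.
by apply/convex_functionP => _ _ s _; rewrite -mulrDl subrK mul1r.
Qed.

Lemma envelope_convex x y s : 0 <= s <= 1 ->
  v ((1 - s) *: x + s *: y) <= (1 - s) * v x + s * v y.
Proof.
move=> s01; have /andP[s0 s1] := s01.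
apply: ge_sup; first by have [] := envelope_has_sup ((1 - s) *: x + s *: y).
move=> _ [h [hc hf ->]].
have /convex_functionP /(_ x y s s01) hx := hc.
apply: (le_trans hx); rewrite lerD// ler_wpM2l ?subr_ge0//; exact: le_envelope.
Qed.

Lemma envelope_midpoint y b : v y <= (v (y + b) + v (y - b)) / 2.
Proof.
have h : 0 <= (2^-1 : R) <= 1 by apply/andP; split; lra.
have := envelope_convex (y + b) (y - b) h.
have -> : 1 - 2^-1 = 2^-1 :> R by field.
have E2 : 2^-1 + 2^-1 = 1 :> R by field.
rewrite -scalerDr addrACA subrr addr0 scalerDr -scalerDl E2 scale1r.
by rewrite -mulrDr mulrC.
Qed.

(* (x, y) lies above the convex hull of m points of the graph of f. *)
Definition combo (m : nat) (x : vec) (y : R) := exists (q : 'I_m -> R) (p : 'I_m -> vec),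
  [/\ forall i, 0 <= q i, \sum_i q i = 1, \sum_i q i *: p i = x & \sum_i q i * f (p i) <= y].

Lemma combo_grow m x y : combo m x y -> combo m.+1 x y.
Proof.
move=> [q [p [q0 q1 qx qy]]].
exists (fun i => oapp q 0 (unlift ord_max i)), (fun i => oapp p 0 (unlift ord_max i)).
split.
- by move=> i; case: unliftP => [j|] _ /=.
- rewrite (bigD1_ord ord_max)//= unlift_none /= add0r -[RHS]q1.
  by apply: eq_bigr => i _; rewrite liftK.
- rewrite (bigD1_ord ord_max)//= unlift_none /= scale0r add0r -[RHS]qx.
  by apply: eq_bigr => i _; rewrite liftK.
- rewrite (bigD1_ord ord_max)//= unlift_none /= mul0r add0r.
  by apply: le_trans qy; apply: ler_sum => i _; rewrite liftK.
Qed.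

(** A nonzero vector in the left kernel of the matrix with rows (p i, 1), whose rank is at most d +
    1. *)
Lemma affine_dependence m (p : 'I_m -> vec) : (d.+1 < m)%N ->
  exists c : 'I_m -> R, [/\ exists i, c i != 0, \sum_i c i = 0 & \sum_i c i *: p i = 0].
Proof.
move=> dm.
pose A : 'M[R]_(m, d + 1) := row_mx (\matrix_i p i) (const_mx 1).
have kA : kermx A != 0.
  rewrite -mxrank_eq0 mxrank_ker subn_eq0 -ltnNge.
  by apply: (leq_ltn_trans (rank_leq_col A)); rewrite addn1.
have [i [j cij]] : exists i j, kermx A i j != 0.
  apply/not_existsP => h; move/eqP : kA; apply; apply/matrixP => i j; rewrite [RHS]mxE.
  by apply/eqP; rewrite -[_ == _]negbK; apply/negP => hij; apply: (h i); exists j.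
pose c := row i (kermx A).
have cA : c *m A = 0 by rewrite -row_mul mulmx_ker row0.
move: cA; rewrite mul_mx_row => /eqP; rewrite row_mx_eq0 => /andP[/eqP c1 /eqP c2].
exists (fun k => c 0 k); split.
- by exists j; rewrite [c _ _]mxE.
- have := congr1 (fun B : 'M[R]_1 => B 0 0) c2; rewrite [LHS]mxE [RHS]mxE => c20; rewrite -[RHS]c20.
  by apply: eq_bigr => k _; rewrite [const_mx _ _ _]mxE mulr1.
- rewrite -[RHS]c1 mulmx_sum_row; apply: eq_bigr => k _.
  by rewrite rowK.
Qed.

(** Move the weights along an affine dependence, signed so that the height does not increase, until
    the first weight vanishes. *)
Lemma combo_shrink m x y : (d.+1 <= m)%N -> combo m.+1 x y -> combo m x y.
Proof.
move=> dm [q [p [q0 q1 qx qy]]].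
have [c [ci cs cx cf]] : exists c : 'I_m.+1 -> R, [/\ exists i, c i != 0, \sum_i c i = 0,
    \sum_i c i *: p i = 0 & \sum_i c i * f (p i) <= 0].
  have [c [[i ci] cs cx]] := affine_dependence p (dm : (d.+1 < m.+1)%N).
  have [h|h] := lerP (\sum_i c i * f (p i)) 0.
    by exists c; split => //; exists i.
  exists (fun i => - c i); split.
  - by exists i; rewrite oppr_eq0.
  - by rewrite sumrN cs oppr0.
  - by under eq_bigr do rewrite scaleNr; rewrite sumrN cx oppr0.
  - by under eq_bigr do rewrite mulNr; rewrite sumrN oppr_le0 ltW.
have [i1 i1c] : exists i, c i < 0.
  apply/not_existsP => h; case: ci => i /eqP; apply.
  have c0 k : 0 <= c k by rewrite leNgt; apply/negP; exact: h.
  by move/eqP : cs; rewrite psumr_eq0// => /allP /(_ i (mem_index_enum _)) /eqP.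
pose i0 := [arg min_(i < i1 | c i < 0) (q i / - c i)]%O.
have [i0c i0min] : c i0 < 0 /\ forall i, c i < 0 -> q i0 / - c i0 <= q i / - c i.
  by rewrite /i0; case: arg_minP.
pose s := q i0 / - c i0.
have s0 : 0 <= s by rewrite divr_ge0// oppr_ge0 ltW.
pose q' i := q i + s * c i.
have q'0 i : 0 <= q' i.
  rewrite /q'; have [h|h] := ltP (c i) 0; last by rewrite addr_ge0// mulr_ge0.
  have := i0min i h; rewrite -/s ler_pdivlMr ?oppr_gt0// mulrN; lra.
have q'i0 : q' i0 = 0.
  by rewrite /q' /s; field; rewrite lt_eqF.
exists (fun i => q' (lift i0 i)), (fun i => p (lift i0 i)); split => //.
- have : \sum_i q' i = 1 by rewrite big_split /= -mulr_sumr cs mulr0 addr0.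
  by rewrite (bigD1_ord i0)//= q'i0 add0r.
- have : \sum_i q' i *: p i = x.
    under eq_bigr do rewrite scalerDl -scalerA.
    by rewrite big_split /= -scaler_sumr cx scaler0 addr0.
  by rewrite (bigD1_ord i0)//= q'i0 scale0r add0r.
- have : \sum_i q' i * f (p i) <= y.
    under eq_bigr do rewrite mulrDl -mulrA.
    rewrite big_split /= -mulr_sumr; apply: le_trans qy.
    by rewrite gerDl mulr_ge0_le0.
  by rewrite (bigD1_ord i0)//= q'i0 mul0r add0r.
Qed.

Lemma caratheodory m x y : combo m x y -> combo d.+1 x y.
Proof.
have [md|dm] := leqP m d.+1.
  by rewrite -(subnKC md); elim: (d.+1 - m)%N => [|k IH] h; rewrite ?addn0// in h *;
    rewrite addnS; apply: combo_grow; exact: IH.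
rewrite -(subnKC (ltnW dm)); elim: (m - d.+1)%N => [|k IH]; first by rewrite addn0.
by rewrite addnS => h; apply: IH; apply: combo_shrink => //; rewrite leq_addr.
Qed.

Lemma combo_conv m x y x' y' s : 0 <= s <= 1 -> combo m x y -> combo m x' y' ->
  combo (m + m) ((1 - s) *: x + s *: x') ((1 - s) * y + s * y').
Proof.
move=> /andP[s0 s1] [q [p [q0 q1 qx qy]]] [q' [p' [q'0 q'1 q'x q'y]]].
have s1' : 0 <= 1 - s by rewrite subr_ge0.
exists (fun i : 'I_(m + m) => match fintype.split i with inl j => (1 - s) * q j | inr j => s * q' j end),
  (fun i : 'I_(m + m) => match fintype.split i with inl j => p j | inr j => p' j end).
have sl (i : 'I_m) : fintype.split (lshift m i) = inl i by exact: (unsplitK (inl i)).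
have sr (i : 'I_m) : fintype.split (rshift m i) = inr i by exact: (unsplitK (inr i)).
split.
- by move=> i; case: (fintype.split i) => j; rewrite mulr_ge0.
- rewrite big_split_ord /=; under eq_bigr do rewrite sl.
  by under [X in _ + X]eq_bigr do rewrite sr; rewrite -!mulr_sumr q1 q'1 !mulr1 subrK.
- rewrite big_split_ord /= -qx -q'x !scaler_sumr; congr (_ + _).
    by apply: eq_bigr => i _; rewrite sl scalerA.
  by apply: eq_bigr => i _; rewrite sr scalerA.
- rewrite big_split_ord /=; apply: (@le_trans _ _ ((1 - s) * (\sum_i q i * f (p i)) + s * \sum_i q' i * f (p' i))).
    rewrite !mulr_sumr; apply: lerD; apply: ler_sum => i _; rewrite ?sl ?sr mulrA//.
  by apply: lerD; rewrite ler_wpM2l.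
Qed.

Lemma combo_ge m x y : combo m x y -> b0 <= y.
Proof.
move=> [q [p [q0 q1 _ qy]]]; apply: le_trans qy.
rewrite -[b0]mul1r -q1 mulr_suml; apply: ler_sum => i _.
by rewrite ler_wpM2l.
Qed.

Lemma combo1 x : combo 1 x (f x).
Proof. by exists (fun=> 1), (fun=> x); split => //; rewrite big_ord1 ?scale1r ?mul1r. Qed.

(** The infimum of the attainable heights is convex, because two combinations can be concatenated
    and reduced by [caratheodory]; it lies below [f], hence below the envelope. *)
Lemma envelope_combo x e : 0 < e -> combo d.+1 x (v x + e).
Proof.
move=> e0.
pose Q x := [set y | combo d.+1 x y].
have hQ z : has_inf (Q z).
  split; first by exists (f z); apply: caratheodory (combo1 z).
  by exists b0 => y; exact: combo_ge.
pose h z := inf (Q z).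
have hf z : h z <= f z.
  by apply: ge_inf; [have [] := hQ z|apply: caratheodory (combo1 z)].
have hc : convex_function [set: vec] h.
  apply/convex_functionP => a b s s01; have /andP[s0 s1] := s01.
  apply/ler_addgt0Pr => r r0.
  have [ya Ha la] := inf_adherent r0 (hQ a).
  have [yb Hb lb] := inf_adherent r0 (hQ b).
  have := caratheodory (combo_conv s01 Ha Hb) => H.
  have : h ((1 - s) *: a + s *: b) <= (1 - s) * ya + s * yb.
    by apply: ge_inf; [have [] := hQ ((1 - s) *: a + s *: b)|].
  move/le_trans; apply.
  have E : (1 - s) * h a + s * h b + r = (1 - s) * (h a + r) + s * (h b + r) by ring.
  rewrite E lerD// ler_wpM2l ?subr_ge0//; exact: ltW.
have := le_envelope x hc hf => hv.
have [y Hy ly] := inf_adherent e0 (hQ x).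
have [q [p [q0 q1 qx qy]]] := Hy.
exists q, p; split => //; apply: (le_trans qy).
by rewrite (le_trans (ltW ly))// lerD2r.
Qed.

(* A point p i far from x is replaced by the point of the segment [x, p i] at
   distance 2 R0 + 1 from x, where f coincides with its envelope v; convexity of v
   along the segment shows that, after renormalising the weights, the average of f
   does not increase beyond v x + e. *)
Lemma near_combo (R0 : R) x e : 0 < R0 -> `|x| <= R0 -> 0 < e ->
  (forall y, R0 < `|y| -> f y = v y) ->
  exists (q : 'I_d.+1 -> R) (p : 'I_d.+1 -> vec),
  [/\ forall i, 0 <= q i, \sum_i q i = 1, \sum_i q i *: p i = x,
      forall i, `|p i - x| <= 2 * R0 + 1 & \sum_i q i * f (p i) <= v x + e].
Proof.
move=> R00 xR0 e0 fv.
have [q [p [q0 q1 qx qy]]] := envelope_combo x e0.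
set R1 := 2 * R0 + 1.
have R10 : 0 < R1 by rewrite /R1; lra.
pose s i := if `|p i - x| <= R1 then 1 else R1 / `|p i - x|.
have far i : ~~ (`|p i - x| <= R1) -> 0 < `|p i - x|.
  by rewrite -ltNge; apply: lt_trans.
have s0 i : 0 < s i.
  by rewrite /s; case: ifPn => // h; rewrite divr_gt0// far.
have s1 i : s i <= 1.
  rewrite /s; case: ifPn => // h; rewrite ler_pdivrMr ?far// mul1r ltW//.
  by rewrite ltNge.
pose p' i := x + s i *: (p i - x).
pose Z := \sum_i q i / s i.
have Z1 : 1 <= Z.
  rewrite -q1 /Z; apply: ler_sum => i _.
  by rewrite ler_peMr// invf_ge1.
have Z0 : 0 < Z by exact: lt_le_trans Z1.
have q'sum : \sum_i q i / s i / Z = 1 by rewrite -mulr_suml mulfV// gt_eqF.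
exists (fun i => q i / s i / Z), p'; split => //.
- by move=> i; rewrite !divr_ge0// ltW.
- under eq_bigr do rewrite scalerDr; rewrite big_split /= -scaler_suml q'sum scale1r.
  rewrite -[RHS]addr0; congr (_ + _).
  transitivity (Z^-1 *: \sum_i q i *: (p i - x)).
    rewrite scaler_sumr; apply: eq_bigr => i _; rewrite !scalerA; congr (_ *: _).
    by field; rewrite !gt_eqF.
  under eq_bigr do rewrite scalerBr.
  by rewrite sumrB qx -scaler_suml q1 scale1r subrr scaler0.
- move=> i; rewrite /p' addrAC subrr add0r normrZ gtr0_norm// /s.
  by case: ifPn => [|h]; rewrite ?mul1r// divfK// gt_eqF// far.
have hp i : f (p' i) <= (1 - s i) * v x + s i * f (p i).
  have E : p' i = (1 - s i) *: x + s i *: p i.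
    by rewrite /p' scalerBr scalerBl scale1r addrA addrAC.
  have [h|h] := boolP (`|p i - x| <= R1).
    have si1 : s i = 1 by rewrite /s h.
    by rewrite E si1 subrr scale0r add0r scale1r mul0r add0r mul1r.
  (* [p' i] is at distance 2 R0 + 1 from [x], and the norm of [x] is at most R0, so [p' i] lies
     outside the ball of radius R0. *)
  rewrite fv; last first.
    have : `|p' i - x| = R1.
      rewrite /p' addrAC subrr add0r normrZ gtr0_norm// /s (negbTE h).
      by rewrite divfK// gt_eqF// far.
    have := ler_normB (p' i) x; move: xR0; rewrite /R1.
    move: `|p' i - x| `|x| `|p' i| => a b c; lra.
  rewrite E; apply: (le_trans (envelope_convex _ _ _)); first by rewrite (ltW (s0 i)) s1.
  by rewrite lerD2l ler_wpM2l ?(ltW (s0 i))// envelope_le.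
have main : \sum_i q i / s i * f (p' i) <= Z * v x + e.
  apply: (@le_trans _ _ (\sum_i (q i / s i * v x - q i * v x + q i * f (p i)))).
    apply: ler_sum => i _.
    have := ler_wpM2l (divr_ge0 (q0 i) (ltW (s0 i))) (hp i).
    move/le_trans; apply.
    rewrite le_eqVlt; apply/orP; left; apply/eqP; field.
    by rewrite gt_eqF.
  rewrite big_split sumrB /= -!mulr_suml q1 mul1r -/Z.
  by rewrite -addrA lerD2l addrC lerBlDr addrC.
have -> : \sum_i q i / s i / Z * f (p' i) = Z^-1 * \sum_i q i / s i * f (p' i).
  by rewrite mulr_sumr; apply: eq_bigr => i _; rewrite mulrAC mulrC.
rewrite mulrC ler_pdivrMr// (le_trans main)// mulrDl mulrC lerD2l.
by rewrite ler_peMr// ltW.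
Qed.

End envelope.

(** * Exponential decay *)

Section line_control.
Context (R : realType) (d : nat) (dO : measure_display)
  (Omega : measurableType dO) (P : probability Omega R)
  (W : R -> Omega -> 'rV[R]_d) (hW : standard_brownian_motion P W) (i0 : 'I_d).
Local Notation intg := (intg P).
Local Notation vec := 'rV[R]_d.
Local Notation Jc := (cost P W).

(* Turns the noise into the i0-th Brownian coordinate times the vector z. *)
Definition line_ctl (z : vec) : 'M[R]_d := (delta_mx i0 0 *m z)^T.

Lemma mul_line_ctl (y z : vec) : y *m (line_ctl z)^T = y 0 i0 *: z.
Proof.
rewrite trmxK mulmxA -mul_scalar_mx; congr (_ *m _).
rewrite -colE; apply/matrixP => i j; rewrite !ord1 !mxE eqxx.
by rewrite mulr1n.
Qed.

Lemma ctl_line (z : vec) : d%:R * `|z| ^+ 2 <= 2 -> ctl (line_ctl z).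
Proof.
move=> hz; rewrite /ctl /= frobeniusE ler_wsqrtr// (le_trans _ hz)//.
rewrite (_ : \sum_i _ = \sum_i z 0 i ^+ 2).
  rewrite mulr_natl -[X in _ *+ X]card_ord -sumr_const; apply: ler_sum => i _.
  by rewrite -real_normK ?num_real// ler_sqr ?nnegrE// mx_entry_le.
apply: eq_bigr => i _; rewrite (bigD1 i0)//= big1 => [|j ji].
  rewrite addr0 !mxE (bigD1 0)//= big1 ?addr0 => [|k]; last by rewrite ord1.
  by rewrite mxE !eqxx mul1r.
rewrite !mxE big1 ?expr0n// => k _.
by rewrite mxE (negbTE ji) mul0r.
Qed.

(** A symmetric quartic bound integrates to the second and fourth moments of one coordinate. The
    quartic term is of order h^2, hence negligible over t / h steps. *)
Lemma cost_line_sym (f : vec -> R) h x z (a b c : R) : 0 <= h ->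
  lq f ->
  (forall g : R, f (x + g *: z) + f (x - g *: z) <= 2 * (a - b * g ^+ 2 + c * g ^+ 4)) ->
  Jc h f x (line_ctl z) <= a - b * (h * gmoment R 2) + c * (h ^+ 2 * gmoment R 4).
Proof.
move=> h0 lf hf.
set s := line_ctl z.
have [iS E] := cost_sym hW x s h0 lf.
have [j2 e2] := incr_moment hW i0 (lexx 0) h0 (isT : (0 < 1 <= 3)%N).
have [j4 e4] := incr_moment hW i0 (lexx 0) h0 (isT : (0 < 2 <= 3)%N).
rewrite !subr0 expr1 in e2 e4.
rewrite -e2 -e4 E -!meanZ// -[X in X - _](mean_cst P) -meanB; [|exact: intg_cst|exact: intgZ].
rewrite -meanD; [|by apply: intgB; [exact: intg_cst|exact: intgZ]|exact: intgZ].
apply: mean_le.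
- exact: intgZ.
- by apply: intgD; [apply: intgB; [exact: intg_cst|exact: intgZ]|exact: intgZ].
move=> w; rewrite ler_pdivrMl//.
by rewrite mul_line_ctl; exact: hf.
Qed.

End line_control.

(** Source of the contraction: averaged over opposite tilts, a geometric mean loses a quadratic
    amount in a - b, by concavity of the square root. *)
Lemma sqrt_pair (R : realType) (a b : R) : `|a| <= 1 -> `|b| <= 1 ->
  Num.sqrt ((1 + a) * (1 + b)) + Num.sqrt ((1 - a) * (1 - b)) <= 2 - (a - b) ^+ 2 / 4.
Proof.
rewrite !ler_norml => /andP[a1 a2] /andP[b1 b2].
have p1 : 0 <= (1 + a) * (1 + b) by rewrite mulr_ge0//; lra.
have p2 : 0 <= (1 - a) * (1 - b) by rewrite mulr_ge0//; lra.
have e1 := sqr_sqrtr p1; have e2 := sqr_sqrtr p2.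
have := sqrtr_ge0 ((1 + a) * (1 + b)); have := sqrtr_ge0 ((1 - a) * (1 - b)).
move: e1 e2; move: (Num.sqrt _) (Num.sqrt _) => r s e1 e2 s0 r0.
have h0 : 0 <= 1 - (a ^+ 2 + b ^+ 2) / 2 by nra.
(* Arithmetic-geometric inequality for 1 - a^2 and 1 - b^2. *)
have rs : r * s <= 1 - (a ^+ 2 + b ^+ 2) / 2.
  rewrite -ler_sqr ?nnegrE ?mulr_ge0// exprMn e1 e2.
  have := sqr_ge0 (a ^+ 2 - b ^+ 2).
  rewrite -subr_ge0 [X in _ -> _ <= X](_ : _ = (a ^+ 2 - b ^+ 2) ^+ 2 / 4); last by field.
  by move=> h; rewrite divr_ge0.
have rhs0 : 0 <= 2 - (a - b) ^+ 2 / 4 by nra.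
rewrite -ler_sqr ?nnegrE//; last exact: addr_ge0.
apply: (@le_trans _ _ (4 - (a - b) ^+ 2)).
  rewrite (_ : (s + r) ^+ 2 = r ^+ 2 + s ^+ 2 + 2 * (r * s)); last by ring.
  rewrite e1 e2; move: (r * s) rs => z hz; lra.
rewrite -subr_ge0 [X in _ <= X](_ : _ = ((a - b) ^+ 2 / 4) ^+ 2); last by field.
exact: sqr_ge0.
Qed.

Section weights.
Context (R : realType) (m : nat).
Implicit Types q : 'I_m -> R.

Definition weights q := (forall i, 0 <= q i) /\ \sum_i q i = 1.

(** On [weights] it vanishes exactly at the Dirac masses, so it measures how far a combination is
    from a single point. *)
Definition overlap q : R := \sum_i \sum_(j | j != i) Num.sqrt (q i * q j).

(** Centred under [q], so that the factors 1 + g tilt keep the total weight equal to 1. *)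
Definition tilt (a q : 'I_m -> R) i : R := a i - \sum_j q j * a j.

Lemma weights_le1 q i : weights q -> q i <= 1.
Proof. by move=> [q0 <-]; rewrite (bigD1 i)//= lerDl sumr_ge0. Qed.

Lemma overlap_ge0 q : 0 <= overlap q.
Proof. by apply: sumr_ge0 => i _; apply: sumr_ge0 => j _; exact: sqrtr_ge0. Qed.

Lemma overlap_le q : weights q -> overlap q <= m%:R ^+ 2.
Proof.
move=> wq; have [q0 q1] := wq.
apply: (@le_trans _ _ (\sum_(i < m) \sum_(j < m) 1)).
  apply: ler_sum => i _; rewrite big_mkcond /=; apply: ler_sum => j _.
  case: ifP => // _; rewrite -[leRHS]sqrtr1 ler_wsqrtr//.
  by rewrite mulr_ile1// weights_le1.
by rewrite !sumr_const card_ord -mulrnA -natrX mulnn.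
Qed.

Lemma tilt_sum a q : weights q -> \sum_i q i * tilt a q i = 0.
Proof.
move=> [q0 q1]; under eq_bigr do rewrite mulrBr.
by rewrite sumrB -mulr_suml q1 mul1r subrr.
Qed.

Lemma norm_tilt a q b i : weights q -> (forall i, 0 <= a i <= b) -> `|tilt a q i| <= b.
Proof.
move=> [q0 q1] ab; rewrite /tilt; have /andP[a0 a1] := ab i.
have s0 : 0 <= \sum_j q j * a j.
  by apply: sumr_ge0 => j _; rewrite mulr_ge0//; have /andP[] := ab j.
have s1 : \sum_j q j * a j <= b.
  rewrite -[leRHS]mul1r -q1 mulr_suml; apply: ler_sum => j _.
  by rewrite ler_wpM2l//; have /andP[] := ab j.
rewrite ler_norml; apply/andP; split; lra.
Qed.

Lemma weights_tilt a q g : weights q -> (forall i, `|tilt a q i| <= 1) -> `|g| <= 1 ->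
  weights (fun i => q i * (1 + g * tilt a q i)).
Proof.
move=> wq ta g1; have [q0 q1] := wq; split.
  move=> i; rewrite mulr_ge0//.
  have : `|g * tilt a q i| <= 1 by rewrite normrM mulr_ile1.
  rewrite ler_norml => /andP[]; lra.
under eq_bigr do rewrite mulrDr mulr1 mulrCA.
by rewrite big_split /= q1 -mulr_sumr tilt_sum// mulr0 addr0.
Qed.

(** [sqrt_pair] applies to each pair; the difference of two tilts is a i - a j whatever [q] is,
    which makes the gain uniform over all weights. *)
Lemma overlap_tilt a q g c : weights q -> (forall i, `|tilt a q i| <= 1) -> `|g| <= 1 ->
  0 <= c -> (forall i j, j != i -> c <= `|a i - a j|) ->
  overlap (fun i => q i * (1 + g * tilt a q i)) +
  overlap (fun i => q i * (1 + (- g) * tilt a q i)) <=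
  overlap q * (2 - c ^+ 2 * g ^+ 2 / 4).
Proof.
move=> [q0 q1] ta g1 c0 hc; rewrite /overlap -big_split mulr_suml /=.
apply: ler_sum => i _; rewrite -big_split mulr_suml /=.
apply: ler_sum => j ji.
rewrite mulrACA [X in _ + Num.sqrt X]mulrACA !mulNr !(sqrtrM _ (mulr_ge0 (q0 i) (q0 j))) -mulrDr ler_wpM2l ?sqrtr_ge0//.
have t1 k : `|g * tilt a q k| <= 1 by rewrite normrM mulr_ile1.
apply: (le_trans (sqrt_pair (t1 i) (t1 j))).
rewrite lerD2l lerN2 ler_wpM2r// -mulrBr exprMn mulrC ler_wpM2l ?sqr_ge0//.
rewrite -[leRHS]real_normK ?num_real// ler_sqr ?nnegrE//.
rewrite /tilt opprB addrA subrK; exact: hc.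
Qed.

End weights.

Section decay.
Context (R : realType) (d : nat) (dO : measure_display)
  (Omega : measurableType dO) (P : probability Omega R)
  (W : R -> Omega -> 'rV[R]_d) (hW : standard_brownian_motion P W) (i0 : 'I_d).
Local Notation vec := 'rV[R]_d.
Local Notation opT := (opT P W).
Variables (m : nat) (p : 'I_m -> vec) (x0 : vec) (f : vec -> R) (b0 K D c : R).
Hypotheses (lf : lq f) (hb0 : forall x, b0 <= f x) (K0 : 0 <= K) (c0 : 0 <= c)
  (pD : forall i, `|p i - x0| <= D)
  (hJ : forall q, weights q ->
    f (\sum_i q i *: p i) <= \sum_i q i * f (p i) + K * overlap q)
  (cm1 : c * m%:R <= 1) (cD : d%:R * (c * m%:R * D) ^+ 2 <= 2).

(** Equally spaced: the gap [c] yields the rate, the range c m bounds the tilts. The 8 in [rate] is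
    the 4 of [overlap_tilt] doubled by averaging over the two signs. *)
Let a (i : 'I_m) : R := c * (i : nat)%:R.
Let rate : R := c ^+ 2 * gmoment R 2 / 8.

Let a_bound i : 0 <= a i <= c * m%:R.
Proof. by rewrite /a mulr_ge0//= ler_wpM2l// ler_nat ltnW. Qed.

Let a_gap i j : j != i -> c <= `|a i - a j|.
Proof.
move=> ji; rewrite /a -mulrBr normrM ger0_norm// ler_peMr//.
have [h|h|h] := ltngtP i j; last by rewrite (val_inj h) eqxx in ji.
  by rewrite distrC -natrB ?(ltnW h)// ger0_norm// ler1n subn_gt0.
by rewrite -natrB ?(ltnW h)// ger0_norm// ler1n subn_gt0.
Qed.

Let slope q : vec := \sum_i (q i * tilt a q i) *: p i.

Let norm_slope q : weights q -> `|slope q| <= c * m%:R * D.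
Proof.
move=> wq; have [q0 q1] := wq.
have -> : slope q = \sum_i (q i * tilt a q i) *: (p i - x0).
  under [RHS]eq_bigr do rewrite scalerBr.
  by rewrite sumrB -scaler_suml tilt_sum// scale0r subr0.
apply: (le_trans (ler_norm_sum _ _ _)).
rewrite -[leRHS]mul1r -[X in _ <= X * _]q1 mulr_suml; apply: ler_sum => i _.
rewrite normrZ normrM (ger0_norm (q0 i)) -[leLHS]mulrA ler_wpM2l// ler_pM//.
exact: norm_tilt.
Qed.

Let norm_mean q : weights q -> `|\sum_i q i *: p i| <= `|x0| + D.
Proof.
move=> [q0 q1]; apply: (le_trans (ler_norm_sum _ _ _)).
rewrite -[leRHS]mul1r -q1 mulr_suml; apply: ler_sum => i _.
rewrite normrZ (ger0_norm (q0 i)) ler_wpM2l//.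
by rewrite -[p i](subrK x0) (le_trans (ler_normD _ _))// addrC lerD2l.
Qed.

Let shift_slope q g : \sum_i q i *: p i + g *: slope q =
  \sum_i (q i * (1 + g * tilt a q i)) *: p i.
Proof.
rewrite /slope scaler_sumr -big_split /=; apply: eq_bigr => i _.
by rewrite scalerA -mulrCA -scalerDl [in RHS]mulrDr mulr1.
Qed.

(* For |g| <= 1 the tilted weights are still weights and the induction hypothesis
   applies at x + g z and x - g z; on the event |g| > 1 any quadratic bound on f is
   absorbed in C g^4, whose expectation is O (h^2). *)
Lemma decay_iter : exists2 E, 0 <= E & forall h n q, 0 <= h -> rate * h <= 1 -> weights q ->
  iter n (opT h) f (\sum_i q i *: p i) <=
  \sum_i q i * f (p i) + K * (1 - rate * h) ^+ n * overlap q + n%:R * (E * h ^+ 2).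
Proof.
have [Kf Kf0 fK] := lq_quad lf.
(* An empty family carries no weights of sum 1; a nonempty one has a point, which forces D >= 0. *)
have [m0|m0] := posnP m.
  exists 0 => // h n q _ _ [_ q1]; exfalso; move: q1.
  rewrite big1 => [/esym/eqP|i _]; first by rewrite oner_eq0.
  by exfalso; have := ltn_ord i; rewrite {2}m0.
have D0 : 0 <= D by rewrite (le_trans _ (pD (Ordinal m0))).
pose M := `|x0| + D + c * m%:R * D.
have M0 : 0 <= M by rewrite /M !addr_ge0// !mulr_ge0.
(* One term for each contribution when |g| > 1: the growth of [F], the lower bound b0 on [A], and
   the quadratic gain, which is then an obstacle. *)
pose C := Kf * (1 + M ^+ 2) + `|b0| + K * m%:R ^+ 2 * (c ^+ 2 / 8).
have C0 : 0 <= C by rewrite /C !addr_ge0// ?mulr_ge0// ?addr_ge0 ?sqr_ge0.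
have g40 : 0 <= gmoment R 4.
  have [_] := incr_moment hW i0 (lexx 0) ler01 (isT : (0 < 2 <= 3)%N).
  rewrite subr0 expr1n mul1r => <-; apply: mean_ge0 => w.
  exact: exprn_even_ge0.
exists (C * gmoment R 4); first exact: mulr_ge0.
move=> h + + h0 rh; elim=> [|n IH] q wq.
  by rewrite /= expr0 mulr1 mul0r addr0; exact: hJ.
have [q0 q1] := wq.
set F := iter n (opT h) f in IH *.
have lF : lq F by exact: lq_iter.
have rn0 : 0 <= K * (1 - rate * h) ^+ n by rewrite mulr_ge0// exprn_ge0// subr_ge0.
have rnK : K * (1 - rate * h) ^+ n <= K.
  rewrite ler_piMr// exprn_ile1// ?subr_ge0// gerBl mulr_ge0//.
  by rewrite /rate !mulr_ge0// ?sqr_ge0// ltW// gmoment2_gt0.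
set k := K * _ in rn0 rnK IH.
rewrite [iter _ _ _ _]/= -/F.
have cs : ctl (line_ctl i0 (slope q)).
  apply: ctl_line; apply: le_trans cD; rewrite ler_wpM2l// ler_sqr ?nnegrE//.
    exact: norm_slope.
  by rewrite !mulr_ge0.
apply: (le_trans (opT_le_cost _ _ h0 lF cs)) => //.
pose A := \sum_i q i * f (p i) + k * overlap q + n%:R * (C * gmoment R 4 * h ^+ 2).
apply: (le_trans (@cost_line_sym _ _ _ _ _ _ hW i0 F h _ _ A (k * overlap q * (c ^+ 2 / 8)) C h0 lF _)).
  move=> g; have g4 : 0 <= g ^+ 4 by exact: exprn_even_ge0.
  have Ab0 : b0 <= A.
    rewrite /A -addrA (le_trans _ (_ : \sum_i q i * f (p i) <= _))//.
      by rewrite -[leLHS]mul1r -[X in X * _]q1 mulr_suml; apply: ler_sum => i _; rewrite ler_wpM2l.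
    have ov0 := overlap_ge0 q; by rewrite lerDl addr_ge0//; [exact: mulr_ge0|rewrite !mulr_ge0// sqr_ge0].
  have [g1|g1] := lerP `|g| 1.
    have t1 i : `|tilt a q i| <= 1 by apply: le_trans cm1; exact: norm_tilt.
    have g1' : `|- g| <= 1 by rewrite normrN.
    have := IH _ (weights_tilt wq t1 g1); have := IH _ (weights_tilt wq t1 g1').
    rewrite -!shift_slope scaleNr.
    have ov := ler_wpM2l rn0 (overlap_tilt wq t1 g1 c0 a_gap).
    have sf : \sum_i q i * (1 + g * tilt a q i) * f (p i) +
        \sum_i q i * (1 + - g * tilt a q i) * f (p i) = 2 * \sum_i q i * f (p i).
      rewrite -big_split mulr_sumr /=; apply: eq_bigr => i _; ring.
    move: ov sf; rewrite mulrDr /A.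
    set y1 := F _; set y2 := F _; set s1 := \sum_i _; set s2 := \sum_i _.
    set o1 := k * _; set o2 := k * _; set o := overlap q.
    have Ck : 0 <= C * g ^+ 4 by rewrite mulr_ge0.
    set N := n%:R * (_ * _); set S := \sum_i _; move: Ck.
    move: (C * g ^+ 4) N S o s1 s2 o1 o2 y1 y2 => Cg N S o s1 s2 o1 o2 y1 y2.
    lra.
  have g2 : 1 <= g ^+ 2 by rewrite -real_normK ?num_real// exprn_ege1// ltW.
  have g42 : g ^+ 2 <= g ^+ 4 by rewrite [leRHS](exprD g 2 2) ler_peMr// sqr_ge0.
  have g41 := le_trans g2 g42.
  have far y : `|y| <= `|g| * M -> F y <= Kf * (1 + M ^+ 2) * g ^+ 4.
    move=> yM; apply: (le_trans (iter_le hW h0 n y lf)).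
    apply: (le_trans (ler_norm _)); apply: (le_trans (fK y)).
    rewrite -mulrA ler_wpM2l// mulrDl mul1r lerD//.
    apply: (@le_trans _ _ ((`|g| * M) ^+ 2)); first by rewrite ler_sqr ?nnegrE ?mulr_ge0.
    by rewrite exprMn real_normK ?num_real// mulrC ler_wpM2l ?sqr_ge0.
  have hM : `|\sum_i q i *: p i| + `|g *: slope q| <= `|g| * M.
    rewrite /M mulrDr normrZ lerD//; last by rewrite ler_wpM2l// norm_slope.
    by rewrite (le_trans (norm_mean wq))// ler_peMl ?addr_ge0// ltW.
  have := far _ (le_trans (ler_normD _ _) hM); have := far _ (le_trans (ler_normB _ _) hM).
  have hb : - `|b0| * g ^+ 4 <= b0.
    have := ler_norm (- b0); rewrite normrN => hn.
    have := ler_wpM2l (normr_ge0 b0) g41; rewrite mulr1 mulNr.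
    move: (`|b0| * _) => z; lra.
  have hV : k * overlap q * (c ^+ 2 / 8) * g ^+ 2 <= K * m%:R ^+ 2 * (c ^+ 2 / 8) * g ^+ 4.
    have c8 : 0 <= c ^+ 2 / 8 by rewrite mulr_ge0// sqr_ge0.
    have ov0 := overlap_ge0 q; apply: ler_pM => //; [by apply: mulr_ge0 => //; exact: mulr_ge0|exact: sqr_ge0|].
    apply: ler_wpM2r => //; apply: ler_pM => //; exact: overlap_le.
  move: hV hb Ab0; rewrite /C mulNr [X in _ <= 2 * (_ + X)]mulrDl.
  rewrite [X in _ <= 2 * (_ + (X + _))]mulrDl.
  move: (k * _ * _ * _) (K * _ * _ * _) (`|b0| * _) (Kf * _ * _) A (F _) (F _).
  move=> {}A {}rn0 ? ? ? ? ?; lra.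
rewrite /A (exprS (1 - rate * h)) -[n.+1%:R]natr1 /k /rate.
move: ((1 - _) ^+ n) (gmoment R 4) (overlap q) (\sum_i _) => r g4 o S.
rewrite le_eqVlt; apply/orP; left; apply/eqP; by field.
Qed.

End decay.

(** Expanding at the barycentre x cancels the linear terms. The remainders are controlled since |p_i
    - x| <= 2 D \sum_(j <> i) q_j and q_i q_j <= sqrt (q_i q_j). *)
Lemma jensen_overlap (R : realType) (d m : nat) (p : 'I_m -> 'rV[R]_d) x0 (f : 'rV[R]_d -> R) L D q :
  0 <= L -> (forall x, exists a : 'rV[R]_d, forall y,
    f x + ((y - x) *m a^T) 0 0 - L * `|y - x| ^+ 2 <= f y) ->
  (forall i, `|p i - x0| <= D) -> weights q ->
  f (\sum_i q i *: p i) <= \sum_i q i * f (p i) + L * (2 * D) ^+ 2 * overlap q.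
Proof.
move=> L0 hf pD wq; have [q0 q1] := wq.
set x := \sum_i _; have [a ha] := hf x.
have qx : \sum_i q i *: (p i - x) = 0.
  under eq_bigr do rewrite scalerBr.
  by rewrite sumrB -scaler_suml q1 scale1r subrr.
have pp i j : `|p i - p j| <= 2 * D.
  rewrite -[p i](subrK x0) -addrA -[x0 - _]opprB.
  by rewrite (le_trans (ler_normB _ _))// mulr_natl mulr2n lerD.
have dist i : `|p i - x| ^+ 2 <= (2 * D) ^+ 2 * \sum_(j | j != i) q j.
  have D0 : 0 <= 2 * D by apply: le_trans (pp i i).
  have s0 : 0 <= \sum_(j | j != i) q j by apply: sumr_ge0.
  have s1 : \sum_(j | j != i) q j <= 1 by rewrite -q1 [leRHS](bigD1 i)//= lerDr.
  have h : `|p i - x| <= 2 * D * \sum_(j | j != i) q j.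
    have -> : p i - x = \sum_j q j *: (p i - p j).
      under eq_bigr do rewrite scalerBr.
      by rewrite sumrB -scaler_suml q1 scale1r.
    apply: (le_trans (ler_norm_sum _ _ _)).
    rewrite (bigD1 i)//= subrr scaler0 normr0 add0r mulr_sumr.
    by apply: ler_sum => j _; rewrite normrZ (ger0_norm (q0 j)) mulrC ler_wpM2r.
  apply: (@le_trans _ _ ((2 * D * \sum_(j | j != i) q j) ^+ 2)).
    by rewrite ler_sqr ?nnegrE// mulr_ge0.
  by rewrite exprMn ler_wpM2l ?sqr_ge0// expr2 ler_piMr//.
have ov : \sum_i q i * \sum_(j | j != i) q j <= overlap q.
  apply: ler_sum => i _; rewrite mulr_sumr; apply: ler_sum => j _.
  have qq0 : 0 <= q i * q j by rewrite mulr_ge0.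
  rewrite -ler_sqr ?nnegrE ?sqrtr_ge0// sqr_sqrtr// expr2 ler_piMl//.
  by rewrite mulr_ile1// weights_le1.
apply: (@le_trans _ _ (\sum_i q i * (f (p i) - ((p i - x) *m a^T) 0 0 + L * `|p i - x| ^+ 2))).
  rewrite -[leLHS]mul1r -[X in X * _]q1 mulr_suml; apply: ler_sum => i _.
  by rewrite ler_wpM2l//; have := ha (p i); lra.
under eq_bigr do rewrite mulrDr mulrBr.
rewrite big_split sumrB /= -!addrA lerD2l.
have -> : \sum_i q i * ((p i - x) *m a^T) 0 0 = 0.
  transitivity ((0 *m a^T : 'M[R]_1) 0 0); last by rewrite mul0mx mxE.
  rewrite -qx mulmx_suml summxE; apply: eq_bigr => i _.
  by rewrite -scalemxAl [RHS]mxE.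
rewrite oppr0 add0r.
apply: (@le_trans _ _ (L * (2 * D) ^+ 2 * \sum_i q i * \sum_(j | j != i) q j)).
  rewrite mulr_sumr; apply: ler_sum => i _.
  rewrite mulrCA -[leRHS]mulrA ler_wpM2l// [leRHS]mulrCA ler_wpM2l//; exact: dist.
by rewrite ler_wpM2l// mulr_ge0// sqr_ge0.
Qed.

Section limval_decay.
Context (R : realType) (d : nat) (dO : measure_display)
  (Omega : measurableType dO) (P : probability Omega R)
  (W : R -> Omega -> 'rV[R]_d) (hW : standard_brownian_motion P W) (i0 : 'I_d).
Local Notation vec := 'rV[R]_d.
Variables (u0 : vec -> R) (c0 b0 L R0 : R).
Hypotheses (lu0 : lq u0) (c0_ge0 : 0 <= c0)
  (hc0 : forall h x, 0 <= h -> u0 x - c0 * h <= opT P W h u0 x)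
  (hb0 : forall x, b0 <= u0 x) (L0 : 0 <= L)
  (hsub : forall x, exists a : vec, forall y,
    u0 x + ((y - x) *m a^T) 0 0 - L * `|y - x| ^+ 2 <= u0 y)
  (R00 : 0 < R0) (hR0 : forall y, R0 < `|y| -> u0 y = convex_envelope u0 y).

(** The points, the weights and the error constant [E] depend on [x] and on the tolerance, whereas
    [K] and the rate depend on the bound [D] only; [E] disappears as the number of steps grows. *)
Lemma limval_decay : exists C lam : R, [/\ 0 <= C, 0 < lam &
  forall t x, 0 <= t -> `|x| <= R0 ->
    limval P W u0 t x <= convex_envelope u0 x + C * expR (- (lam * t))].
Proof.
have d0 : 0 < d%:R :> R by rewrite ltr0n (leq_ltn_trans (leq0n i0)).
have d1 : 1 <= d%:R :> R by rewrite ler1n -(ltr0n R).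
pose D := 2 * R0 + 1.
have D0 : 0 < D by rewrite addr_gt0// mulr_gt0.
pose m := d.+1; have m0 : 0 < m%:R :> R by rewrite ltr0n.
(* Thus c m = 1 / (d (D + 1)), small enough both for tilts bounded by 1 and for the slope to define
   a matrix in [ctl]. *)
pose c := (m%:R * (d%:R * (D + 1)))^-1.
have D10 : 0 < D + 1 by rewrite addr_gt0.
have c0' : 0 < c by rewrite invr_gt0 !mulr_gt0.
have cmE : c * m%:R = (d%:R * (D + 1))^-1 by rewrite /c; field; rewrite !gt_eqF.
have cm1 : c * m%:R <= 1.
  by rewrite cmE invf_le1 ?mulr_gt0// mulr_ege1// lerDr ltW.
have cD : d%:R * (c * m%:R * D) ^+ 2 <= 2.
  have -> : d%:R * (c * m%:R * D) ^+ 2 = d%:R^-1 * (D / (D + 1)) ^+ 2.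
    by rewrite cmE; field; rewrite !gt_eqF.
  apply: (@le_trans _ _ 1); last by rewrite ler1n.
  rewrite mulr_ile1 ?sqr_ge0 ?invr_ge0 ?invf_le1 ?(ltW d0)// exprn_ile1 ?divr_ge0 ?(ltW D0) ?(ltW D10)//.
  by rewrite ler_pdivrMr// mul1r lerDl.
pose K := L * (2 * D) ^+ 2.
have K0 : 0 <= K by rewrite mulr_ge0// sqr_ge0.
pose rate := c ^+ 2 * gmoment R 2 / 8.
have rate0 : 0 < rate by rewrite !mulr_gt0 ?gmoment2_gt0.
exists (K * m%:R ^+ 2), rate; split => //; first by rewrite mulr_ge0// sqr_ge0.
move=> t x t0 xR0; apply/ler_addgt0Pr => e e0.
have e2 : 0 < e / 2 by rewrite divr_gt0.
have [q [p [q0 q1 qx pD qf]]] := near_combo hb0 R00 xR0 e2 hR0.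
have wq : weights q by [].
have hJ q' : weights q' -> u0 (\sum_i q' i *: p i) <= \sum_i q' i * u0 (p i) + K * overlap q'.
  by move=> wq'; apply: jensen_overlap pD wq'.
have [E E0 hE] := decay_iter hW i0 lu0 hb0 K0 (ltW c0') pD hJ cm1 cD.
(* So many steps that the contraction factor is nonnegative and the accumulated error E t^2 / N is
   at most e / 2. *)
have [N N0 hN] : exists2 N, (0 < N)%N & rate * t + E * t ^+ 2 * (e / 2)^-1 < N%:R.
  exists (Num.truncn (rate * t + E * t ^+ 2 * (e / 2)^-1)).+1 => //.
  exact: truncnS_gt.
have N0' : 0 < N%:R :> R by rewrite ltr0n.
have Et0 : 0 <= E * t ^+ 2 by rewrite mulr_ge0// sqr_ge0.
have rt0 : 0 <= rate * t by rewrite mulr_ge0// ltW.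
have h0 : 0 <= t / N%:R by rewrite divr_ge0// ltW.
have rh : rate * (t / N%:R) <= 1.
  rewrite mulrA ler_pdivrMr// mul1r (le_trans _ (ltW hN))// lerDl mulr_ge0//.
  by rewrite invr_ge0 ltW.
have := hE _ N q h0 rh wq; rewrite qx.
move/(le_trans (limval_le_iter hW lu0 c0_ge0 hc0 hb0 x t0 N0)) => /le_trans; apply.
have NE : N%:R * (E * (t / N%:R) ^+ 2) <= e / 2.
  have -> : N%:R * (E * (t / N%:R) ^+ 2) = E * t ^+ 2 / N%:R by field; rewrite gt_eqF.
  by rewrite ler_pdivrMr// [leRHS]mulrC -ler_pdivrMr// (le_trans _ (ltW hN))// lerDr.
have dec : K * (1 - rate * (t / N%:R)) ^+ N * overlap q <= K * m%:R ^+ 2 * expR (- (rate * t)).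
  rewrite [leLHS]mulrAC; apply: ler_pM.
  - by rewrite mulr_ge0// overlap_ge0.
  - by rewrite exprn_ge0// subr_ge0.
  - by rewrite ler_wpM2l// overlap_le.
  apply: (@le_trans _ _ (expR (- (rate * (t / N%:R))) ^+ N)).
    rewrite lerXn2r ?nnegrE ?expR_ge0 ?subr_ge0//.
    exact: expR_ge1Dx.
  rewrite -expRM_natl (_ : N%:R * _ = - (rate * t))//.
  by field; rewrite gt_eqF.
move: qf NE dec; rewrite [X in _ <= _ + X]splitr.
move: (\sum_i _) (N%:R * _) (K * _ * _) (K * _ * _) => a1 a2 a3 a4; lra.
Qed.

End limval_decay.

(** Prolong the segment from [x] through [y] up to distance r = 1 + |x| + |y|: semiconcavity along
    it, with the quadratic growth at both ends, bounds f x - f y by a multiple of r |x - y|. *)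
Lemma lq_semiconcave (R : realType) (V : normedModType R) (f : V -> R) L Q :
  0 <= L -> semiconcave L f -> (forall x, `|f x| <= Q * (1 + `|x| ^+ 2)) -> lq f.
Proof.
move=> L0 sc fQ.
have Q0 : 0 <= Q by have := le_trans (normr_ge0 _) (fQ 0); rewrite normr0 expr0n addr0 mulr1.
suff main x y : f x - f y <= (7 * Q + L) * (1 + `|x| + `|y|) * `|x - y|.
  exists (7 * Q + L); first by rewrite addr_ge0// mulr_ge0.
  move=> x y; rewrite ler_norml main andbT lerNl opprB.
  by rewrite (le_trans (main y x))// distrC -!addrA [`|y| + _]addrC.
have [->|xy] := eqVneq x y; first by rewrite !subrr normr0 mulr0.
set r := 1 + `|x| + `|y|; set dl := `|x - y|.
have dl0 : 0 < dl by rewrite normr_gt0 subr_eq0.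
have r1 : 1 <= r by rewrite /r -addrA lerDl addr_ge0.
have r0 : 0 < r by exact: lt_le_trans r1.
have dlr : dl <= r.
  by rewrite (le_trans (ler_normB _ _))// /r -addrA lerDr.
pose s := dl / r.
have s0 : 0 < s by rewrite divr_gt0.
have s1 : s <= 1 by rewrite ler_pdivrMr// mul1r.
pose z := x + s^-1 *: (y - x).
have zy : (1 - s) *: x + s *: z = y.
  rewrite /z scalerDr scalerA mulfV ?gt_eqF// scale1r addrA -scalerDl subrK scale1r.
  by rewrite addrC subrK.
have xz : `|x - z| = r.
  rewrite /z opprD addrA subrr add0r normrN normrZ distrC ger0_norm ?invr_ge0 ?(ltW s0)//.
  by rewrite -/dl /s; field; rewrite !gt_eqF.
have s01 : 0 <= s <= 1 by rewrite (ltW s0).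
have := sc x z s s01; rewrite zy xz => h.
have hz : `|z| <= 2 * r.
  rewrite -[z](subrK x) (le_trans (ler_normD _ _))// distrC xz mulr_natl mulr2n lerD2l.
  by rewrite /r -addrA addrCA lerDl addr_ge0.
have fx : f x <= Q * (2 * r ^+ 2).
  rewrite (le_trans (ler_norm _))// (le_trans (fQ _))// ler_wpM2l//.
  rewrite mulr_natl mulr2n lerD ?exprn_ege1// ler_sqr ?nnegrE ?(ltW r0)//.
  by rewrite /r -addrA addrCA lerDl addr_ge0.
have fz : - f z <= Q * (5 * r ^+ 2).
  rewrite (le_trans (ler_norm _))// normrN (le_trans (fQ _))// ler_wpM2l//.
  have : `|z| ^+ 2 <= (2 * r) ^+ 2 by rewrite ler_sqr ?nnegrE// mulr_ge0// ltW.
  have : 1 <= r ^+ 2 by rewrite exprn_ege1.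
  rewrite exprMn; move: (`|z| ^+ 2) (r ^+ 2) => a b; lra.
have E : (7 * Q + L) * r * dl = s * (Q * (2 * r ^+ 2) + Q * (5 * r ^+ 2) + L * r ^+ 2).
  by rewrite /s; field; rewrite gt_eqF.
rewrite E; apply: (@le_trans _ _ (s * (f x + - f z + L * r ^+ 2))); last first.
  by rewrite ler_wpM2l ?(ltW s0)// lerD2r lerD.
have : L * (s * (1 - s)) * r ^+ 2 <= s * (L * r ^+ 2).
  rewrite [leRHS](_ : _ = L * s * r ^+ 2); last by ring.
  by rewrite ler_wpM2r ?sqr_ge0// ler_wpM2l// ler_piMr ?(ltW s0)// gerBl ltW.
move: h; move: (L * _ * _) => w; move: (L * r ^+ 2) => q; nra.
Qed.

(** * Regularity *)

Section semiconvex.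
Context (R : realType) (d : nat) (dO : measure_display)
  (Omega : measurableType dO) (P : probability Omega R)
  (W : R -> Omega -> 'rV[R]_d) (hW : standard_brownian_motion P W) (i0 : 'I_d).
Local Notation vec := 'rV[R]_d.
Variables (U : vec -> R) (c0 t : R).
Hypotheses (lU : lq U) (t0 : 0 < t) (c00 : 0 <= c0)
  (drift : forall j x s, ctl s ->
    U x - c0 * (t / (2 ^ j)%:R) <= cost P W (t / (2 ^ j)%:R) U x s).

(* If U lies below a parabola of opening -B through x in direction z, running the
   diffusion along z loses B h E[g^2] + O (h^2), whereas it can lose at most c0 h. *)
Lemma touching_drift x z B e : 0 < e -> 0 <= B -> d%:R * `|z| ^+ 2 <= 2 ->
  (forall g, `|g| <= e -> U (x + g *: z) + U (x - g *: z) <= 2 * (U x - B * g ^+ 2)) ->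
  B * gmoment R 2 <= c0.
Proof.
move=> e0 B0 hz hU.
have [Q Q0 fQ] := lq_quad lU.
pose A0 := Q * (1 + 2 * `|x| ^+ 2) + `|U x|.
pose A1 := Q * (2 * `|z| ^+ 2) + B.
have A00 : 0 <= A0 by rewrite addr_ge0// mulr_ge0// addr_ge0// mulr_ge0// sqr_ge0.
have A10 : 0 <= A1 by rewrite addr_ge0// mulr_ge0// mulr_ge0// sqr_ge0.
(* For |g| > e, the two terms of C g^4 dominate A0 and A1 g^2, which bound the quadratic growth of
   [U] and the parabola. *)
pose C := A0 / e ^+ 4 + A1 / e ^+ 2.
have C0 : 0 <= C by rewrite addr_ge0// divr_ge0// exprn_ge0// ltW.
have hC g : U (x + g *: z) + U (x - g *: z) <= 2 * (U x - B * g ^+ 2 + C * g ^+ 4).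
  have g40 : 0 <= g ^+ 4 by exact: exprn_even_ge0.
  have [ge|eg] := lerP `|g| e.
    apply: (le_trans (hU g ge)); rewrite ler_wpM2l// lerDl mulr_ge0//.
  have far y : `|y| <= `|x| + `|g| * `|z| -> U y <= Q * (1 + 2 * `|x| ^+ 2) + Q * (2 * `|z| ^+ 2) * g ^+ 2.
    move=> hy; apply: (le_trans (ler_norm _)); apply: (le_trans (fQ _)).
    rewrite -mulrA -mulrDr ler_wpM2l// -addrA lerD2l.
    apply: (@le_trans _ _ ((`|x| + `|g| * `|z|) ^+ 2)).
      by rewrite ler_sqr ?nnegrE ?addr_ge0 ?mulr_ge0.
    apply: (le_trans (sqrD_le _ _)); rewrite lerD2l exprMn real_normK ?num_real//.
    by rewrite [leRHS]mulrAC mulrA.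
  have n1 : `|x + g *: z| <= `|x| + `|g| * `|z| by rewrite -normrZ ler_normD.
  have n2 : `|x - g *: z| <= `|x| + `|g| * `|z| by rewrite -normrZ ler_normB.
  have := far _ n1; have := far _ n2.
  have h2 : e ^+ 2 <= g ^+ 2.
    by rewrite -[leRHS]real_normK ?num_real// ler_sqr ?nnegrE// ltW.
  have h4 : e ^+ 4 <= g ^+ 4 by rewrite !(exprD _ 2 2) ler_pM// ?sqr_ge0.
  have e2 : 0 < e ^+ 2 by rewrite exprn_gt0.
  have e4 : 0 < e ^+ 4 by rewrite exprn_gt0.
  have k0 : A0 <= A0 / e ^+ 4 * g ^+ 4.
    by rewrite -mulrA ler_peMr// mulrC ler_pdivlMr// mul1r.
  have k1 : A1 * g ^+ 2 <= A1 / e ^+ 2 * g ^+ 4.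
    rewrite -mulrA ler_wpM2l// mulrC (exprD g 2 2) -mulrA ler_peMr ?sqr_ge0//.
    by rewrite ler_pdivlMr// mul1r.
  have ux := ler_norm (- U x); rewrite normrN in ux.
  have CE : C * g ^+ 4 = A0 / e ^+ 4 * g ^+ 4 + A1 / e ^+ 2 * g ^+ 4 by rewrite -mulrDl.
  have A1E : A1 * g ^+ 2 = Q * (2 * `|z| ^+ 2) * g ^+ 2 + B * g ^+ 2 by rewrite -mulrDl.
  rewrite CE; move: k0 k1 ux; rewrite A1E /A0.
  move: (Q * (1 + _)) (Q * _ * _) (B * _) => q1 q2 q3.
  move: (U x) `|U x| (U (x + _)) (U (x - _)) (A1 / _ * _) ((q1 + _) / _ * _) => ? ? ? ? ? ?; lra.
have cs := ctl_line i0 hz.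
have key j : B * gmoment R 2 - c0 <= C * gmoment R 4 * (t / (2 ^ j)%:R).
  have h0 : 0 < t / (2 ^ j)%:R by rewrite divr_gt0// ltr0n expn_gt0.
  have := le_trans (drift j x cs) (cost_line_sym hW i0 (ltW h0) lU hC).
  move: (t / _) h0 => h h0 hh.
  rewrite -(ler_pM2r h0); move: hh; rewrite expr2; move: (U x) => u; nra.
rewrite -subr_le0 leNgt; apply/negP => pos.
have g40 : 0 <= gmoment R 4.
  have [_] := incr_moment hW i0 (lexx 0) ler01 (isT : (0 < 2 <= 3)%N).
  rewrite subr0 expr1n mul1r => <-; apply: mean_ge0 => w; exact: exprn_even_ge0.
set dl := _ - c0 in pos key.
have [j hj] : exists j, C * gmoment R 4 * t / dl < (2 ^ j)%:R.
  exists (Num.truncn (C * gmoment R 4 * t / dl)).+1.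
  rewrite (lt_trans (truncnS_gt _))// ltr_nat; exact: ltn_expl.
have := key j; rewrite mulrA leNgt => /negP; apply.
by rewrite ltr_pdivrMr ?ltr0n ?expn_gt0// [ltRHS]mulrC -ltr_pdivrMr.
Qed.

(* Otherwise U minus its affine interpolation plus M q^2 has an interior maximum on
   some segment, to which [touching_drift] applies. *)
Lemma semiconvex_drift : semiconcave (d%:R ^+ 2 * (c0 + 1) / gmoment R 2) (fun x => - U x).
Proof.
set L := d%:R ^+ 2 * _ / _ => a b r r01.
have d0 : 0 < d%:R :> R by rewrite ltr0n (leq_ltn_trans (leq0n i0)).
have gm := gmoment2_gt0 R.
have c10 : 0 < c0 + 1 by rewrite ltr_wpDl.
have L0 : 0 < L by rewrite divr_gt0// mulr_gt0// exprn_gt0.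
have [<-|ab] := eqVneq a b.
  by rewrite subrr normr0 expr0n mulr0 subr0 -mulrDl subrK mul1r -scalerDl subrK scale1r.
pose z := b - a; have z0 : 0 < `|z| by rewrite normr_gt0 subr_eq0 eq_sym.
have lineE q : (1 - q) *: a + q *: b = a + q *: z.
  by rewrite /z scalerBr scalerBl scale1r addrA addrAC.
pose M := L * `|z| ^+ 2.
(* This is [U] minus its affine interpolation minus M q (1 - q): it vanishes at both ends, and the
   claim is psi r <= 0. *)
pose psi q := U (a + q *: z) - (U a + q * (U b - U a + M)) + M * q ^+ 2.
have psi0 : psi 0 = 0 by rewrite /psi scale0r addr0 mul0r addr0 subrr expr0n mulr0 addr0.
have psi1 : psi 1 = 0.
  rewrite /psi scale1r /z (addrC a) subrK; move: (U a) (U b) => ? ?; ring.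
suff : psi r <= 0.
  have ME : L * (r * (1 - r)) * `|z| ^+ 2 = M * (r * (1 - r)) by rewrite /M mulrAC.
  rewrite lineE distrC -/z /psi ME.
  move=> h; rewrite -subr_ge0; apply: le_trans (_ : 0 - (U (a + r *: z) - (U a + r * (U b - U a + M)) + M * r ^+ 2) <= _).
    by rewrite subr_ge0.
  by rewrite le_eqVlt; apply/orP; left; apply/eqP; ring.
have cpsi : {within `[0, 1], continuous psi}.
  apply: continuous_subspaceT => q; apply: cvgD; first apply: cvgB.
  - have lUl : lq (fun q : R^o => U (a + (q : R) *: z)).
      apply: (lq_comp (V := R^o) (h := fun q : R^o => a + (q : R) *: z) (C := `|z|)) => // x y.
      by rewrite opprD addrACA subrr add0r -scalerBl normrZ mulrC.
    exact: (lq_continuous lUl).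
  - by apply: cvgD; [exact: cvg_cst|apply: cvgM; [exact: cvg_id|exact: cvg_cst]].
  - by apply: cvgM; [exact: cvg_cst|exact: exprn_continuous].
have [rm rm01 hmax] := EVT_max ler01 cpsi.
move: rm01; rewrite in_itv/= => /andP[]; rewrite le_eqVlt => /predU1P[rmE _|rm0].
  by have := hmax r; rewrite -rmE psi0; apply; rewrite in_itv.
rewrite le_eqVlt => /predU1P[rm1|rm1].
  by have := hmax r; rewrite rm1 psi1; apply; rewrite in_itv.
exfalso.
(* Scales the direction so that d |c z|^2 = 1 / d, within the range of [ctl_line]. *)
pose c := (d%:R * `|z|)^-1.
have c0' : 0 < c by rewrite invr_gt0 mulr_gt0.
pose e := Num.min rm (1 - rm) / c.
have e0 : 0 < e by rewrite divr_gt0// lt_min rm0 subr_gt0.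
(* In the scaled direction the curvature M becomes L / d^2; the value of [L] makes the left side
   equal to c0 + 1, a contradiction. *)
have : L / d%:R ^+ 2 * gmoment R 2 <= c0.
  apply: (@touching_drift (a + rm *: z) (c *: z) _ e) => //.
  - by rewrite divr_ge0// ?sqr_ge0// ltW.
  - rewrite normrZ (gtr0_norm c0') /c.
    have -> : d%:R * ((d%:R * `|z|)^-1 * `|z|) ^+ 2 = d%:R^-1 by field; rewrite !gt_eqF.
    rewrite (@le_trans _ _ 1)// ?ler1n// invf_le1// ler1n -(ltr0n R)//.
  move=> g ge.
  have : `|g * c| <= Num.min rm (1 - rm) by rewrite normrM (gtr0_norm c0') -ler_pdivlMr.
  rewrite le_min !ler_norml => /andP[/andP[g1 g2] /andP[g3 g4]].
  have h1 := hmax (rm + g * c); have h2 := hmax (rm - g * c).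
  move: h1 h2; rewrite !in_itv/= => h1 h2.
  have {}h1 : psi (rm + g * c) <= psi rm by apply: h1; lra.
  have {}h2 : psi (rm - g * c) <= psi rm by apply: h2; lra.
  have E : L / d%:R ^+ 2 * g ^+ 2 = M * (g * c) ^+ 2 by rewrite /M /c; field; rewrite !gt_eqF.
  rewrite E !scalerA -!addrA -scalerDl -scalerBl.
  move: h1 h2; rewrite /psi; move: (U _) (U _) (U _) (U a) (U b) => ? ? ? ? ?; nra.
have -> : L / d%:R ^+ 2 * gmoment R 2 = c0 + 1 by rewrite /L; field; rewrite !gt_eqF.
by rewrite -subr_ge0 opprD addrA subrr; lra.
Qed.

End semiconvex.

(** * First order expansions and gradients *)

Section expansions.
Context (R : realType) (d : nat).
Local Notation vec := 'rV[R]_d.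
Implicit Types (f : vec -> R) (x y z p h : vec) (C L : R).

Definition dot z p : R := (z *m p^T) 0 0.

Definition expansion C f x p := forall h, `|f (x + h) - f x - dot h p| <= C * `|h| ^+ 2.

Lemma dotE z p : dot z p = \sum_i z 0 i * p 0 i.
Proof. by rewrite /dot mxE; apply: eq_bigr => i _; rewrite mxE. Qed.

Lemma dotDl y z p : dot (y + z) p = dot y p + dot z p.
Proof. by rewrite /dot mulmxDl mxE. Qed.

Lemma dotZl (a : R) z p : dot (a *: z) p = a * dot z p.
Proof. by rewrite /dot -scalemxAl mxE. Qed.

Lemma dotNl z p : dot (- z) p = - dot z p.
Proof. by rewrite /dot mulNmx mxE. Qed.

Lemma dotBr z p y : dot z (p - y) = dot z p - dot z y.
Proof. by rewrite /dot linearB/= mulmxBr !mxE. Qed.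

Lemma norm_dot z p : `|dot z p| <= d%:R * `|z| * `|p|.
Proof. by rewrite (le_trans (mx_entry_le _ _ _))// (le_trans (mulmx_norm_le _ _))// norm_trmx. Qed.

Lemma dot_enorm x : dot x x = enorm x ^+ 2.
Proof. by rewrite dotE enorm_sq; apply: eq_bigr => i _; rewrite expr2. Qed.

Lemma norm_le_enorm x : `|x| <= enorm x.
Proof. by rewrite -ler_sqr ?nnegrE ?sqrtr_ge0// enorm_sq norm_row_sq. Qed.

Lemma enorm_le x : enorm x <= d%:R * `|x|.
Proof.
have [d0|d0] := posnP d.
  rewrite /enorm big1 ?sqrtr0 ?mulr_ge0// => i; by exfalso; have := ltn_ord i; rewrite {2}d0.
rewrite -ler_sqr ?nnegrE ?sqrtr_ge0 ?mulr_ge0//.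
rewrite -dot_enorm (le_trans (ler_norm _))// (le_trans (norm_dot _ _))//.
rewrite exprMn -mulrA -expr2 ler_wpM2r ?sqr_ge0// expr2 ler_peMl// ler1n//.
Qed.

Lemma continuous_dot p : continuous (dot ^~ p).
Proof.
apply: (@lq_continuous _ _ (dot ^~ p)); exists (d%:R * `|p|); first by rewrite mulr_ge0.
move=> x y; rewrite -[- dot y p]dotNl -dotDl (le_trans (norm_dot _ _))//.
rewrite mulrAC ler_wpM2r// ler_peMr ?mulr_ge0//.
by rewrite -addrA lerDl addr_ge0.
Qed.

Lemma expansion_diff C f x p : 0 <= C -> expansion C f x p ->
  differentiable f x /\ gradient f x = p.
Proof.
move=> C0 ep.
have lin : linear (dot ^~ p : vec -> R^o) by move=> a y z; rewrite dotDl dotZl.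
pose linM := GRing.isLinear.Build _ _ _ _ _ lin.
pose df : {linear vec -> R^o} := HB.pack (dot ^~ p : vec -> R^o) linM.
have Df : (f : vec -> R^o) \o shift x = cst (f x : R^o) + df +o_ (0 : vec) id.
  apply/eqaddoP => _/posnumP[e]; near=> h.
  rewrite /= opprD addrA.
  rewrite -[X in `|X|]/(f (h + x) - f x - dot h p) [h + x]addrC.
  rewrite (le_trans (ep h))// expr2 mulrA ler_wpM2r//.
  have : `|h| <= e%:num / (C + 1).
    by near: h; apply: (@nbhs0_le _ vec); rewrite divr_gt0// ltr_wpDl.
  have C1 : 0 < C + 1 by rewrite ltr_wpDl.
  rewrite ler_pdivlMr// => he; rewrite (le_trans _ he)// mulrC ler_wpM2l// lerDl//.
have cdf : continuous df by exact: continuous_dot.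
have dE := diff_unique cdf Df.
have diff : differentiable f x by apply/diff_locallyP; rewrite dE.
split => //; apply/rowP => i; rewrite mxE deriveE// dE /= dotE.
rewrite (bigD1 i)//= big1 => [|j ji]; rewrite mxE eqxx.
  by rewrite eqxx mul1r addr0.
by rewrite (negbTE ji) mul0r.
Unshelve. all: by end_near. Qed.

(** Mean value theorem along the segment, then the Lipschitz bound on the gradient; the powers of d
    convert between the sup and Euclidean norms. *)
Lemma C11_expansion f : C11 f -> exists2 C, 0 <= C & forall x, expansion C f x (gradient f x).
Proof.
move=> [df [L hL]]; exists (d%:R * (`|L| * d%:R)); first by rewrite !mulr_ge0.
move=> x z.
have dfE y : 'd f y z = dot z (gradient f y).
  rewrite {1}[z]row_sum_delta linear_sum dotE; apply: eq_bigr => i _.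
  by rewrite linearZ/= mxE deriveE.
pose phi (r : R) := f (x + r *: z).
have deriv (s : R) : is_derive s (1 : R) (phi : R -> R) (dot z (gradient f (x + s *: z))).
  have E : (fun r : R => r^-1 *: ((phi \o shift s) (r *: (1 : R)) - phi s)) =
    (fun r : R => r^-1 *: ((f \o shift (x + s *: z)) (r *: z) - f (x + s *: z))).
    apply/funext => r; rewrite /phi /= [r *: 1]mulr1 scalerDl.
    by congr (_ *: (f _ - _)); rewrite addrCA.
  split; first by rewrite /derivable E; exact: diff_derivable.
  rewrite /derive E -/(derive f (x + s *: z) z) deriveE//; exact: dfE.
have cphi : {within `[0, 1], continuous phi}.
  apply: continuous_subspaceT => s; apply: differentiable_continuous.
  apply/derivable1_diffP; exact: ex_derive.
have [s s01] := MVT_segment ler01 (fun s _ => deriv s) cphi.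
rewrite /phi scale1r scale0r addr0 subr0 mulr1 => ->.
rewrite -dotBr (le_trans (norm_dot _ _))//.
rewrite -mulrA -mulrA ler_wpM2l// expr2 mulrCA ler_wpM2l//.
rewrite (le_trans (norm_le_enorm _))// (le_trans (hL _ _))//.
rewrite addrAC subrr add0r -mulrA; apply: (@le_trans _ _ (`|L| * enorm (s *: z))).
  by rewrite ler_wpM2r ?sqrtr_ge0// ler_norm.
rewrite ler_wpM2l// (le_trans (enorm_le _))// ler_wpM2l// normrZ ler_piMl//.
by move: s01; rewrite in_itv/= => /andP[s0 s1]; rewrite ger0_norm.
Qed.

(** Expand at the intermediate point: the first order terms cancel, and the remainders add up to C s
    (1 - s) |x - y|^2 since (1 - s) s^2 + s (1 - s)^2 = s (1 - s). *)
Lemma expansion_semiconcave C f : (forall x, exists p, expansion C f x p) ->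
  semiconcave C f /\ semiconcave C (fun x => - f x).
Proof.
move=> ef.
have main (x y : vec) (s : R) : 0 <= s <= 1 ->
    `|(1 - s) * f x + s * f y - f ((1 - s) *: x + s *: y)| <= C * (s * (1 - s)) * `|x - y| ^+ 2.
  move=> /andP[s0 s1]; have s1' : 0 <= 1 - s by rewrite subr_ge0.
  set c := (1 - s) *: x + s *: y; have [p hp] := ef c.
  have ex : x = c + s *: (x - y).
    by rewrite /c scalerBr addrA addrAC addrK -scalerDl subrK scale1r.
  have ey : y = c + - ((1 - s) *: (x - y)).
    by rewrite /c scalerBr opprB addrC addrA subrK -scalerDl subrK scale1r.
  have := hp (s *: (x - y)); have := hp (- ((1 - s) *: (x - y))).
  rewrite -ex -ey normrN !normrZ (ger0_norm s0) (ger0_norm s1') dotNl !dotZl.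
  move: (dot _ p) (f x) (f y) (f c) => q a b e h1 h2.
  have -> : (1 - s) * a + s * b - e = s * (b - e - - ((1 - s) * q)) + (1 - s) * (a - e - s * q) by ring.
  rewrite (le_trans (ler_normD _ _))// !normrM (ger0_norm s0) (ger0_norm s1').
  apply: (le_trans (lerD (ler_wpM2l s0 h1) (ler_wpM2l s1' h2))).
  by rewrite le_eqVlt; apply/orP; left; apply/eqP; ring.
split=> x y s s01; have := main x y s s01; rewrite ler_norml => /andP[].
  by move: (C * _ * _) ((1 - s) * _ + _) (f (_ + _)) => a b e; lra.
by rewrite !mulrN; move: (C * _ * _) ((1 - s) * _) (s * f _) (f (_ + _)) => a b e g; lra.
Qed.

End expansions.

(* [phi] is f (x + _) - f x for a function f both semiconcave and semiconvex; its
   dyadic difference quotients converge to a linear form. *)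
Section tangent.
Context (R : realType) (d : nat).
Local Notation vec := 'rV[R]_d.
Variables (phi : vec -> R) (L : R).
Hypotheses (L0 : 0 <= L) (phi0 : phi 0 = 0)
  (hphi : forall (a b : vec) (s : R), 0 <= s <= 1 ->
    `|(1 - s) * phi a + s * phi b - phi ((1 - s) *: a + s *: b)| <=
    L * (s * (1 - s)) * `|a - b| ^+ 2).

Let eps n : R := 2^-1 ^+ n.
Let quo n (a : vec) : R := phi (eps n *: a) / eps n.
Let tan (a : vec) : R := limn (quo ^~ a).

Let eps_gt0 n : 0 < eps n. Proof. by rewrite exprn_gt0// invr_gt0. Qed.

Let eps_le1 n : eps n <= 1.
Proof. by rewrite exprn_ile1 ?invr_ge0 ?invf_le1// ler1n. Qed.

Let epsS n : eps n.+1 = eps n / 2. Proof. by rewrite /eps exprS mulrC. Qed.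

Let half01 : 0 <= (2^-1 : R) <= 1.
Proof. by rewrite invr_ge0 ler0n invf_le1// ler1n. Qed.

Let quoS n a : `|quo n.+1 a - quo n a| <= L / 2 * eps n * `|a| ^+ 2.
Proof.
have := hphi 0 (eps n *: a) half01.
rewrite scaler0 add0r phi0 mulr0 add0r sub0r normrN normrZ (gtr0_norm (eps_gt0 n)).
have e0 := eps_gt0 n; have eS : eps n.+1 *: a = 2^-1 *: (eps n *: a).
  by rewrite scalerA epsS mulrC.
rewrite /quo eS epsS; move: (phi _) (phi _) => y x h.
have -> : y / (eps n / 2) - x / eps n = - (2 / eps n) * (2^-1 * x - y).
  by field; rewrite gt_eqF.
rewrite normrM normrN (gtr0_norm (divr_gt0 (ltr0n R 2) e0)).
have := ler_wpM2l (ltW (divr_gt0 (ltr0n R 2) e0)) h.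
move/le_trans; apply; rewrite le_eqVlt; apply/orP; left; apply/eqP.
by field; rewrite gt_eqF.
Qed.

Let quo_phi n a : `|quo n a - phi a| <= L * `|a| ^+ 2 * (1 - eps n).
Proof.
elim: n => [|n IH]; first by rewrite /quo /eps expr0 scale1r divr1 !subrr normr0 mulr0.
rewrite -[quo n.+1 a](subrK (quo n a)) -addrA (le_trans (ler_normD _ _))//.
apply: (le_trans (lerD (quoS n a) IH)); rewrite epsS.
by rewrite le_eqVlt; apply/orP; left; apply/eqP; field.
Qed.

(** By [quoS], adding L |a|^2 eps n makes the quotients nonincreasing, and [quo_phi] bounds them
    from below; the added term tends to 0. *)
Let cvg_quo a : quo n a @[n --> \oo] --> tan a.
Proof.
pose r n := quo n a + L * `|a| ^+ 2 * eps n.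
have La : 0 <= L * `|a| ^+ 2 by rewrite mulr_ge0// sqr_ge0.
have ceps : eps n @[n --> \oo] --> 0.
  by apply: cvg_expr; rewrite ger0_norm ?invr_ge0// invf_lt1// ltr1n.
have cr : cvgn r.
  apply: nonincreasing_is_cvgn.
    apply/nonincreasing_seqP => n; rewrite /r epsS.
    have := ler_norm (quo n.+1 a - quo n a); have := quoS n a.
    move: (quo _ a) (quo _ a) `|_ - _| => q1 q2 w.
    rewrite mulrAC [L / 2 * _]mulrAC; move: (L * `|a| ^+ 2) (eps n) => K e; lra.
  exists (phi a - L * `|a| ^+ 2) => _ [n _ <-].
  have := quo_phi n a; rewrite ler_norml => /andP[+ _].
  have := mulr_ge0 La (ltW (eps_gt0 n)).
  rewrite /r; move: (quo n a) (phi a) (L * `|a| ^+ 2) (eps n) => q z K e; lra.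
suff : cvgn (quo ^~ a) by [].
rewrite (_ : quo ^~ a = fun n => r n - L * `|a| ^+ 2 * eps n); last first.
  by apply/funext => n; rewrite /r addrK.
apply: is_cvgB => //; apply: is_cvgM; first exact: is_cvg_cst.
by apply/cvg_ex; exists 0.
Qed.

Let tan_phi a : `|tan a - phi a| <= L * `|a| ^+ 2.
Proof.
have c : `|quo n a - phi a| @[n --> \oo] --> `|tan a - phi a|.
  by apply: cvg_norm; apply: cvgB; [exact: cvg_quo|exact: cvg_cst].
apply: (ler_cvg_to c (cvg_cst (L * `|a| ^+ 2))); near=> n.
rewrite (le_trans (quo_phi n a))// ler_piMr ?mulr_ge0 ?sqr_ge0// gerBl ltW//.
Unshelve. all: by end_near. Qed.

Let tan0 : tan 0 = 0.
Proof. by apply/eqP; rewrite -normr_le0; have := tan_phi 0; rewrite phi0 subr0 normr0 expr0n mulr0. Qed.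

(** The affine defect of [phi] at scale eps n is of order eps n squared, so it still tends to 0
    after division by eps n. *)
Let tan_affine a b s : 0 <= s <= 1 -> tan ((1 - s) *: a + s *: b) = (1 - s) * tan a + s * tan b.
Proof.
move=> s01; have /andP[s0 s1] := s01; apply/eqP; rewrite -subr_eq0 -normr_le0 distrC.
have ceps : eps n @[n --> \oo] --> 0.
  by apply: cvg_expr; rewrite ger0_norm ?invr_ge0// invf_lt1// ltr1n.
have c : `|(1 - s) * quo n a + s * quo n b - quo n ((1 - s) *: a + s *: b)| @[n --> \oo] -->
    `|(1 - s) * tan a + s * tan b - tan ((1 - s) *: a + s *: b)|.
  apply: cvg_norm; apply: cvgB; last exact: cvg_quo.
  by apply: cvgD; apply: cvgM; try exact: cvg_cst; exact: cvg_quo.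
have c' : L * (s * (1 - s)) * `|a - b| ^+ 2 * eps n @[n --> \oo] --> 0.
  by rewrite -[X in _ --> X](mulr0 (L * (s * (1 - s)) * `|a - b| ^+ 2)); apply: cvgM => //; exact: cvg_cst.
apply: (ler_cvg_to c c'); near=> n.
have := hphi (eps n *: a) (eps n *: b) s01.
rewrite !scalerA ![_ * eps n]mulrC -!scalerA -scalerDr -scalerBr normrZ (gtr0_norm (eps_gt0 n)).
rewrite /quo; move: (phi _) (phi _) (phi _) => z y x h.
have -> : (1 - s) * (x / eps n) + s * (y / eps n) - z / eps n =
  (eps n)^-1 * ((1 - s) * x + s * y - z) by ring.
have e0 := eps_gt0 n.
rewrite normrM gtr0_norm ?invr_gt0// ler_pdivrMl// (le_trans h)//.
by rewrite le_eqVlt; apply/orP; left; apply/eqP; ring.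
Unshelve. all: by end_near. Qed.

Let tanZ01 s a : 0 <= s <= 1 -> tan (s *: a) = s * tan a.
Proof. by move=> s01; have := tan_affine 0 a s01; rewrite scaler0 add0r tan0 mulr0 add0r. Qed.

Let tanD a b : tan (a + b) = tan a + tan b.
Proof.
have e : 1 - 2^-1 = 2^-1 :> R by field.
have := tan_affine a b half01; rewrite e -scalerDr tanZ01// -mulrDr.
by apply: mulfI; rewrite invr_eq0.
Qed.

Let tanZ s a : tan (s *: a) = s * tan a.
Proof.
have pos r : 0 <= r -> tan (r *: a) = r * tan a.
  move=> r0; have [r1|r1] := leP r 1; first by apply: tanZ01; rewrite r0.
  have r0' : 0 < r by exact: lt_trans r1.
  have ir : 0 <= r^-1 <= 1 by rewrite invr_ge0 r0 invf_le1// ltW.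
  have := tanZ01 (r *: a) ir; rewrite scalerA mulVf ?gt_eqF// scale1r => ->.
  by rewrite mulVKf ?gt_eqF.
have [s0|s0] := leP 0 s; first exact: pos.
have := tanD (s *: a) (- s *: a); rewrite -scalerDl subrr scale0r tan0.
rewrite (pos (- s)) ?oppr_ge0 ?(ltW s0)// mulNr => /esym/eqP; rewrite addr_eq0 opprK => /eqP.
by [].
Qed.

Lemma tangent : exists p : vec, forall a, `|phi a - dot a p| <= L * `|a| ^+ 2.
Proof.
exists (\row_i tan (delta_mx 0 i)) => a.
rewrite distrC (_ : dot _ _ = tan a); first exact: tan_phi.
rewrite dotE [in RHS](row_sum_delta a) (big_morph tan tanD tan0).
by apply: eq_bigr => i _; rewrite tanZ mxE.
Qed.

End tangent.

Section gaps.
Context (R : realType) (d : nat).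
Local Notation vec := 'rV[R]_d.
Implicit Types (f g : vec -> R).

Lemma semiconcave_expansion f L : 0 <= L -> semiconcave L f -> semiconcave L (fun x => - f x) ->
  forall x, exists p, expansion L f x p.
Proof.
move=> L0 sc sc' x.
have := @tangent R d (fun a => f (x + a) - f x) L L0; rewrite addr0 subrr; apply=> //.
move=> a b s s01; have := sc (x + a) (x + b) s s01; have := sc' (x + a) (x + b) s s01.
have -> : (1 - s) *: (x + a) + s *: (x + b) = x + ((1 - s) *: a + s *: b).
  by rewrite !scalerDr addrACA -scalerDl subrK scale1r.
rewrite opprD addrACA subrr add0r ler_norml.
move: (f (x + (_ + _))) (f (x + a)) (f (x + b)) (f x) (L * _ * _) => c u v w z h1 h2.
apply/andP; split; lra.
Qed.

(* Evaluate the nonnegative function f - g at x - (p - q) / (4 C). *)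
Lemma gradient_gap f g x p q C M : 0 < C -> expansion C f x p -> expansion C g x q ->
  (forall y, 0 <= f y - g y <= M) -> enorm (p - q) ^+ 2 <= 8 * C * M.
Proof.
move=> C0 ef eg fg.
pose r := p - q; pose tau := (4 * C)^-1.
have tau0 : 0 < tau by rewrite invr_gt0 mulr_gt0.
have := ef (- (tau *: r)); have := eg (- (tau *: r)).
have /andP[h1 _] := fg (x - tau *: r); have /andP[_ h2] := fg x.
have rE : dot r p - dot r q = enorm r ^+ 2 by rewrite -dotBr dot_enorm.
have nr : `|- (tau *: r)| ^+ 2 <= tau ^+ 2 * enorm r ^+ 2.
  rewrite normrN normrZ exprMn (gtr0_norm tau0) ler_wpM2l ?sqr_ge0//.
  by rewrite ler_sqr ?nnegrE ?sqrtr_ge0// norm_le_enorm.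
rewrite !dotNl !dotZl.
have {nr} := ler_wpM2l (ltW C0) nr.
rewrite -rE.
have -> : C * (tau ^+ 2 * (dot r p - dot r q)) = tau * (dot r p - dot r q) / 4.
  by rewrite /tau; field; rewrite gt_eqF.
move: h1 h2; rewrite -/r; move: (f _) (f x) (g _) (g x) (C * _) => f1 f0 g1 g0 Z h1 h2 hZ.
rewrite !ler_norml => /andP[k1 k2] /andP[k3 k4].
have T : tau * (dot r p - dot r q) / 2 <= M by move: hZ k1 k2 k3 k4; rewrite mulrBr; lra.
have -> : dot r p - dot r q = 8 * C * (tau * (dot r p - dot r q) / 2).
  by rewrite /tau; field; rewrite gt_eqF.
by rewrite ler_wpM2l// mulr_ge0// ltW.
Qed.

Lemma Linfty_norm_le f M : (0 < d)%N -> 0 <= M -> (forall x, `|f x| <= M) ->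
  (Linfty_norm f <= M%:E)%E.
Proof.
move=> d0 M0 fM; apply: ereal_inf_lbound; exists M => //; split => //.
(* The exceptional set is empty, so boxes reduced to a point cover it; their volume is 0 because d >
   0, an empty product being 1. *)
move=> e e0; exists (fun=> 0), (fun=> 0); split.
- by move=> k i; rewrite lexx.
- by move=> x /=; rewrite ltNge fM.
- rewrite eseries0 => [|k _ _]; first by rewrite lee_fin ltW.
  rewrite (bigD1 (Ordinal d0))//= !mxE subrr mul0r//.
Qed.

End gaps.

Lemma semiconcave_le (R : realType) (V : normedModType R) (f : V -> R) (L M : R) :
  L <= M -> semiconcave L f -> semiconcave M f.
Proof.
move=> LM sc x y s s01; apply: le_trans (sc x y s s01); rewrite lerD2l lerN2.
have /andP[s0 s1] := s01.
by rewrite ler_wpM2r ?sqr_ge0// ler_wpM2r// mulr_ge0// subr_ge0.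
Qed.

Section growth.
Context (R : realType) (d : nat).
Variables (f : 'rV[R]_d -> R) (L : R) (p : 'rV[R]_d).
Hypotheses (L0 : 0 <= L) (ep : expansion L f 0 p).

Lemma expansion_quad : exists Q, forall x, `|f x| <= Q * (1 + `|x| ^+ 2).
Proof.
exists (`|f 0| + d%:R * `|p| + L) => x.
have := ep x; rewrite add0r => h.
have -> : f x = (f x - f 0 - dot x p) + f 0 + dot x p by ring.
have h1 := le_trans (ler_normD _ (dot x p)) (lerD (le_trans (ler_normD _ (f 0)) (lerD h (lexx _))) (norm_dot x p)).
apply: (le_trans h1).
have dp0 : 0 <= d%:R * `|p| by rewrite mulr_ge0.
have := normr_ge0 (f 0); have := sqr_ge0 (`|x| - 1).
rewrite mulrAC; move: dp0 L0; move: (d%:R * `|p|) `|f 0| `|x| L; clear => a b c e *; nra.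
Qed.

(** Superlinearity at slope 0 makes [f] nonnegative far away; on the remaining ball the expansion at
    0 bounds it from below. *)
Lemma superlinear_lower : superlinear f -> exists b, forall x, b <= f x.
Proof.
move=> /(_ 0) [r hr].
pose r' := Num.max r 0; have r0 : 0 <= r' by rewrite le_max lexx orbT.
pose b := f 0 - d%:R * r' * `|p| - L * r' ^+ 2.
exists (Num.min 0 b) => x.
have [xr|xr] := lerP (enorm x) r'.
  rewrite ge_min; apply/orP; right.
  have xr' : `|x| <= r' := le_trans (norm_le_enorm x) xr.
  have := ep x; rewrite add0r ler_norml => /andP[h _].
  have h1 : - (d%:R * r' * `|p|) <= dot x p.
    rewrite lerNl (le_trans (ler_norm _))// normrN (le_trans (norm_dot _ _))//.
    by rewrite ler_wpM2r// ler_wpM2l.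
  have h2 : L * `|x| ^+ 2 <= L * r' ^+ 2 by rewrite ler_wpM2l// ler_sqr ?nnegrE.
  move: h h1 h2; rewrite /b.
  move: (f x) (f 0) (dot x p) (d%:R * _ * _) (L * _) (L * _) => *; lra.
rewrite ge_min; apply/orP; left.
have rx : r < enorm x by apply: le_lt_trans xr; rewrite le_max lexx.
have x0 : 0 < enorm x by exact: le_lt_trans xr.
by have := hr x rx; rewrite pmulr_lge0// invr_gt0.
Qed.

End growth.

Theorem theorem5p3 (R : realType) (d : nat) (hd : (1 <= d)%N)
    (dO : measure_display) (Omega : measurableType dO) (P : probability Omega R)
    (W : R -> Omega -> 'rV[R]_d) (hW : standard_brownian_motion P W)
    (u0 : 'rV[R]_d -> R) (hC11 : C11 u0) (hsup : superlinear u0)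
    (henv : exists R0 : R, 0 < R0 /\
      forall x, R0 < enorm x -> u0 x = convex_envelope u0 x) :
  let u := value_function P W u0 in
  let v := convex_envelope u0 in
  [/\ forall x, differentiable v x,
      forall (t : R) x, 0 <= t -> differentiable (u t) x &
      exists C lambda : R,
        [/\ 0 <= C, 0 < lambda,
            forall t : R, 0 <= t ->
              (Linfty_norm (fun x => (u t x - v x)%R)
                 <= (C * expR (- (lambda * t)))%:E)%E &
            forall t : R, 0 <= t ->
              (Linfty_norm (fun x => enorm (gradient (u t) x - gradient v x)%R)
                 <= (C * expR (- (lambda * t)))%:E)%E]].
Proof.
move=> u v.
have i0 : 'I_d := Ordinal hd.
have [L L0 eu] := C11_expansion hC11.
have [sc scN] : semiconcave L u0 /\ semiconcave L (fun x => - u0 x).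
  by apply: expansion_semiconcave => x; exists (gradient u0 x).
have [b0 hb0] := superlinear_lower L0 (eu 0) hsup.
have [Q hQ] := expansion_quad L0 (eu 0).
have lu0 : lq u0 by exact: lq_semiconcave L0 sc hQ.
pose c0 := L * kap R d.
have c00 : 0 <= c0 by rewrite mulr_ge0// kap_ge0.
have hc0 h x : 0 <= h -> u0 x - c0 * h <= opT P W h u0 x.
  move=> h0; apply: opT_sym_lower => // b.
  have := eu x b; have := eu x (- b); rewrite normrN dotNl !ler_norml.
  move: (u0 (x + b)) (u0 (x - b)) (u0 x) (dot b _) (L * _) => p q r s w.
  by move=> /andP[k1 _] /andP[k2 _]; lra.
have hsub x : exists a : 'rV[R]_d, forall y,
    u0 x + ((y - x) *m a^T) 0 0 - L * `|y - x| ^+ 2 <= u0 y.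
  exists (gradient u0 x) => y; have := eu x (y - x).
  rewrite (addrC x) subrK ler_norml -/(dot _ _) => /andP[+ _].
  by move: (u0 y) (u0 x) (dot _ _) (L * _) => p q r s; lra.
have [R0 [R00 hR0]] := henv.
(* The sup norm is at most the Euclidean norm, so the hypothesis carries over to sup-norm balls,
   which are used from here on. *)
have hR0' y : R0 < `|y| -> u0 y = v y.
  by move=> h; apply: hR0; apply: lt_le_trans h (norm_le_enorm y).
have [C [lam [C0 lam0 hC]]] := limval_decay hW i0 lu0 c00 hc0 hb0 L0 hsub R00 hR0'.
pose U := limval P W u0.
have uE t : 0 <= t -> u t = U t.
  move=> t0; apply/funext => x; exact: (value_functionE hW lu0 c00 hc0 hb0).
have vU t x : 0 <= t -> v x <= U t x.
  move=> t0; apply: (limval_ge hW lu0 hb0) => // [y|y b]; first exact: (envelope_le hb0).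
  exact: (envelope_midpoint hb0).
have Uu t x : 0 <= t -> U t x <= u0 x by move=> t0; exact: (limval_le_u0 hW lu0 hb0).
have gap t x : 0 <= t -> 0 <= U t x - v x <= C * expR (- (lam * t)).
  move=> t0; rewrite subr_ge0 vU//= lerBlDl.
  (* Outside the ball, u0^** equals u0, which is above [U t]. *)
  have [xR|xR] := lerP `|x| R0; first exact: hC.
  by rewrite (le_trans (Uu t x t0))// hR0'// lerDl mulr_ge0// expR_ge0.
have scU t : 0 <= t -> semiconcave L (U t).
  by move=> t0; exact: (limval_semiconcave hW lu0 hb0).
(* [v] is the limit of [U t] as t tends to infinity, and the constant [L] is the same for all t. *)
have scv : semiconcave L v.
  move=> x y s s01; have /andP[s0 s1] := s01; apply/ler_addgt0Pr => e e0.
  have [t t0 te] : exists2 t, 0 <= t & C * expR (- (lam * t)) <= e.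
    (* By exp y >= y at y = C / e. *)
    exists (C / e / lam); first by rewrite !divr_ge0// ltW.
    have -> : lam * (C / e / lam) = C / e by field; rewrite !gt_eqF.
    rewrite expRN ler_pdivrMr ?expR_gt0// mulrC -ler_pdivrMr//.
    by apply: le_trans (expR_ge1Dx _); rewrite lerDr.
  have := scU t t0 x y s s01.
  have /andP[k1 k2] := gap t ((1 - s) *: x + s *: y) t0.
  have a1 : (1 - s) * v x <= (1 - s) * U t x by rewrite ler_wpM2l ?subr_ge0// vU.
  have a2 : s * v y <= s * U t y by rewrite ler_wpM2l// vU.
  move: a1 a2 k1 k2 te; move: (C * _) (L * _ * _) ((1 - s) * v x) ((1 - s) * U t x).
  move: (s * v y) (s * U t y) (U t _) (v _) => *; lra.
have scvN : semiconcave L (fun x => - v x).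
  apply: (semiconcave_le L0) => x y s s01; rewrite !mul0r subr0 !mulrN -opprD lerN2.
  exact: (envelope_convex hb0).
(* One constant for both semiconcavity and semiconvexity; the + 1 makes it positive, as
   [gradient_gap] requires. *)
pose M := Num.max L (d%:R ^+ 2 * (c0 + 1) / gmoment R 2) + 1.
have LM : L <= M by rewrite (@le_trans _ _ (Num.max L (d%:R ^+ 2 * (c0 + 1) / gmoment R 2))) ?le_max ?lexx ?lerDl.
have M0 : 0 < M.
  by rewrite ltr_wpDl// le_max L0.
have scUN t : 0 <= t -> semiconcave M (fun x => - U t x).
  (* [semiconvex_drift] needs time steps of positive length; at t = 0 the function is u0 itself. *)
  rewrite le_eqVlt => /predU1P[<-|t0].
    have -> : U 0 = u0.
      apply/funext => x; apply/eqP; rewrite eq_le Uu//=; apply: (limval_glb hW lu0 hb0) => // m.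
      by rewrite /dyadic mul0r iter_opT0.
    exact: semiconcave_le LM scN.
  have lU : lq (U t).
    have Q0 : 0 <= Q by have := le_trans (normr_ge0 _) (hQ 0); rewrite normr0 expr0n addr0 mulr1.
    apply: (@lq_semiconcave _ _ _ L (Q + `|b0|)) => //; first by apply: scU; exact: ltW.
    move=> x; have x1 : 1 <= 1 + `|x| ^+ 2 by rewrite lerDl sqr_ge0.
    have bU : b0 <= U t x := le_trans (envelope_ge hb0 x) (vU t x (ltW t0)).
    have Ub : U t x <= Q * (1 + `|x| ^+ 2).
      exact: le_trans (Uu t x (ltW t0)) (le_trans (ler_norm _) (hQ x)).
    have bx : `|b0| <= `|b0| * (1 + `|x| ^+ 2) by rewrite ler_peMr.
    have nb := ler_norm (- b0); rewrite normrN in nb.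
    have Qx : 0 <= Q * (1 + `|x| ^+ 2) by rewrite mulr_ge0// (le_trans ler01).
    have b00 := normr_ge0 b0; move: bU Ub bx nb Qx b00; rewrite mulrDl.
    move: (Q * _) `|b0| (`|b0| * _) (U t x) => k1 k2 k3 k4 *.
    by rewrite ler_norml; apply/andP; split; lra.
  apply: semiconcave_le (semiconvex_drift hW i0 lU t0 c00 _); last first.
    move=> j x s cs; have [_] := limval_time_lip hW lu0 hc0 hb0 j x (ltW t0) cs.
    exact.
  by rewrite /M (@le_trans _ _ (Num.max L (d%:R ^+ 2 * (c0 + 1) / gmoment R 2))) ?le_max ?lexx ?orbT ?lerDl.
have eU t x : 0 <= t -> exists p, expansion M (U t) x p.
  by move=> t0; apply: semiconcave_expansion; [exact: ltW|exact: semiconcave_le LM (scU t t0)|exact: scUN].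
have ev x : exists p, expansion M v x p.
  apply: semiconcave_expansion; [exact: ltW| |]; exact: semiconcave_le LM _.
have dv x : differentiable v x by have [p /(expansion_diff (ltW M0)) []] := ev x.
split => // [t x t0|].
  by rewrite uE//; have [p /(expansion_diff (ltW M0)) []] := eU t x t0.
(* [gradient_gap] bounds the square of the gradient difference by 8 M times the gap; the square root
   halves the rate. *)
pose K := Num.sqrt (8 * M * C).
have K0 : 0 <= K by exact: sqrtr_ge0.
exists (C + K), (lam / 2); split => [||t t0|t t0].
- exact: addr_ge0.
- by rewrite divr_gt0.
- apply: Linfty_norm_le => //; first by rewrite mulr_ge0 ?addr_ge0 ?expR_ge0.
  move=> x; rewrite uE//; have /andP[g0 g1] := gap t x t0.
  rewrite ger0_norm// (le_trans g1)// ler_pM ?expR_ge0// ?lerDl// ler_expR lerN2.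
  by rewrite mulrAC ler_piMr ?invf_le1 ?ler1n// mulr_ge0// ltW.
- apply: Linfty_norm_le => //; first by rewrite mulr_ge0 ?addr_ge0 ?expR_ge0.
  move=> x; rewrite uE//.
  have [p ep] := eU t x t0; have [q eq] := ev x.
  have [_ ->] := expansion_diff (ltW M0) ep; have [_ ->] := expansion_diff (ltW M0) eq.
  have := gradient_gap M0 ep eq (fun y => gap t y t0).
  rewrite ger0_norm ?sqrtr_ge0// => h.
  apply: (@le_trans _ _ (K * expR (- (lam / 2 * t)))); last first.
    by rewrite ler_wpM2r ?expR_ge0// lerDr.
  rewrite -ler_sqr ?nnegrE ?sqrtr_ge0 ?mulr_ge0 ?expR_ge0// (le_trans h)//.
  rewrite exprMn sqr_sqrtr ?mulr_ge0 ?(ltW M0)// mulrA ler_wpM2l ?mulr_ge0 ?(ltW M0)//.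
  by rewrite -expRM_natl ler_expR le_eqVlt; apply/orP; left; apply/eqP; field.
Qed.
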